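(* Fix $M>0$. (i) If $X_1,\dots,X_n$ are i.i.d. from $P_0$, then $\lim_{n\to\infty}P\big(\tilde T_n\ge\sqrt{3\log\log n}\big)=0$. (ii) There exists a constant $c_1>0$ such that, whenever $\Delta_n(\theta)\ge c_1\big(n^{-1}\sqrt{\log\log n}\big)^{\frac{4s}{4s+\theta+1}}$ for all $\theta\ge0$, $$\lim_{n\to\infty}\inf_{P\in\bigcup_{\theta\ge0}\mathcal P(\Delta_n(\theta),\theta,M)}P\big(\tilde T_n\ge\sqrt{3\log\log n}\big)=1,$$ where under $P$ the sample $X_1,\dots,X_n$ is i.i.d. from $P$.
   Context: Standing setup. $(\mathcal X,\mathcal B)$ is a measurable space and $P_0$ a known probability measure on it. $K$ is a symmetric, positive semidefinite, square-integrable kernel, degenerate under $P_0$, with Mercer decomposition $K(x,x')=\sum_{k\ge1}\lambda_k\varphi_k(x)\varphi_k(x')$, infinitely many eigenvalues $\lambda_1>\lambda_2>\cdots>0$, $\{\varphi_k\}$ an orthonormal basis of the $P_0$-mean-zero functions in $L_2(P_0)$, $0<\liminf_k k^{2s}\lambda_k\le\limsup_k k^{2s}\lambda_k<\infty$ for some $s>1/2$, and $\sup_k\|\varphi_k\|_\infty<\infty$. $\mathcal H(K)$ is the RKHS of $K$, $\|f\|_K^2=\sum_k\lambda_k^{-1}\langle f,\varphi_k\rangle_{L_2(P_0)}^2$. $\mathcal F(\theta;M)$ ($\theta>0$) is the set of $f\in L_2(P_0)$ such that for every $R>0$ there is $f_R\in\mathcal H(K)$ with $\|f_R\|_K\le R$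 and $\|f-f_R\|_{L_2(P_0)}\le MR^{-1/\theta}$; $\mathcal F(0;M)=\{f\in\mathcal H(K):\|f\|_K\le M\}$. $\mathcal P(\Delta,\theta,M)$ is the set of probability measures $P\ll P_0$ with $u=dP/dP_0-1\in\mathcal F(\theta;M)$ and $\|u\|^2_{L_2(P_0)}\ge\Delta$. For $\varrho>0$: $\tilde K_\varrho(x,x')=\sum_k\frac{\lambda_k}{\lambda_k+\varrho^2}\varphi_k(x)\varphi_k(x')$, $\eta^2_\varrho(\widehat P_n,P_0)=\sum_k\frac{\lambda_k}{\lambda_k+\varrho^2}\big[\frac1n\sum_i\varphi_k(X_i)\big]^2$, $v_n(\varrho)=\sum_k\big(\frac{\lambda_k}{\lambda_k+\varrho^2}\big)^2$, $A_n(\varrho)=\frac1n\sum_i\tilde K_\varrho(X_i,X_i)$, and $T_{n,\varrho}=(2v_n(\varrho))^{-1/2}\big[n\eta^2_\varrho(\widehat P_n,P_0)-A_n(\varrho)\big]$. Let $\varrho_*=\big(\frac{\sqrt{\log\log n}}{n}\big)^{2s}$, $m_*=\big\lceil\log_2\big[\varrho_*^{-1}\big(\frac{\sqrt{\log\log n}}{n}\big)^{\frac{2s}{4s+1}}\big]\big\rceil$, and $\tilde T_n=\max_{0\le k\le m_*}T_{n,2^k\varrho_*}$. *)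

(* Defs.v *)
From HB Require Import structures.
From mathcomp Require Import all_boot all_order all_algebra.
From mathcomp Require Import all_classical all_reals all_analysis.
Set Implicit Arguments. Unset Strict Implicit. Unset Printing Implicit Defensive.
Import Order.TTheory GRing.Theory Num.Theory.
Import numFieldNormedType.Exports.
Local Open Scope classical_set_scope.
Local Open Scope ring_scope.

Section Defs.
Context {R : realType} {d : measure_display} {T : measurableType d}.

Definition rsum (a : nat -> R) : R := limn (fun N => \sum_(0 <= k < N) a k).

Definition L2 (P0 : probability T R) (f : T -> R) : Prop :=
  measurable_fun setT f /\ (\int[P0]_x ((f x) ^+ 2)%:E < +oo)%E.

Definition L2sq (P0 : probability T R) (f : T -> R) : R :=
  fine (\int[P0]_x ((f x) ^+ 2)%:E).
Definition L2norm (P0 : probability T R) (f : T -> R) : R := Num.sqrt (L2sq P0 f).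

Definition inner (P0 : probability T R) (f g : T -> R) : R :=
  fine (\int[P0]_x (f x * g x)%:E).

Definition mean0 (P0 : probability T R) (f : T -> R) : Prop :=
  (\int[P0]_x (f x)%:E = 0)%E.

(** Standing setup: Mercer data (lam_k, phi_k), k >= 1 encoded as index k-1. *)
Definition standing_setup (P0 : probability T R) (lam : nat -> R)
    (phi : nat -> T -> R) (s : R) : Prop :=
  [/\ (forall k, 0 < lam k) /\ (forall k, lam k.+1 < lam k),
      (forall k, measurable_fun setT (phi k)) /\
      (forall j k, inner P0 (phi j) (phi k) = (j == k)%:R) /\
      (forall k, mean0 P0 (phi k)),
      (* {phi_k} is an orthonormal BASIS of the mean-zero subspace of L_2(P0) *)
      (forall f, L2 P0 f -> mean0 P0 f ->
         (forall k, inner P0 f (phi k) = 0) -> L2sq P0 f = 0),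
      1 / 2 < s /\
      (0 < limn_einf (fun k => (((k.+1)%:R `^ (2 * s)) * lam k)%:E))%E /\
      (limn_esup (fun k => (((k.+1)%:R `^ (2 * s)) * lam k)%:E) < +oo)%E
    & exists B : R, forall k x, `|phi k x| <= B ].

(** squared RKHS norm ||f||_K^2 = sum_k lam_k^{-1} <f, phi_k>^2 (in [0, +oo]) *)
Definition Knorm2 (P0 : probability T R) (lam : nat -> R) (phi : nat -> T -> R)
    (f : T -> R) : \bar R :=
  (\sum_(0 <= k <oo) ((lam k)^-1 * (inner P0 f (phi k)) ^+ 2)%:E)%E.

Definition inH (P0 : probability T R) lam phi (f : T -> R) : Prop :=
  [/\ L2 P0 f, mean0 P0 f & (Knorm2 P0 lam phi f < +oo)%E].

Definition inF (P0 : probability T R) lam phi (theta M : R) (f : T -> R) : Prop :=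
  (theta = 0 /\ inH P0 lam phi f /\ (Knorm2 P0 lam phi f <= (M ^+ 2)%:E)%E) \/
  (0 < theta /\ L2 P0 f /\
   forall Rr : R, 0 < Rr -> exists fR : T -> R,
     [/\ inH P0 lam phi fR, (Knorm2 P0 lam phi fR <= (Rr ^+ 2)%:E)%E &
         L2norm P0 (fun x => f x - fR x) <= M * Rr `^ (- theta^-1)]).

Definition inCalP (P0 : probability T R) lam phi (Delta theta M : R)
    (P : probability T R) : Prop :=
  exists p : T -> R,
    [/\ measurable_fun setT p,
        (forall A, measurable A -> (P A = \int[P0]_(x in A) (p x)%:E)%E),
        inF P0 lam phi theta M (fun x => p x - 1)
      & Delta <= L2sq P0 (fun x => p x - 1)].

Definition iid_sample {d' : measure_display} {Om : measurableType d'}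
    (Q : probability Om R) (P : probability T R) (n : nat) (X : nat -> Om -> T) : Prop :=
  (forall i, measurable_fun setT (X i)) /\
  forall A : nat -> set T, (forall i, measurable (A i)) ->
    Q (\bigcap_(i in `I_n) (X i @^-1` A i)) = (\prod_(i < n) P (A i))%E.

(** the test statistic; x i = X_{i+1}, i < n *)
Definition wgt (lam : nat -> R) (rho : R) (k : nat) : R := lam k / (lam k + rho ^+ 2).

Definition Ktilde lam phi (rho : R) (x x' : T) : R :=
  rsum (fun k => wgt lam rho k * phi k x * phi k x').

Definition eta2 lam (phi : nat -> T -> R) (rho : R) (n : nat) (x : nat -> T) : R :=
  rsum (fun k => wgt lam rho k * (n%:R^-1 * \sum_(i < n) phi k (x i)) ^+ 2).

Definition vn lam (rho : R) : R := rsum (fun k => (wgt lam rho k) ^+ 2).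

Definition An lam phi (rho : R) (n : nat) (x : nat -> T) : R :=
  n%:R^-1 * \sum_(i < n) Ktilde lam phi rho (x i) (x i).

Definition Tstat lam phi (rho : R) (n : nat) (x : nat -> T) : R :=
  (Num.sqrt (2 * vn lam rho))^-1 * (n%:R * eta2 lam phi rho n x - An lam phi rho n x).

Definition loglog (n : nat) : R := ln (ln n%:R).

Definition rho_star (s : R) (n : nat) : R :=
  (Num.sqrt (loglog n) / n%:R) `^ (2 * s).

Definition int_to_nat (z : int) : nat := if z is Posz k then k else 0%N.

Definition m_star (s : R) (n : nat) : nat :=
  int_to_nat (Num.ceil
    (ln ((rho_star s n)^-1 * (Num.sqrt (loglog n) / n%:R) `^ (2 * s / (4 * s + 1)))
     / ln 2)).

Definition Ttilde lam phi (s : R) (n : nat) (x : nat -> T) : R :=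
  \big[Order.max/Tstat lam phi (rho_star s n) n x]_(0 <= k < (m_star s n).+1)
     Tstat lam phi (2 ^+ k * rho_star s n) n x.

End Defs.

(* Main.v *)
(**
Each T_(n,rho) is a degenerate U-statistic of order two with bounded kernel.

Under P0, truncating the martingale increments and using
exp y <= 1 + y + 6/11 y^2 for y <= 1/12 turns it into an exponential
supermartingale, so that P(T >= sqrt(3 loglog n)) <= (log n)^(-5/4) up to a
fourth-moment and a variance term. Only the fourth-moment term at the lowest
scales is not negligible, and it decays geometrically along the grid, so the first
sqrt(loglog n) scales are handled by Chebyshev's inequality instead. As
m_* = O(log n), a union bound gives (i).

Under P with u = dP/dP0 - 1, the mean of T is of order n G / sqrt(v) with
G = sum_k w_k <u, phi_k>^2. Approximating u in H(K) at the radius where the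
approximation error is |u|/6 gives G >= |u|^2/9 as soon as rho times that radius
is at most |u|/6. The separation condition says exactly that a grid point rho with
this property exists for which the null standard deviation is small compared with
the mean; the Hoeffding decomposition bounds the variance, and Chebyshev's
inequality gives an error O(1/sqrt(loglog n)) that is uniform in theta and P.
*)
Require Import Defs.
From HB Require Import structures.
From mathcomp Require Import all_boot all_order all_algebra.
From mathcomp Require Import all_classical all_reals all_analysis.
From mathcomp Require Import measurable_realfun ring lra.
Import Order.TTheory GRing.Theory Num.Theory.
Import numFieldNormedType.Exports.
Local Open Scope classical_set_scope.
Local Open Scope ring_scope.

Set Implicit Arguments.
Unset Strict Implicit.
Unset Printing Implicit Defensive.

(** * Bounded random variables *)

(** The sup-norm bound on a martingale increment grows like the square root of the effective
    dimension [rho ^ (-1/s)], up to n / sqrt(loglog n) on the grid, whereas an exponential bound at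
    level t needs increments of order 1/t. Hence the truncation, whose price is a fourth moment
    instead of a sup norm. The grid has about log n points, so at t^2 = 3 loglog n a tail exp(-kappa
    t^2) survives the union bound only if kappa > 1/3. The Gaussian value is 1/2; here kappa = 5/12,
    the loss being spent on the truncated exponential (6/11 in place of 1/2) and on the fluctuation
    of the conditional variances (11/10 in place of 1). The fourth-moment term at the k-th scale is
    of order loglog n * y^k with y = 2^(-1/s): useless for small k, but below every power of 1 /
    loglog n from k = sqrt(loglog n) on. Tail bounds are passed around as a bounded [Y >= 0] with
    [Y >= 1] on the event and a bound on its expectation, so that union bounds become sums of
    expectations. *)

Notation Ex P f := (Rintegral P [set: _] f).

(** The eigenfunctions are uniformly bounded and the weights summable, so every variable built from
    the sample is bounded. This class is closed under the operations used, and all expectations in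
    it are real numbers. *)
Definition bmf {d} {T : measurableType d} {R : realType} (f : T -> R) : Prop :=
  measurable_fun [set: T] f /\ exists C, forall x, `|f x| <= C.

Lemma bmf_comp {d1 d2} {U : measurableType d1} {T : measurableType d2} {R : realType}
  {g : U -> T} {f : T -> R} :
  bmf f -> measurable_fun setT g -> bmf (fun x => f (g x)).
Proof.
by move=> [mf [A fA]] mg; split; [exact: measurableT_comp | exists A].
Qed.

Section BoundedMeasurable.
Context {d} {T : measurableType d} {R : realType}.
Implicit Types f g : T -> R.

Lemma bmf_cst (a : R) : bmf (fun _ : T => a).
Proof. by split; [exact: measurable_cst | exists `|a|]. Qed.

Lemma bmfD f g : bmf f -> bmf g -> bmf (fun x => f x + g x).
Proof.
move=> [mf [A fA]] [mg [B gB]]; split; first exact: measurable_funD.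
by exists (A + B) => x; apply: le_trans (ler_normD _ _) _; exact: lerD.
Qed.

Lemma bmfM f g : bmf f -> bmf g -> bmf (fun x => f x * g x).
Proof.
move=> [mf [A fA]] [mg [B gB]]; split; first exact: measurable_funM.
by exists (A * B) => x; rewrite normrM ler_pM.
Qed.

Lemma bmfZ (a : R) f : bmf f -> bmf (fun x => a * f x).
Proof. by apply: bmfM; exact: bmf_cst. Qed.

Lemma bmfN f : bmf f -> bmf (fun x => - f x).
Proof.
move=> [mf [A fA]]; split; first exact: measurable_funN.
by exists A => x; rewrite normrN.
Qed.

Lemma bmfB f g : bmf f -> bmf g -> bmf (fun x => f x - g x).
Proof. by move=> bf bg; apply: bmfD => //; exact: bmfN. Qed.

Lemma bmfX n f : bmf f -> bmf (fun x => f x ^+ n).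
Proof.
move=> bf; elim: n => [|n ih]; first exact: bmf_cst.
under [X in bmf X]eq_fun do rewrite exprS.
exact: bmfM.
Qed.

Lemma bmf_sum (I : Type) (s : seq I) (F : I -> T -> R) :
  (forall i, bmf (F i)) -> bmf (fun x => \sum_(i <- s) F i x).
Proof.
move=> bF; elim: s => [|i s ih].
  by under [X in bmf X]eq_fun do rewrite big_nil; exact: bmf_cst.
under [X in bmf X]eq_fun do rewrite big_cons.
exact: bmfD.
Qed.

Lemma bmf_sum_nat m (F : nat -> T -> R) :
  (forall i, (i < m)%N -> bmf (F i)) -> bmf (fun x => \sum_(i < m) F i x).
Proof.
move=> bF; apply: (@bmf_sum 'I_m _ (fun i => F i)) => i; exact: bF.
Qed.

Lemma bmf_min f (a : R) : bmf f -> bmf (fun x => Num.min (f x) a).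
Proof.
move=> [mf [A fA]]; split; first by apply: measurable_minr => //; exact: measurable_cst.
exists (A + `|a|) => x; have A0 := le_trans (normr_ge0 _) (fA x).
by rewrite /Num.min; case: ifP => _; [rewrite ler_wpDr | rewrite ler_wpDl].
Qed.

Lemma bmf_expR f : bmf f -> bmf (fun x => expR (f x)).
Proof.
move=> [mf [A fA]]; split; first exact: measurableT_comp.
exists (expR A) => x; rewrite ger0_norm ?expR_ge0// ler_expR.
exact: le_trans (ler_norm _) (fA x).
Qed.

Variable P : probability T R.
Local Notation itg f := (P.-integrable [set: T] (EFin \o f)).

Lemma bmf_itg f : bmf f -> itg f.
Proof.
move=> [mf [C fC]]; apply: measurable_bounded_integrable => //.
  by apply: (@le_lt_trans _ _ 1%E); [exact: probability_le1 | exact: ltry].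
by exists C; split; [rewrite num_real | move=> M CM x _; exact: le_trans (fC x) (ltW CM)].
Qed.

Lemma Ex_cst (a : R) : Ex P (fun _ => a) = a.
Proof. by rewrite Rintegral_cst//= probability_setT/= mulr1. Qed.

Lemma ExD f g : itg f -> itg g -> Ex P (fun x => f x + g x) = Ex P f + Ex P g.
Proof. by move=> *; rewrite RintegralD. Qed.

Lemma ExB f g : itg f -> itg g -> Ex P (fun x => f x - g x) = Ex P f - Ex P g.
Proof. by move=> *; rewrite RintegralB. Qed.

Lemma ExZ (a : R) f : itg f -> Ex P (fun x => a * f x) = a * Ex P f.
Proof. by move=> *; rewrite RintegralZl. Qed.

Lemma Ex_le f g : itg f -> itg g -> (forall x, f x <= g x) -> Ex P f <= Ex P g.
Proof. by move=> *; apply: le_Rintegral. Qed.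

Lemma Ex_ge0 f : (forall x, 0 <= f x) -> 0 <= Ex P f.
Proof. by move=> f0; apply: Rintegral_ge0. Qed.

Lemma itgD f g : itg f -> itg g -> itg (fun x => f x + g x).
Proof. by move=> *; exact: (@integrableD _ _ _ P setT measurableT (EFin \o f) (EFin \o g)). Qed.

Lemma itgB f g : itg f -> itg g -> itg (fun x => f x - g x).
Proof. by move=> *; exact: (@integrableB _ _ _ P setT measurableT (EFin \o f) (EFin \o g)). Qed.

Lemma itgZ (a : R) f : itg f -> itg (fun x => a * f x).
Proof. by move=> *; exact: (@integrableZl _ _ _ P setT measurableT a (EFin \o f)). Qed.

Lemma Ex_sum (I : Type) (s : seq I) (F : I -> T -> R) : (forall i, itg (F i)) ->
  itg (fun x => \sum_(i <- s) F i x) /\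
  Ex P (fun x => \sum_(i <- s) F i x) = \sum_(i <- s) Ex P (F i).
Proof.
move=> iF; elim: s => [|i s [ih1 ih2]].
  under [X in itg X]eq_fun do rewrite big_nil.
  under [X in Ex P X]eq_fun do rewrite big_nil.
  by rewrite big_nil Ex_cst; split => //; exact/bmf_itg/bmf_cst.
under [X in itg X]eq_fun do rewrite big_cons.
under [X in Ex P X]eq_fun do rewrite big_cons.
by rewrite big_cons ExD// ih2; split => //; exact: itgD.
Qed.

Lemma Ex_sumE (I : Type) (s : seq I) (F : I -> T -> R) : (forall i, bmf (F i)) ->
  Ex P (fun x => \sum_(i <- s) F i x) = \sum_(i <- s) Ex P (F i).
Proof. by move=> bF; apply: (Ex_sum _ _).2 => i; exact: bmf_itg. Qed.

Lemma Ex_norm_le f (C : R) : itg f -> (forall x, `|f x| <= C) -> `|Ex P f| <= C.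
Proof.
move=> bf fC; apply: le_trans (le_normr_Rintegral _ _) _ => //.
rewrite -[leRHS]Ex_cst; apply: Ex_le => //; last exact/bmf_itg/bmf_cst.
exact: (integrable_norm bf).
Qed.

(** Bounded convergence. Identities for Mercer series are proved for partial sums and carried to the
    limit by this lemma, which also supplies measurability of the limit. *)
Lemma bounded_cvg_Ex (F : nat -> T -> R) f (C : R) :
  (forall m, measurable_fun setT (F m)) -> (forall m x, `|F m x| <= C) ->
  (forall x, F ^~ x @ \oo --> f x) ->
  bmf f /\ Ex P (F m) @[m --> \oo] --> Ex P f.
Proof.
move=> mF FC Ff.
have mf : measurable_fun setT f by apply: (measurable_fun_cvg mF) => x _; exact: Ff.
have bf : bmf f.
  split => //; exists C => x.
  have nF : `|F m x| @[m --> \oo] --> `|f x| by apply: cvg_norm; exact: Ff.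
  rewrite -(cvg_lim _ nF)//; apply: limr_le; first by apply/cvg_ex; exists `|f x|.
  exact: nearW.
split => //.
have bF m : bmf (F m) by split => //; exists C.
have ibC : itg (fun=> C) by exact/bmf_itg/bmf_cst.
have mF' m : measurable_fun setT (EFin \o F m) by exact/measurable_EFinP.
have mf' : measurable_fun setT (EFin \o f) by exact/measurable_EFinP.
have Ff' : {ae P, forall x, setT x -> (EFin \o F m) x @[m --> \oo] --> (EFin \o f) x}.
  by apply: aeW => x _; apply/fine_cvgP; split; [exact: nearW | exact: Ff].
have FC' : {ae P, forall x m, setT x -> (`|(EFin \o F m) x| <= (EFin \o (fun=> C)) x)%E}.
  by apply: aeW => x m _; rewrite lee_fin.
have [_ _ h] := dominated_convergence measurableT mF' mf' Ff' ibC FC'.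
by apply: fine_cvg; rewrite fineK //; exact/integrable_fin_num/bmf_itg.
Qed.

Lemma markov_Ex f (a : R) : 0 < a -> bmf f -> (forall x, 0 <= f x) ->
  (P [set x | (a <= f x)%R] <= (Ex P f / a)%:E)%E.
Proof.
move=> a0 bf f0; have [mf _] := bf.
have mS : measurable [set x | (a <= f x)%R].
  by rewrite -[X in measurable X]setTI; exact: measurable_fun_le (measurable_cst _) mf.
rewrite EFinM lee_pdivlMr// muleC.
rewrite /Rintegral fineK; last exact/integrable_fin_num/bmf_itg.
apply: le_trans (_ : (\int[P]_(x in [set x | (a <= f x)%R]) (f x)%:E <= _)%E).
  rewrite -integral_cst//; apply: ge0_le_integral => //.
  - by move=> x _; rewrite lee_fin ltW.
  - by apply/measurable_EFinP; exact: measurable_funTS.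
apply: ge0_subset_integral => //.
- exact/measurable_EFinP.
- by move=> x _; rewrite lee_fin.
Qed.

End BoundedMeasurable.

(** * Bounded kernels of two variables and their partial expectations *)

Section BoundedKernels.
Context {d1 d2} {U : measurableType d1} {T : measurableType d2} {R : realType}.
Variables (Q : probability U R) (P : probability T R).

Definition bkf (h : U -> T -> R) : Prop := bmf (fun z : U * T => h z.1 z.2).

Lemma bkf_l h y : bkf h -> bmf (fun x => h x y).
Proof.
by move=> bh; apply: (bmf_comp bh (g := fun x => (x, y)));
  exact: measurable_pair2.
Qed.

Lemma bkf_r h x : bkf h -> bmf (h x).
Proof.
by move=> bh; apply: (bmf_comp bh (g := fun y => (x, y)));
  exact: measurable_pair1.
Qed.

Lemma bkf_itg h : bkf h ->
  (Q \x P)%E.-integrable setT (EFin \o (fun z : U * T => h z.1 z.2)).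
Proof.
move=> [mh [C hC]]; apply: measurable_bounded_integrable => //.
  apply: (@le_lt_trans _ _ 1%E); last exact: ltry.
  have : ((Q \x P) ([set: U] `*` [set: T]) = Q setT * P setT)%E by exact: product_measure1E.
  rewrite setXTT (@probability_setT _ _ _ Q) (@probability_setT _ _ _ P) mule1 => QP1.
  by rewrite -[leLHS]/((Q \x P)%E [set: U * T]) QP1.
by exists C; split; [rewrite num_real | move=> M CM x _; exact: le_trans (hC x) (ltW CM)].
Qed.

Let FE h : bkf h -> fubini_F P (EFin \o (fun z : U * T => h z.1 z.2)) =
  EFin \o (fun x => Ex P (h x)).
Proof.
move=> bh; apply/funext => x; rewrite /fubini_F/= /Rintegral fineK//.
exact: integrable_fin_num (bmf_itg P (bkf_r x bh)).
Qed.

Let GE h : bkf h -> fubini_G Q (EFin \o (fun z : U * T => h z.1 z.2)) =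
  EFin \o (fun y => Ex Q (fun x => h x y)).
Proof.
move=> bh; apply/funext => x; rewrite /fubini_G/= /Rintegral fineK//.
exact: integrable_fin_num (bmf_itg Q (bkf_l x bh)).
Qed.

Lemma bkf_Ex_r h : bkf h -> bmf (fun x => Ex P (h x)).
Proof.
move=> bh; split; last first.
  by have [_ [C hC]] := bh; exists C => x;
    apply: (Ex_norm_le (bmf_itg P (bkf_r x bh))) => y; exact: (hC (x, y)).
have := integrable_fubini_F (bkf_itg bh); rewrite FE//.
by move=> /measurable_int/measurable_EFinP.
Qed.

Lemma bkf_Ex_l h : bkf h -> bmf (fun y => Ex Q (fun x => h x y)).
Proof.
move=> bh; split; last first.
  by have [_ [C hC]] := bh; exists C => y;
    apply: (Ex_norm_le (bmf_itg Q (bkf_l y bh))) => x; exact: (hC (x, y)).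
by have := measurable_fubini_G (bkf_itg bh); rewrite GE// => /measurable_EFinP.
Qed.

End BoundedKernels.

(** * Elementary inequalities *)

(** The function [(1 + x + 6/11 * x^2) * exp(-x)] equals 1 at 0 and has derivative
    [x * (1/11 - 6/11 * x) * exp(-x)]: it decreases on the negative half-line and increases on
    [0, 1/6], an interval that contains 1/12. *)
Lemma expR_le_quad {R : realType} (y : R) : y <= 1 / 12 ->
  expR y <= 1 + y + 6 / 11 * y ^+ 2.
Proof.
move=> y12.
pose f (x : R) : R := (1 + x + 6 / 11 * x ^+ 2) * expR (- x).
pose df (x : R) : R := x * (1 / 11 - 6 / 11 * x) * expR (- x).
have dfE (x : R) : is_derive x (1 : R) f (df x).
  rewrite /f; apply: is_derive_eq.
  by rewrite /df /GRing.scale/=; field.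
have cf (a b : R) : {within `[a, b], continuous f}.
  apply: continuous_subspaceT => x.
  by apply/differentiable_continuous/derivable1_diffP; case: (dfE x).
have f0 : f 0 = 1 by rewrite /f oppr0 expR0; ring.
suff : 1 <= f y.
  by rewrite /f expRN -ler_pdivrMr ?invr_gt0 ?expR_gt0// invrK mul1r.
rewrite -f0; have [y0|/ltW y0] := leP 0 y.
  have [c /[!in_itv]/= /andP[c0 cy] fc] := MVT_segment y0 (fun x _ => dfE x) (cf 0 y).
  rewrite -subr_ge0 fc /df; have := expR_gt0 (- c) => ec.
  rewrite !mulr_ge0// ?(ltW ec)//; nra.
have [c /[!in_itv]/= /andP[c0 cy] fc] := MVT_segment y0 (fun x _ => dfE x) (cf y 0).
rewrite -subr_le0 fc /df; have := expR_gt0 (- c) => ec.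
have h : c * (1 / 11 - 6 / 11 * c) <= 0 by nra.
rewrite mulr_le0_ge0//; last by lra.
by rewrite mulr_le0_ge0// ltW.
Qed.

Lemma sqr_sum_le {R : realFieldType} (x : nat -> R) m :
  (\sum_(i < m) x i) ^+ 2 <= m%:R * \sum_(i < m) x i ^+ 2.
Proof.
elim: m => [|m ih]; first by rewrite !big_ord0 expr0n mul0r.
case: m => [|m] in ih *; first by rewrite !big_ord_recr !big_ord0/= !add0r mul1r.
rewrite [\sum_(i < m.+2) x i]big_ord_recr [\sum_(i < m.+2) x i ^+ 2]big_ord_recr/=.
set S := \sum_(i < m.+1) _ in ih *.
set V := \sum_(i < m.+1) _ in ih *.
rewrite -natr1.
have V0 : 0 <= V by apply: sumr_ge0 => i _; exact: sqr_ge0.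
set M : R := m.+1%:R in ih *.
have M0 : 0 < M by rewrite ltr0n.
have h : (S - M * x m.+1) ^+ 2 >= 0 by exact: sqr_ge0.
have : 2 * S * x m.+1 <= S ^+ 2 / M + M * x m.+1 ^+ 2.
  rewrite -(ler_pM2l M0) (_ : M * (S ^+ 2 / M + _) = S ^+ 2 + (M * x m.+1) ^+ 2); last by field; rewrite gt_eqF.
  nra.
have : S ^+ 2 / M <= V by rewrite ler_pdivrMr// mulrC.
nra.
Qed.

Lemma sum_square_split {R : comPzRingType} (g : nat -> nat -> R) m :
  (forall i j, g i j = g j i) ->
  \sum_(i < m) \sum_(j < m) g i j =
  \sum_(i < m) g i i + 2 * \sum_(j < m) \sum_(i < j) g i j.
Proof.
move=> sg; elim: m => [|m ih]; first by rewrite !big_ord0 mulr0 addr0.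
under eq_bigr do rewrite big_ord_recr/=.
rewrite big_split/= !big_ord_recr/= ih.
have -> : \sum_(j < m) g m j = \sum_(i < m) g i m by apply: eq_bigr => i _; rewrite sg.
ring.
Qed.

Lemma sum_ltn_nat {R : realFieldType} m : \sum_(j < m) j%:R <= m%:R ^+ 2 / 2 :> R.
Proof.
elim: m => [|m ih]; first by rewrite big_ord0 expr0n mul0r.
rewrite big_ord_recr/= -natr1; have : 0 <= m%:R :> R by []; nra.
Qed.

(** Truncation from above needs no recentring: [min (f x) a <= f x], whose mean vanishes, and
    [(min (f x) a)^2 <= (f x)^2] because [a > 0]. The quadratic bound on the exponential applies
    since only an upper bound on its argument is required. *)
Lemma Ex_expR_min {d} {T : measurableType d} {R : realType} (P : probability T R)
  (f : T -> R) (l a : R) : bmf f -> Ex P f = 0 -> 0 <= l -> 0 < a -> l * a <= 1 / 12 ->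
  Ex P (fun x => expR (l * Num.min (f x) a)) <=
  expR (6 / 11 * l ^+ 2 * Ex P (fun x => f x ^+ 2)).
Proof.
move=> bf f0 l0 a0 la.
have bl := bmfZ l bf.
have b2 := bmfZ (6 / 11 * l ^+ 2) (bmfX 2 bf).
apply: le_trans (expR_ge1Dx _).
have <- : Ex P (fun x => 1 + l * f x + 6 / 11 * l ^+ 2 * f x ^+ 2) =
   1 + 6 / 11 * l ^+ 2 * Ex P (fun x => f x ^+ 2).
  rewrite ExD; [|apply/bmf_itg/bmfD => //; exact: bmf_cst|exact: bmf_itg].
  rewrite ExD; [|exact/bmf_itg/bmf_cst|exact: bmf_itg].
  rewrite Ex_cst (ExZ l (bmf_itg P bf)) f0 mulr0 addr0.
  by rewrite (ExZ _ (bmf_itg P (bmfX 2 bf))).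
apply: Ex_le.
- by apply/bmf_itg/bmf_expR/bmfZ/bmf_min.
- by apply/bmf_itg/bmfD => //; apply: bmfD => //; exact: bmf_cst.
move=> x; set y := Num.min (f x) a.
have ya : y <= a by rewrite ge_min lexx orbT.
have yf : y <= f x by rewrite ge_min lexx.
apply: le_trans (expR_le_quad _) _.
  by apply: le_trans la; exact: ler_wpM2l.
rewrite exprMn mulrA lerD//; first by rewrite lerD2l ler_wpM2l.
rewrite ler_wpM2l ?mulr_ge0 ?sqr_ge0//.
rewrite /y minElt; case: ifPn => //; rewrite -leNgt => af.
by rewrite ler_sqr ?nnegrE// ltW// (lt_le_trans a0).
Qed.

(** * Independence from the past of the sample *)

Section Sample.
Context {d} {T : measurableType d} {R : realType} {d'} {Om : measurableType d'}.
Variables (Q : probability Om R) (P : probability T R) (n : nat) (X : nat -> Om -> T).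
Hypothesis iid : iid_sample Q P n X.

(** Cylinder events of the first j observations: a pi-system generating their sigma-algebra, on
    which [iid_sample] gives the product formula. *)
Definition rects (j : nat) : set (set Om) :=
  [set S | exists2 A : nat -> set T, (forall i, measurable (A i)) &
     S = \bigcap_(i in `I_j) (X i @^-1` A i)].

(* The sample space carrying only the sigma-algebra generated by X_0, ..., X_(j-1). *)
Local Notation Past j := (g_sigma_algebraType (rects j)).

Let mX i : measurable_fun [set: Om] (X i). Proof. by case: iid => + _; exact. Qed.

Let mXpre i A : measurable A -> measurable (X i @^-1` A).
Proof. by move=> mA; rewrite -[X in measurable X]setTI; exact: mX. Qed.

Lemma rects_measurable j : rects j `<=` measurable.
Proof. by move=> _ [A mA ->]; apply: bigcap_measurableType => // i _; exact: mXpre. Qed.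

Lemma sigma_rects_measurable j : <<s rects j >> `<=` measurable.
Proof. exact: smallest_sub (@sigma_algebra_measurable _ Om) (@rects_measurable j). Qed.

Lemma Past_X j i : (i < j)%N -> measurable_fun [set: Past j] (X i : Past j -> T).
Proof.
move=> ij _ A mA; rewrite setTI; apply: sub_sigma_algebra.
exists (fun k => if k == i then A else setT); first by move=> k; case: ifP.
apply/seteqP; split => [x Ax k /= _|x /= Ax].
  by case: ifP => // /eqP ->.
by have := Ax i ij; rewrite /= eqxx.
Qed.

Lemma Past_measurable j d2 (U : measurableType d2) (f : Om -> U) :
  measurable_fun [set: Past j] (f : Past j -> U) -> measurable_fun [set: Om] f.
Proof.
by move=> mf mT A mA; apply: sigma_rects_measurable; exact: (mf measurableT).
Qed.

Lemma Past_bmf j (f : Om -> R) : bmf (f : Past j -> R) -> bmf f.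
Proof. by move=> [mf bf]; split => //; exact: Past_measurable mf. Qed.

Lemma rects_setI j : setI_closed (rects j).
Proof.
move=> _ _ [A mA ->] [B mB ->]; exists (fun i => A i `&` B i).
  by move=> i; exact: measurableI.
by rewrite -bigcapI; apply: eq_bigcapr => i _; rewrite preimage_setI.
Qed.

Lemma rects_setT j : rects j setT.
Proof.
by exists (fun=> setT) => //; apply/esym/seteqP; split.
Qed.

(** The coordinates from j to n - 1 are filled with the whole space, each contributing a factor
    1. *)
Lemma rects_prob j (A : nat -> set T) : (j <= n)%N -> (forall i, measurable (A i)) ->
  Q (\bigcap_(i in `I_j) (X i @^-1` A i)) = (\prod_(i < j) P (A i))%E.
Proof.
move=> jn mA; have [_ h] := iid.
have := h (fun i => if (i < j)%N then A i else setT) _.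
have -> : \bigcap_(i in `I_n) (X i @^-1` (if (i < j)%N then A i else setT)) =
   \bigcap_(i in `I_j) (X i @^-1` A i).
  apply/seteqP; split => x Ax i /= ij.
    by have := Ax i (leq_trans ij jn); rewrite /= ij.
  by case: ifP => // ij'; exact: Ax.
move=> ->; last by move=> i; case: ifP.
rewrite -(big_mkord xpredT (fun i => P (if (i < j)%N then A i else setT))).
rewrite (big_cat_nat _ jn)//=.
have -> : (\prod_(j <= i < n) P (if (i < j)%N then A i else setT) = 1)%E.
  rewrite big_nat_cond big1// => i /andP[/andP[ji _] _].
  by rewrite ltnNge ji/= probability_setT.
rewrite mule1.
by rewrite big_mkord; apply: eq_bigr => i _; rewrite ltn_ord.
Qed.

(** For fixed B both sides are finite measures in A: the restriction [m1] of Q to the event that X_j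
    lies in B, and Q scaled by P(B), [m2]. They agree on the pi-system [rects j], where B becomes
    the factor number j of a rectangle with j + 1 sides. *)
Lemma Past_indep j A B : (j < n)%N -> <<s rects j >> A -> measurable B ->
  Q (A `&` X j @^-1` B) = (Q A * P B)%E.
Proof.
move=> jn sA mB.
have fPB : P B \is a fin_num by exact: fin_num_measure.
have PB0 : (0 <= fine (P B))%R by exact: fine_ge0.
pose m1 := mrestr Q (mXpre j mB).
pose m2 := mscale (NngNum PB0) Q.
have -> : Q (A `&` X j @^-1` B) = m1 A by [].
have m2E Z : m2 Z = (P B * Q Z)%E by rewrite /m2 /mscale/= fineK.
rewrite muleC -m2E.
apply: (g_sigma_algebra_measure_unique (rects j) (@rects_measurable j) (fun=> setT)) => //.
- by move=> _; exact: rects_setT.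
- by rewrite bigcup_const.
- exact: rects_setI.
- move=> _ [C mC ->]; rewrite -[RHS]/(m2 _) m2E.
  rewrite -[LHS]/(Q (_ `&` X j @^-1` B)).
  have -> : \bigcap_(i in `I_j) (X i @^-1` C i) `&` X j @^-1` B =
    \bigcap_(i in `I_j.+1) (X i @^-1` (if (i < j)%N then C i else B)).
    apply/seteqP; split => [x [Cx Bx] i /=|x Cx].
      by rewrite ltnS leq_eqVlt => /predU1P[->|ij]; rewrite ?ltnn// ij; exact: Cx.
    split; last by have := Cx j (ltnSn j); rewrite /= ltnn.
    by move=> i /= ij; have := Cx i (ltnW ij); rewrite /= ij.
  rewrite rects_prob//; last by move=> i; case: ifP.
  rewrite big_ord_recr/= ltnn rects_prob ?(ltnW jn)// muleC; congr (_ * _)%E.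
  by apply: eq_bigr => i _; rewrite ltn_ord.
- move=> _; apply: (@le_lt_trans _ _ 1%E); last exact: ltry.
  rewrite -[leLHS]/(Q (setT `&` X j @^-1` B)) setTI probability_le1//.
  exact: mXpre.
Qed.

(** Freezing lemma. By [Past_indep] and uniqueness of product measures, the joint law of the past
    and X_j is [Q' \x P], with [Q'] the restriction of Q to the past; Fubini then integrates in
    either order. The first form conditions on the past, as martingale arguments require; the second
    conditions on the new observation, as moment computations require. *)
Lemma Past_freezing j (H : Past j * T -> R) : (j < n)%N -> bmf H ->
  Ex Q (fun w => H (w, X j w)) = Ex Q (fun w => Ex P (fun x => H (w, x))) /\
  Ex Q (fun w => H (w, X j w)) = Ex P (fun x => Ex Q (fun w => H (w, x))).
Proof.
move=> jn [mH [C HC]].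
have mid : measurable_fun [set: Om] (id : Om -> Past j).
  by move=> _ A mA; rewrite setTI; exact: (sigma_rects_measurable mA).
have mpair : measurable_fun [set: Om] (fun w => (w, X j w) : Past j * T).
  by apply/measurable_fun_pair.
pose idm : {mfun Om >-> Past j} := mfun_Sub (mem_set mid).
pose prm : {mfun Om >-> (Past j * T)%type} := mfun_Sub (mem_set mpair).
pose Q' : probability (Past j) R := distribution Q idm.
pose J : probability (Past j * T)%type R := distribution Q prm.
have QJ : forall Z, measurable Z -> (Q' \x P)%E Z = J Z.
  move=> Z; apply: product_measure_unique => A B mA mB.
  exact: Past_indep.
have iH : (Q' \x P)%E.-integrable setT (EFin \o H).
  apply: measurable_bounded_integrable => //.
    apply: (@le_lt_trans _ _ 1%E); last exact: ltry.
    by rewrite -(@probability_setT _ _ _ J) -QJ.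
  by exists C; split; [rewrite num_real | move=> M CM x _; exact: le_trans (HC x) (ltW CM)].
have E1 : (\int[Q]_w (H (w, X j w))%:E = \int[(Q' \x P)%E]_z (H z)%:E)%E.
  transitivity (\int[J]_z (H z)%:E)%E.
    rewrite integral_distribution//; first exact/measurable_EFinP.
    by apply: (bmf_itg Q (f := fun w => H (w, X j w))); split;
      [exact: (measurableT_comp mH mpair) | exists C].
  by apply: eq_measure_integral => A mA _; exact/esym/QJ.
have bH1 w : bmf (fun x => H (w, x)).
  split; last by exists C.
  exact: (measurableT_comp mH (measurable_pair1 w)).
have bH2 x : bmf (fun w : Past j => H (w, x)).
  split; last by exists C.
  exact: (measurableT_comp mH (measurable_pair2 x)).
have FE : fubini_F P (EFin \o H) = EFin \o (fun w => Ex P (fun x => H (w, x))).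
  apply/funext => w; rewrite /= /Rintegral fineK//.
  exact: integrable_fin_num (bmf_itg P (bH1 w)).
have GE : fubini_G Q' (EFin \o H) = EFin \o (fun x => Ex Q (fun w => H (w, x))).
  apply/funext => x; rewrite /= /Rintegral fineK//; last first.
    exact: integrable_fin_num (bmf_itg Q (Past_bmf (bH2 x))).
  rewrite /fubini_G integral_distribution//.
    by apply/measurable_EFinP; case: (bH2 x).
  exact: (bmf_itg Q (f := fun w => H (w, x)) (Past_bmf (bH2 x))).
split; congr fine; rewrite E1.
  rewrite -(integral12_prod_meas1 iH) FE integral_distribution//.
    by have := integrable_fubini_F iH; rewrite FE => /measurable_int.
  apply: (bmf_itg Q (f := fun w => Ex P (fun x => H (w, x)))); apply: (Past_bmf (j := j)).
  split; last by exists C => w; exact: (Ex_norm_le (bmf_itg P (bH1 w))).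
  by have := integrable_fubini_F iH; rewrite FE => /measurable_int/measurable_EFinP.
by rewrite -(integral21_prod_meas1 iH) GE.
Qed.

Lemma Past_sum_bmf j m (f : T -> R) : bmf f -> (m <= j)%N ->
  bmf (fun w : Past j => \sum_(i < m) f (X i w)).
Proof.
move=> bf mj; apply: (bmf_sum_nat (F := fun i (w : Past j) => f (X i w))) => i im.
by apply: (bmf_comp bf); apply: Past_X; exact: leq_trans im mj.
Qed.

Lemma Ex_indep j (F : Past j -> R) (f : T -> R) : (j < n)%N -> bmf F -> bmf f ->
  Ex Q (fun w => F w * f (X j w)) = Ex Q F * Ex P f.
Proof.
move=> jn bF bf.
have [-> _] := Past_freezing jn
  (bmfM (bmf_comp bF measurable_fst) (bmf_comp bf measurable_snd)).
under [X in Ex Q X = _]eq_fun do rewrite /= (ExZ _ (bmf_itg P bf)).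
rewrite mulrC -(ExZ (Ex P f) (bmf_itg Q (Past_bmf bF))).
by under [X in Ex Q X = _]eq_fun do rewrite mulrC.
Qed.

Lemma Ex_X j (f : T -> R) : (j < n)%N -> bmf f -> Ex Q (fun w => f (X j w)) = Ex P f.
Proof.
move=> jn bf; have := Ex_indep jn (bmf_cst (1 : R)) bf.
rewrite Ex_cst mul1r => <-.
by under [X in _ = Ex Q X]eq_fun do rewrite mul1r.
Qed.

Let XX (f : T -> R) i : bmf f -> bmf (fun w => f (X i w)).
Proof. by move=> bf; apply: (bmf_comp bf). Qed.

Lemma Ex_sum1 (f : T -> R) m : bmf f -> (m <= n)%N -> Ex P f = 0 ->
  Ex Q (fun w => \sum_(i < m) f (X i w)) = 0.
Proof.
move=> bf mn f0; rewrite (Ex_sumE Q _ (F := fun (i : 'I_m) w => f (X i w))) => [|i]; last exact: XX.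
by apply: big1 => i _; rewrite Ex_X// (leq_trans _ mn).
Qed.

Lemma Ex_sum_sqr (f : T -> R) m : bmf f -> (m <= n)%N -> Ex P f = 0 ->
  Ex Q (fun w => (\sum_(i < m) f (X i w)) ^+ 2) = m%:R * Ex P (fun x => f x ^+ 2).
Proof.
move=> bf + f0; elim: m => [|m ih] mn.
  by under [X in Ex Q X]eq_fun do rewrite big_ord0 expr0n/=; rewrite Ex_cst mul0r.
have bS := Past_sum_bmf bf (leqnn m).
have bS' := Past_bmf bS.
under [X in Ex Q X]eq_fun do rewrite big_ord_recr/= sqrrD -mulr_natl.
rewrite ExD; [|apply: bmf_itg; by auto using bmfD, bmfX, bmfM, bmfZ, XX..].
rewrite ExD; [|apply: bmf_itg; by auto using bmfD, bmfX, bmfM, bmfZ, XX..].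
rewrite ih ?(ltnW mn)//.
have -> : Ex Q (fun w => 2 * ((\sum_(i < m) f (X i w)) * f (X m w))) = 0.
  rewrite ExZ; last by apply: bmf_itg; auto using bmfM, XX.
  by rewrite (Ex_indep (j := m) (F := fun w => \sum_(i < m) f (X i w)))// f0 !mulr0.
by rewrite addr0 (Ex_X mn (bmfX 2 bf)) -natr1 mulrDl mul1r.
Qed.

(** Expanding the fourth power of [S + f (X m)], the terms in [S^3 f] and [S f^3] vanish by
    independence and centring. What remains closes the induction because
    [3 m^2 + 6 m <= 3 (m + 1)^2]. *)
Lemma Ex_sum_pow4 (f : T -> R) m : bmf f -> (m <= n)%N -> Ex P f = 0 ->
  Ex Q (fun w => (\sum_(i < m) f (X i w)) ^+ 4) <=
  m%:R * Ex P (fun x => f x ^+ 4) + 3 * m%:R ^+ 2 * Ex P (fun x => f x ^+ 2) ^+ 2.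
Proof.
move=> bf + f0; elim: m => [|m ih] mn.
  under [X in Ex Q X]eq_fun do rewrite big_ord0 expr0n/=.
  by rewrite Ex_cst expr0n/= mulr0 !mul0r addr0.
have bS := Past_sum_bmf bf (leqnn m).
have bS' := Past_bmf bS.
pose S w := \sum_(i < m) f (X i w).
have -> : (fun w => (\sum_(i < m.+1) f (X i w)) ^+ 4) = (fun w =>
   (((S w ^+ 4 + 4 * (S w ^+ 3 * f (X m w))) + 6 * (S w ^+ 2 * f (X m w) ^+ 2)) +
     4 * (S w * f (X m w) ^+ 3)) + f (X m w) ^+ 4).
  by apply/funext => w; rewrite big_ord_recr/= -/(S w); ring.
have h k l : Ex Q (fun w => S w ^+ k * f (X m w) ^+ l) =
    Ex Q (fun w => S w ^+ k) * Ex P (fun x => f x ^+ l).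
  by apply: (Ex_indep (j := m) (F := fun w => S w ^+ k) (f := fun x => f x ^+ l)) => //; exact: bmfX.
rewrite !ExD; try by apply: bmf_itg; auto 10 using bmfD, bmfX, bmfM, bmfZ, XX.
rewrite !ExZ; try by apply: bmf_itg; auto 10 using bmfD, bmfX, bmfM, bmfZ, XX.
have -> : Ex Q (fun w => S w ^+ 3 * f (X m w)) = 0.
  by rewrite (Ex_indep (j := m) (F := fun w => S w ^+ 3))// ?f0 ?mulr0//; exact: bmfX.
have -> : Ex Q (fun w => S w * f (X m w) ^+ 3) = 0.
  rewrite (Ex_indep (j := m) (F := S) (f := fun x => f x ^+ 3))//; last exact: bmfX.
  by rewrite Ex_sum1 ?mul0r// ltnW.
rewrite h Ex_sum_sqr ?(ltnW mn)//.
rewrite (Ex_X mn (bmfX 4 bf)).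
have := ih (ltnW mn); rewrite -/S => ih'.
set a := Ex P (fun x => f x ^+ 2) in ih' *; set b := Ex P (fun x => f x ^+ 4) in ih' *.
rewrite -natr1; set M := m%:R in ih' *.
have : 0 <= a ^+ 2 by exact: sqr_ge0.
nra.
Qed.

Lemma Past_ker j m (h : T -> T -> R) : bkf h -> (m <= j)%N ->
  bkf (fun (w : Past j) (x : T) => \sum_(i < m) h (X i w) x).
Proof.
move=> bh mj.
apply: (bmf_sum_nat (F := fun i (z : Past j * T) => h (X i z.1) z.2)) => i im.
apply: (bmf_comp bh (g := fun z : Past j * T => (X i z.1, z.2))).
apply/measurable_fun_pair; last exact: measurable_snd.
apply: measurableT_comp; last exact: measurable_fst.
by apply: Past_X; exact: leq_trans im mj.
Qed.

Lemma Past_bkf j (H : Om -> T -> R) :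
  bkf (H : Past j -> T -> R) -> bkf H.
Proof.
move=> bH; apply: (bmf_comp bH (g := fun z : Om * T => (z.1 : Past j, z.2))).
apply/measurable_fun_pair; last exact: measurable_snd.
have mid : measurable_fun [set: Om] (id : Om -> Past j).
  by move=> _ A mA; rewrite setTI; exact: (sigma_rects_measurable mA).
exact: (measurableT_comp mid measurable_fst).
Qed.

Lemma Past_pair i j m (h : T -> T -> R) : bkf h -> (i < m)%N -> (j < m)%N ->
  bmf (fun w : Past m => h (X i w) (X j w)).
Proof.
move=> bh im jm; apply: (bmf_comp bh (g := fun w : Past m => (X i w, X j w))).
by apply/measurable_fun_pair; exact: Past_X.
Qed.

Lemma Past_D j m (h : T -> T -> R) : bkf h -> (j < m)%N ->
  bmf (fun w : Past m => \sum_(i < j) h (X i w) (X j w)).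
Proof.
move=> bh jm; apply: (bmf_sum_nat (F := fun i (w : Past m) => h (X i w) (X j w))) => i ij.
by apply: Past_pair => //; exact: ltn_trans ij jm.
Qed.

Lemma Past_U m (h : T -> T -> R) : bkf h ->
  bmf (fun w : Past m => \sum_(j < m) \sum_(i < j) h (X i w) (X j w)).
Proof.
move=> bh.
apply: (bmf_sum_nat (F := fun j (w : Past m) => \sum_(i < j) h (X i w) (X j w))) => j jm.
exact: Past_D.
Qed.

Lemma Ex_D_pow j k (h : T -> T -> R) : bkf h -> (j < n)%N ->
  Ex Q (fun w => (\sum_(i < j) h (X i w) (X j w)) ^+ k) =
  Ex P (fun x => Ex Q (fun w => (\sum_(i < j) h (X i w) x) ^+ k)).
Proof.
move=> bh jn.
by have [_ ->] := Past_freezing jn (bmfX k (Past_ker bh (leqnn j))).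
Qed.

(** ** Degenerate U-statistics *)

Section Degenerate.
Variable h : T -> T -> R.
Hypotheses (bh : bkf h) (sh : forall x y, h x y = h y x)
  (h0 : forall x, Ex P (h x) = 0).

Let h0' y : Ex P (fun x => h x y) = 0.
Proof. by rewrite -(h0 y); apply: eq_Rintegral => x _; exact: sh. Qed.

(** Martingale property: with the past frozen, the increment is a sum of functions [h (X i w)], each
    of mean zero by degeneracy. *)
Lemma Ex_D_indep j (F : Past j -> R) : (j < n)%N -> bmf F ->
  Ex Q (fun w => F w * \sum_(i < j) h (X i w) (X j w)) = 0.
Proof.
move=> jn bF.
have := Past_freezing jn (bmfM (bmf_comp bF measurable_fst) (Past_ker bh (leqnn j))).
move=> [/= -> _]; rewrite -[RHS](Ex_cst Q); apply: eq_Rintegral => w _.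
rewrite (@ExZ _ _ _ P (F w) (fun x => \sum_(i < j) h (X i w) x)); last first.
  by apply: bmf_itg; exact: (bkf_r (w : Past j) (Past_ker bh (leqnn j))).
rewrite (Ex_sumE P _ (F := fun (i : 'I_j) x => h (X i w) x)) => [|i]; last exact: bkf_r.
by rewrite big1 ?mulr0.
Qed.

(** The increments are orthogonal, and given X_j the j-th one is a sum of j independent centred
    variables, so it contributes j times the second moment of h. *)
Lemma Ex_U_sqr m : (m <= n)%N ->
  Ex Q (fun w => (\sum_(j < m) \sum_(i < j) h (X i w) (X j w)) ^+ 2) =
  (\sum_(j < m) j%:R) * Ex P (fun x => Ex P (fun y => h y x ^+ 2)).
Proof.
elim: m => [|m ih] mn.
  by under [X in Ex Q X]eq_fun do rewrite big_ord0 expr0n/=; rewrite Ex_cst big_ord0 mul0r.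
pose S w := \sum_(j < m) \sum_(i < j) h (X i w) (X j w).
pose D w := \sum_(i < m) h (X i w) (X m w).
have bS : bmf (S : Past m -> R) by exact: Past_U.
have bD : bmf (D : Om -> R) by apply: (@Past_bmf m.+1); exact: Past_D.
have -> : (fun w => (\sum_(j < m.+1) \sum_(i < j) h (X i w) (X j w)) ^+ 2) =
  (fun w => S w ^+ 2 + 2 * (S w * D w) + D w ^+ 2).
  by apply/funext => w; rewrite big_ord_recr/= -/(S w) -/(D w); ring.
have bS' := Past_bmf bS.
rewrite !ExD; try by apply: bmf_itg; auto using bmfD, bmfX, bmfM, bmfZ.
rewrite ih ?(ltnW mn)// big_ord_recr/= mulrDl -addrA; congr (_ + _).
rewrite ExZ; last by apply: bmf_itg; exact: bmfM.
rewrite /D (Ex_D_indep mn bS) mulr0 add0r Ex_D_pow//.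
have -> : (fun x => Ex Q (fun w => (\sum_(i < m) h (X i w) x) ^+ 2)) =
   (fun x => m%:R * Ex P (fun y => h y x ^+ 2)).
  apply/funext => x; rewrite (Ex_sum_sqr (f := fun y => h y x))//; first exact: bkf_l.
  exact: ltnW.
rewrite ExZ//; apply: bmf_itg.
exact: (bkf_Ex_l P P (h := fun y x => h y x ^+ 2) (bmfX 2 bh)).
Qed.

(** Given X_j the increment is a sum of independent centred variables. Its variance must be
    controlled uniformly in the value of X_j, since it enters squared; the fourth moment only on
    average. *)
Lemma Ex_D_pow4 j (A C4 : R) : (j < n)%N ->
  (forall x, Ex P (fun z => h x z ^+ 2) <= A) ->
  Ex P (fun x => Ex P (fun y => h y x ^+ 4)) <= C4 ->
  Ex Q (fun w => (\sum_(i < j) h (X i w) (X j w)) ^+ 4) <=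
  j%:R * C4 + 3 * j%:R ^+ 2 * A ^+ 2.
Proof.
move=> jn hA hC4; rewrite Ex_D_pow//.
have b4 := bkf_Ex_l P P (h := fun y x => h y x ^+ 4) (bmfX 4 bh).
apply: (@le_trans _ _ (Ex P (fun x => j%:R * Ex P (fun y => h y x ^+ 4) +
    3 * j%:R ^+ 2 * A ^+ 2))).
  apply: Ex_le.
  - apply: bmf_itg.
    apply: (bkf_Ex_l Q P (h := fun w x => (\sum_(i < j) h (X i w) x) ^+ 4)).
    by apply: bmfX; exact: Past_bkf (Past_ker bh (leqnn j)).
  - by apply: bmf_itg; apply: bmfD; [exact: bmfZ | exact: bmf_cst].
  - move=> x; apply: le_trans (Ex_sum_pow4 (f := fun y => h y x) _ (ltnW jn) (h0' x)) _.
      exact: bkf_l.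
    rewrite lerD2l ler_wpM2l ?mulr_ge0//.
    have -> : Ex P (fun y => h y x ^+ 2) = Ex P (fun y => h x y ^+ 2).
      by apply: eq_Rintegral => y _; rewrite sh.
    have p0 : 0 <= Ex P (fun y => h x y ^+ 2) by apply: Ex_ge0 => y; exact: sqr_ge0.
    by rewrite ler_sqr ?nnegrE//; exact: le_trans (hA x).
rewrite ExD; [|exact/bmf_itg/bmfZ|exact/bmf_itg/bmf_cst].
by rewrite (ExZ _ (bmf_itg P b4)) Ex_cst lerD2r ler_wpM2l.
Qed.

End Degenerate.

(** * Exponential tail bound for degenerate U-statistics *)

Section Tail.
Variables (h h2 : T -> T -> R).
Hypotheses (bh : bkf h) (sh : forall x y, h x y = h y x)
  (h0 : forall x, Ex P (h x) = 0).
Hypotheses (bh2 : bkf h2) (sh2 : forall x y, h2 x y = h2 y x)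
  (h20 : forall x, Ex P (h2 x) = 0)
  (hconv : forall x y, Ex P (fun z => h x z * h y z) = h2 x y).

(* D j is the j-th martingale increment of the U-statistic and V j its conditional second moment given X_0, ..., X_(j-1). *)
Let D j w := \sum_(i < j) h (X i w) (X j w).
Let V j w := \sum_(i < j) \sum_(k < j) h2 (X i w) (X k w).

(** Expanding the square, each product integrates to [h2] by [hconv]. The conditional variance is
    thus a V-statistic whose kernel is again degenerate, so its fluctuations can be bounded by the
    same second-moment computation. *)
Let VE j w : V j w = Ex P (fun x => (\sum_(i < j) h (X i w) x) ^+ 2).
Proof.
have bhi i := bkf_r (X i w) bh.
under [X in Ex P X]eq_fun do rewrite expr2 mulr_suml.
rewrite (Ex_sumE P _ (F := fun (i : 'I_j) x => h (X i w) x * \sum_(k < j) h (X k w) x));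
  last first.
  move=> i; apply: bmfM => //.
  exact: (bmf_sum_nat (F := fun k x => h (X k w) x)).
apply: eq_bigr => i _.
under [X in Ex P X]eq_fun do rewrite mulr_sumr.
rewrite (Ex_sumE P _ (F := fun (k : 'I_j) x => h (X i w) x * h (X k w) x)).
  by apply: eq_bigr => k _; rewrite hconv.
by move=> k; exact: bmfM.
Qed.

Let Past_V j m : (j <= m)%N -> bmf (V j : Past m -> R).
Proof.
move=> jm.
apply: (bmf_sum_nat (F := fun i (w : Past m) => \sum_(k < j) h2 (X i w) (X k w))) => i ij.
apply: (bmf_sum_nat (F := fun k (w : Past m) => h2 (X i w) (X k w))) => k kj.
by apply: Past_pair => //; exact: leq_trans jm.
Qed.

Section Supermartingale.
Variables (l a : R).
Hypotheses (l0 : 0 <= l) (a0 : 0 < a) (la : l * a <= 1 / 12).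

Let Z m w := expR (l * \sum_(j < m) Num.min (D j w) a -
  6 / 11 * l ^+ 2 * \sum_(j < m) V j w).

Let Past_Z m : bmf (Z m : Past m -> R).
Proof.
apply: bmf_expR; apply: bmfB; apply: bmfZ.
  apply: (bmf_sum_nat (F := fun j (w : Past m) => Num.min (D j w) a)) => j jm.
  by apply: bmf_min; exact: Past_D.
by apply: (bmf_sum_nat (F := fun j (w : Past m) => V j w)) => j jm; exact/Past_V/ltnW.
Qed.

(** [V m] depends on the first m observations only, so the new compensator can be attached to [Z m],
    giving a past-measurable [G]. Given the past, [Ex_expR_min] bounds the new exponential factor by
    exactly the inverse of that compensator. *)
Lemma Ex_supermartingale m : (m <= n)%N -> Ex Q (Z m) <= 1.
Proof.
elim: m => [|m ih] mn.
  rewrite /Z; under [X in Ex Q X]eq_fun do rewrite !big_ord0 !mulr0 subrr expR0.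
  by rewrite Ex_cst.
apply: le_trans (ih (ltnW mn)).
pose G w := Z m w * expR (- (6 / 11 * l ^+ 2 * V m w)).
have bG : bmf (G : Past m -> R).
  by apply: bmfM => //; apply/bmf_expR/bmfN/bmfZ; exact: Past_V.
have -> : Z m.+1 = (fun w => G w * expR (l * Num.min (D m w) a)).
  apply/funext => w; rewrite /Z /G /Z -!expRD !big_ord_recr/=; congr expR; ring.
have bE : bkf (fun (w : Past m) (x : T) => expR (l * Num.min (\sum_(i < m) h (X i w) x) a)).
  by apply/bmf_expR/bmfZ/bmf_min; exact: Past_ker.
have bGE := bmfM (bmf_comp bG measurable_fst) bE.
have [-> _] := Past_freezing mn bGE.
apply: Ex_le.
- exact: (bmf_itg Q (bkf_Ex_r Q P (Past_bkf (H := fun w x => G w *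
    expR (l * Num.min (\sum_(i < m) h (X i w) x) a)) bGE))).
- exact: (bmf_itg Q (Past_bmf (Past_Z m))).
move=> w /=.
rewrite (@ExZ _ _ _ P (G w) (fun x => expR (l * Num.min (\sum_(i < m) h (X i w) x) a)));
  last by apply: bmf_itg; exact: (bkf_r (w : Past m) bE).
have -> : Z m w = G w * expR (6 / 11 * l ^+ 2 * V m w).
  by rewrite /G -mulrA -expRD addNr expR0 mulr1.
rewrite ler_wpM2l ?mulr_ge0 ?expR_ge0// VE.
have bhi i := bkf_r (X i w) bh.
apply: (Ex_expR_min (f := fun x => \sum_(i < m) h (X i w) x)) => //.
  exact: (bmf_sum_nat (F := fun k x => h (X k w) x)).
rewrite (Ex_sumE P _ (F := fun (i : 'I_m) x => h (X i w) x))//.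
by apply: big1 => i _.
Qed.

End Supermartingale.

Let q x := h2 x x.

(** The centred V-statistic is [S + 2 U]: its diagonal gives the sum [S] of independent centred
    variables, its off-diagonal part a degenerate U-statistic [U] in [h2]. Then
    [(S + 2 U)^2 <= 2 S^2 + 8 U^2], with second moments at most [m * A^2] and [m^2 / 2 * B2]. *)
Let Ex_V_dev m (A B2 : R) : (m <= n)%N -> (forall x, 0 <= q x <= A) ->
  Ex P (fun x => Ex P (fun y => h2 y x ^+ 2)) <= B2 ->
  Ex Q (fun w => (V m w - m%:R * Ex P q) ^+ 2) <=
  2 * m%:R * A ^+ 2 + 4 * m%:R ^+ 2 * B2.
Proof.
move=> mn qA hB2.
have bq : bmf q.
  apply: (bmf_comp bh2 (g := fun x => (x, x))).
  by apply/measurable_fun_pair; exact: measurable_id.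
pose q0 x := q x - Ex P q.
have bq0 : bmf q0 by apply: bmfB => //; exact: bmf_cst.
have q00 : Ex P q0 = 0.
  by rewrite ExB ?Ex_cst ?subrr//; apply: bmf_itg => //; exact: bmf_cst.
pose S w := \sum_(i < m) q0 (X i w).
pose U w := \sum_(j < m) \sum_(i < j) h2 (X i w) (X j w).
have bS : bmf S by apply: (@Past_bmf m); exact: Past_sum_bmf.
have bU : bmf U by apply: (@Past_bmf m); exact: Past_U.
have VSU w : V m w - m%:R * Ex P q = S w + 2 * U w.
  rewrite /V (sum_square_split m (g := fun i k => h2 (X i w) (X k w))) => [|i k //].
  rewrite /S /q0 big_split/= sumrN sumr_const card_ord -mulr_natl /U /q; ring.
apply: (@le_trans _ _ (Ex Q (fun w => 2 * S w ^+ 2 + 8 * U w ^+ 2))).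
  apply: Ex_le.
  - under [X in Q.-integrable _ (EFin \o X)]eq_fun do rewrite VSU.
    by apply: bmf_itg; auto using bmfD, bmfX, bmfZ.
  - by apply: bmf_itg; auto using bmfD, bmfX, bmfZ.
  - by move=> w; rewrite VSU; have := sqr_ge0 (S w - 2 * U w); nra.
rewrite ExD; try by apply: bmf_itg; auto using bmfX, bmfZ.
rewrite (ExZ 2 (bmf_itg Q (bmfX 2 bS))) (ExZ 8 (bmf_itg Q (bmfX 2 bU))).
rewrite Ex_sum_sqr// Ex_U_sqr//.
have q02 : Ex P (fun x => q0 x ^+ 2) <= A ^+ 2.
  rewrite -[leRHS](Ex_cst P); apply: Ex_le; [exact/bmf_itg/bmfX|exact/bmf_itg/bmf_cst|].
  move=> x; rewrite /q0; have /andP[q1 q2] := qA x.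
  have m1 : 0 <= Ex P q by apply: Ex_ge0 => y; case/andP: (qA y).
  have m2 : Ex P q <= A.
    rewrite -[leRHS](Ex_cst P); apply: Ex_le; [exact/bmf_itg|exact/bmf_itg/bmf_cst|].
    by move=> y; case/andP: (qA y).
  set e := Ex P q in m1 m2 *.
  have : 0 <= (A - (q x - e)) * (A + (q x - e)) by apply: mulr_ge0; lra.
  nra.
have s2 : \sum_(j < m) j%:R <= m%:R ^+ 2 / 2 :> R by exact: sum_ltn_nat.
set s := \sum_(j < m) _ in s2 *.
have s0 : 0 <= s by apply: sumr_ge0 => i _.
set E2 := Ex P (fun x => Ex P (fun y => h2 y x ^+ 2)) in hB2 *.
have E20 : 0 <= E2 by apply: Ex_ge0 => x; apply: Ex_ge0 => y; exact: sqr_ge0.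
have : s * E2 <= m%:R ^+ 2 / 2 * B2 by apply: ler_pM.
have : m%:R * Ex P (fun x => q0 x ^+ 2) <= m%:R * A ^+ 2 by rewrite ler_wpM2l.
nra.
Qed.

(* On {t <= U} one of three things happens: some increment exceeds [a] (fourth
   moment bound), the sum of the [V j] exceeds 11/10 while its mean is at most 1 (variance bound),
   or the supermartingale is at least [expR (l * t - 3 / 5 * l ^+ 2)], since
   6/11 * (1 + 1/10) = 3/5. Hence the three terms. *)
Lemma U_tail (l a t A B2 C4 : R) :
  0 <= l -> 0 < a -> l * a <= 1 / 12 ->
  (forall x, 0 <= h2 x x <= A) ->
  Ex P (fun x => Ex P (fun y => h2 y x ^+ 2)) <= B2 ->
  Ex P (fun x => Ex P (fun y => h y x ^+ 4)) <= C4 ->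
  (\sum_(j < n) j%:R) * Ex P (fun x => h2 x x) <= 1 ->
  exists Y : Om -> R, [/\ bmf Y, forall w, 0 <= Y w,
    forall w, t <= \sum_(j < n) \sum_(i < j) h (X i w) (X j w) -> 1 <= Y w &
    Ex Q Y <= expR (3 / 5 * l ^+ 2 - l * t) +
      100 * (2 * n%:R ^+ 3 * A ^+ 2 + 4 * n%:R ^+ 4 * B2) +
      (n%:R ^+ 2 * C4 + 3 * n%:R ^+ 3 * A ^+ 2) / a ^+ 4].
Proof.
move=> l0 a0 la qA hB2 hC4 m1.
set e := Ex P _ in m1.
pose Z w := expR (l * \sum_(j < n) Num.min (D j w) a -
  6 / 11 * l ^+ 2 * \sum_(j < n) V j w).
pose c := expR (3 / 5 * l ^+ 2 - l * t).
pose W w := \sum_(j < n) (V j w - j%:R * e).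
pose F w := \sum_(j < n) D j w ^+ 4.
have bD j : (j < n)%N -> bmf (D j) by move=> jn; apply: (@Past_bmf n); exact: Past_D.
have bV j : (j < n)%N -> bmf (V j).
  by move=> jn; apply: (@Past_bmf n); apply: Past_V; exact: ltnW.
have bVe j : (j < n)%N -> bmf (fun w => V j w - j%:R * e).
  by move=> jn; apply: bmfB; [exact: bV | exact: bmf_cst].
have bZ : bmf Z.
  apply/bmf_expR/bmfB/bmfZ; first apply: bmfZ.
    by apply: (bmf_sum_nat (F := fun j w => Num.min (D j w) a)) => j jn; exact/bmf_min/bD.
  exact: bmf_sum_nat.
have bW : bmf W by exact: (bmf_sum_nat (F := fun j w => V j w - j%:R * e)).
have bF : bmf F.
  by apply: (bmf_sum_nat (F := fun j w => D j w ^+ 4)) => j jn; exact/bmfX/bD.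
have a4 : 0 < a ^+ 4 by exact: exprn_gt0.
have F0 w : 0 <= F w by apply: sumr_ge0 => j _; rewrite (exprM _ 2 2) sqr_ge0.
have EF : Ex Q F <= n%:R ^+ 2 * C4 + 3 * n%:R ^+ 3 * A ^+ 2.
  have C40 : 0 <= C4.
    apply: le_trans hC4; apply: Ex_ge0 => x; apply: Ex_ge0 => y.
    by rewrite (exprM _ 2 2) sqr_ge0.
  have -> : n%:R ^+ 2 * C4 + 3 * n%:R ^+ 3 * A ^+ 2 =
     \sum_(j < n) (n%:R * C4 + 3 * n%:R ^+ 2 * A ^+ 2).
    by rewrite sumr_const card_ord -mulr_natl; ring.
  rewrite (Ex_sumE Q _ (F := fun (j : 'I_n) w => D j w ^+ 4)) => [|j]; last exact/bmfX/bD.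
  apply: ler_sum => j _.
  have jn : j%:R <= n%:R :> R by rewrite ler_nat ltnW.
  apply: le_trans (Ex_D_pow4 bh sh h0 (A := A) (C4 := C4) (ltn_ord j) _ hC4) _.
    move=> x; under [X in Ex P X]eq_fun do rewrite expr2.
    by rewrite hconv; case/andP: (qA x).
  apply: lerD; first exact: ler_wpM2r.
  by rewrite ler_wpM2r ?sqr_ge0// ler_wpM2l// ler_sqr ?nnegrE.
have EW : Ex Q (fun w => W w ^+ 2) <= 2 * n%:R ^+ 3 * A ^+ 2 + 4 * n%:R ^+ 4 * B2.
  have B20 : 0 <= B2.
    by apply: le_trans hB2; apply: Ex_ge0 => x; apply: Ex_ge0 => y; exact: sqr_ge0.
  apply: (@le_trans _ _ (Ex Q (fun w => n%:R * \sum_(j < n) (V j w - j%:R * e) ^+ 2))).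
    apply: Ex_le; [exact/bmf_itg/bmfX| |].
      apply/bmf_itg/bmfZ.
      by apply: (bmf_sum_nat (F := fun j w => (V j w - j%:R * e) ^+ 2)) => j jn; exact/bmfX/bVe.
    by move=> w; exact: (sqr_sum_le (fun j => V j w - j%:R * e)).
  have bVi (j : 'I_n) : bmf (fun w => (V j w - j%:R * e) ^+ 2) by exact/bmfX/bVe.
  rewrite (ExZ _ (bmf_itg Q (bmf_sum _ bVi))) (Ex_sumE Q _ bVi).
  have -> : 2 * n%:R ^+ 3 * A ^+ 2 + 4 * n%:R ^+ 4 * B2 =
    n%:R * \sum_(j < n) (2 * n%:R * A ^+ 2 + 4 * n%:R ^+ 2 * B2).
    by rewrite sumr_const card_ord -mulr_natl; ring.
  rewrite ler_wpM2l//; apply: ler_sum => j _.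
  have jn : j%:R <= n%:R :> R by rewrite ler_nat ltnW.
  apply: le_trans (Ex_V_dev (ltnW (ltn_ord j)) qA hB2) _.
  apply: lerD; first by rewrite ler_wpM2r ?sqr_ge0// ler_wpM2l.
  by rewrite ler_wpM2r// ler_wpM2l// ler_sqr ?nnegrE.
(* One Markov-type variable for each of the three cases; 100 is the inverse square of the gap 1/10
   between 11/10 and the bound 1 on the mean. *)
exists (fun w => c * Z w + 100 * W w ^+ 2 + (a ^+ 4)^-1 * F w); split.
- by apply: bmfD; [apply: bmfD; apply: bmfZ => //; exact: bmfX | exact: bmfZ].
- move=> w; have ia4 : 0 <= a ^- 4 by rewrite invr_ge0 ltW.
  by apply: addr_ge0; [apply: addr_ge0|]; apply: mulr_ge0 => //;
    rewrite ?expR_ge0 ?sqr_ge0.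
- move=> w tU.
  have Z0 : 0 <= c * Z w by rewrite mulr_ge0 ?expR_ge0.
  have W0 : 0 <= 100 * W w ^+ 2 by rewrite mulr_ge0 ?sqr_ge0.
  have F0' : 0 <= (a ^+ 4)^-1 * F w by rewrite mulr_ge0 ?invr_ge0 // ltW.
  have [/existsP[j aj]|/existsPn Da] := boolP [exists j : 'I_n, a < D j w].
    suff : 1 <= (a ^+ 4)^-1 * F w by lra.
    rewrite mulrC ler_pdivlMr// mul1r; apply: (@le_trans _ _ (D j w ^+ 4)).
      by rewrite lerXn2r ?nnegrE// ltW// (lt_trans a0).
    rewrite /F (bigD1 j)//= lerDl; apply: sumr_ge0 => i _.
    by rewrite (exprM _ 2 2) sqr_ge0.
  have [W1|W1] := leP (11 / 10) (\sum_(j < n) V j w).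
    suff : 1 <= 100 * W w ^+ 2 by lra.
    have : 1 / 10 <= W w.
      by rewrite /W big_split/= sumrN -mulr_suml; lra.
    nra.
  suff : 1 <= c * Z w by lra.
  rewrite -expRD -[leLHS]expR0 ler_expR.
  have -> : \sum_(j < n) Num.min (D j w) a = \sum_(j < n) D j w.
    by apply: eq_bigr => j _; apply/min_idPl; rewrite leNgt.
  have : l * t <= l * \sum_(j < n) D j w by rewrite ler_wpM2l.
  have : 6 / 11 * l ^+ 2 * \sum_(j < n) V j w <= 6 / 11 * l ^+ 2 * (11 / 10).
    by rewrite ler_wpM2l ?mulr_ge0 ?sqr_ge0// ltW.
  lra.
have bW2 := bmfX 2 bW.
rewrite !ExD; try by apply: bmf_itg; auto using bmfD, bmfZ.
rewrite (ExZ _ (bmf_itg Q bZ)) (ExZ _ (bmf_itg Q bW2)) (ExZ _ (bmf_itg Q bF)).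
apply: lerD; first apply: lerD.
- by rewrite -[leRHS]mulr1 ler_wpM2l ?expR_ge0// Ex_supermartingale.
- by rewrite ler_wpM2l.
- by rewrite mulrC ler_wpM2r// invr_ge0 ltW.
Qed.

End Tail.

End Sample.

(** * Mercer kernels *)

Section RealSeries.
Context {R : realType}.
Implicit Types a b : nat -> R.

Lemma rsum_cvg a : cvgn (series a) ->
  (\sum_(0 <= k < N) a k) @[N --> \oo] --> rsum a.
Proof. by []. Qed.

Lemma rsumE a (l : R) : (\sum_(0 <= k < N) a k) @[N --> \oo] --> l -> rsum a = l.
Proof. by move=> al; exact: (cvg_lim _ al). Qed.

Lemma le_rsum_partial a N : (forall k, 0 <= a k) -> cvgn (series a) ->
  \sum_(0 <= k < N) a k <= rsum a.
Proof.
move=> a0 ca; apply: (@nondecreasing_cvgn_le R (series a)) => //.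
by apply: nondecreasing_series => *; exact: a0.
Qed.

Lemma rsum_le_bound a (C : R) : cvgn (series a) ->
  (forall N, \sum_(0 <= k < N) a k <= C) -> rsum a <= C.
Proof. by move=> ca aC; apply: limr_le => //; exact: nearW. Qed.

Lemma summable_bound a (C : R) : (forall k, 0 <= a k) ->
  (forall N, \sum_(0 <= k < N) a k <= C) -> cvgn (series a).
Proof.
move=> a0 aC; apply: nondecreasing_is_cvgn.
  by apply: nondecreasing_series => *; exact: a0.
by exists C => _ [N _ <-]; exact: aC.
Qed.

Lemma summable_le a b : (forall k, 0 <= a k <= b k) -> cvgn (series b) ->
  cvgn (series a).
Proof.
move=> ab; apply: series_le_cvg => k; have /andP[a0 ab'] := ab k => //.
exact: le_trans ab'.
Qed.

Lemma rsum_le a b : (forall k, 0 <= a k <= b k) -> cvgn (series b) ->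
  rsum a <= rsum b.
Proof.
move=> ab cb; apply: rsum_le_bound; first exact: summable_le ab cb.
move=> N; apply: le_trans (le_rsum_partial N _ cb).
  by apply: ler_sum => k _; case/andP: (ab k).
by move=> k; case/andP: (ab k) => a0; exact: le_trans.
Qed.

Lemma rsum_ge0 a : (forall k, 0 <= a k) -> cvgn (series a) -> 0 <= rsum a.
Proof. by move=> a0 /(le_rsum_partial 0 a0); rewrite big_geq. Qed.

Lemma cvg_sum_seq (I : Type) (s : seq I) (u : I -> nat -> R) (l : I -> R) :
  (forall i, u i @ \oo --> l i) ->
  (\sum_(i <- s) u i N) @[N --> \oo] --> \sum_(i <- s) l i.
Proof. by move=> ul; apply: cvg_big => //; exact: add_continuous. Qed.

Lemma sum_diag (f : nat -> nat -> R) N : (forall j k, j != k -> f j k = 0) ->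
  \sum_(0 <= j < N) \sum_(0 <= k < N) f j k = \sum_(0 <= k < N) f k k.
Proof.
move=> f0; apply: eq_big_nat => j /andP[_ jN].
rewrite (bigD1_seq j) ?mem_index_iota ?iota_uniq//= big1 ?addr0// => k kj.
by rewrite f0// eq_sym.
Qed.

End RealSeries.

Section Mercer.
Context {d} {T : measurableType d} {R : realType} (P0 : probability T R).
Variables (phi : nat -> T -> R) (B : R).
Hypotheses (mphi : forall k, measurable_fun setT (phi k))
  (phiB : forall k x, `|phi k x| <= B)
  (orth : forall j k, Ex P0 (fun x => phi j x * phi k x) = (j == k)%:R).

(** [Ktilde] with arbitrary weights: composing two such kernels multiplies their weights, so squared
    weights are needed as well. *)
Definition ker (w : nat -> R) (x y : T) : R :=
  rsum (fun k => w k * phi k x * phi k y).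

Definition kerN (w : nat -> R) (N : nat) (x y : T) : R :=
  \sum_(0 <= k < N) w k * phi k x * phi k y.

Lemma phi_bmf k : bmf (phi k). Proof. by split => //; exists B. Qed.

Lemma kerC w x y : ker w x y = ker w y x.
Proof. by congr rsum; apply/funext => k; rewrite mulrAC. Qed.

Lemma kerN_bkf w N : bkf (kerN w N).
Proof.
apply: (@bmf_sum _ _ _ _ _ (fun k (z : T * T) => w k * phi k z.1 * phi k z.2)) => k.
apply: bmfM; last exact: (bmf_comp (phi_bmf k) measurable_snd).
exact: (bmfZ (w k) (bmf_comp (phi_bmf k) measurable_fst)).
Qed.

Section Weights.
Variable w : nat -> R.
Hypotheses (w0 : forall k, 0 <= w k) (sw : cvgn (series w)).

Let phi2 k x y : `|w k * phi k x * phi k y| <= B ^+ 2 * w k.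
Proof.
rewrite !normrM (ger0_norm (w0 k)) -mulrA mulrC expr2.
by rewrite ler_wpM2r// ler_pM.
Qed.

Lemma ker_cvg x y : (kerN w N x y) @[N --> \oo] --> ker w x y.
Proof.
apply: rsum_cvg; apply: normed_cvg.
apply: (@summable_le _ _ (fun k => B ^+ 2 * w k)) => [k|].
  by rewrite normr_ge0 phi2.
exact: (@is_cvg_seriesZ _ w (B ^+ 2)).
Qed.

Lemma kerN_bound N x y : `|kerN w N x y| <= B ^+ 2 * rsum w.
Proof.
apply: le_trans (ler_norm_sum _ _ _) _.
apply: (@le_trans _ _ (\sum_(0 <= k < N) B ^+ 2 * w k)).
  by apply: ler_sum => k _; exact: phi2.
by rewrite -mulr_sumr ler_wpM2l ?sqr_ge0// le_rsum_partial.
Qed.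

Lemma ker_bound x y : `|ker w x y| <= B ^+ 2 * rsum w.
Proof.
have nF : `|kerN w N x y| @[N --> \oo] --> `|ker w x y|.
  by apply: cvg_norm; exact: ker_cvg.
rewrite -(cvg_lim _ nF)//; apply: limr_le; first by apply/cvg_ex; exists `|ker w x y|.
by apply: nearW => N; exact: kerN_bound.
Qed.

Lemma ker_bkf : bkf (ker w).
Proof.
split; last by exists (B ^+ 2 * rsum w) => z; exact: ker_bound.
apply: (measurable_fun_cvg (h := fun N (z : T * T) => kerN w N z.1 z.2)).
  by move=> N; case: (kerN_bkf w N).
by move=> z _; exact: ker_cvg.
Qed.

Lemma Ex_ker (P : probability T R) x :
  Ex P (ker w x) = rsum (fun k => w k * phi k x * Ex P (phi k)).
Proof.
apply/esym/rsumE.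
have [_ h] := @bounded_cvg_Ex _ _ _ P (fun N => kerN w N x) (ker w x) (B ^+ 2 * rsum w)
  (fun N => (bkf_r x (kerN_bkf w N)).1) (fun N y => kerN_bound N x y)
  (fun y => ker_cvg (x := x) (y := y)).
apply: cvg_trans h; apply: near_eq_cvg; apply: nearW => N.
rewrite (Ex_sumE P _ (F := fun k y => w k * phi k x * phi k y)) => [|k].
  by apply: eq_bigr => k _; rewrite ExZ//; exact/bmf_itg/phi_bmf.
exact/bmfZ/phi_bmf.
Qed.

Lemma ker_diag_bound x : 0 <= ker w x x <= B ^+ 2 * rsum w.
Proof.
rewrite (le_trans (ler_norm _) (ker_bound x x)) andbT; apply: limr_ge.
  exact: (ker_cvg (x := x) (y := x)).
by apply: nearW => N; apply: sumr_ge0 => k _; rewrite -mulrA mulr_ge0// -expr2 sqr_ge0.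
Qed.

Lemma Ex_ker_diag : Ex P0 (fun x => ker w x x) = rsum w.
Proof.
apply/esym/rsumE.
have mF N : measurable_fun setT (fun x => kerN w N x x).
  have mxx : measurable_fun setT (fun x : T => (x, x)).
    by apply/measurable_fun_pair; exact: measurable_id.
  by have [] := bmf_comp (kerN_bkf w N) mxx.
have [_ h] := @bounded_cvg_Ex _ _ _ P0 (fun N x => kerN w N x x) (fun x => ker w x x) (B ^+ 2 * rsum w)
  mF (fun N x => kerN_bound N x x) (fun x => ker_cvg (x := x) (y := x)).
apply: cvg_trans h; apply: near_eq_cvg; apply: nearW => N.
rewrite (Ex_sumE P0 _ (F := fun k x => w k * phi k x * phi k x)) => [|k].
  apply: eq_bigr => k _; under [X in Ex _ X]eq_fun do rewrite -mulrA.
  by rewrite ExZ ?orth ?eqxx ?mulr1//; apply: bmf_itg; apply: bmfM; exact: phi_bmf.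
by apply: bmfM; [apply: bmfZ|]; exact: phi_bmf.
Qed.

End Weights.

(** Composition of integral operators: by orthonormality only the diagonal of the double sum of
    partial kernels survives. *)
Lemma Ex_ker_conv (w v : nat -> R) x y :
  (forall k, 0 <= w k) -> (forall k, 0 <= v k) ->
  cvgn (series w) -> cvgn (series v) ->
  Ex P0 (fun z => ker w x z * ker v y z) = ker (fun k => w k * v k) x y.
Proof.
move=> w0 v0 sw sv; apply/esym/rsumE.
have [_ h] := @bounded_cvg_Ex _ _ _ P0 (fun N z => kerN w N x z * kerN v N y z)
  (fun z => ker w x z * ker v y z) ((B ^+ 2 * rsum w) * (B ^+ 2 * rsum v))
  (fun N => (bmfM (bkf_r x (kerN_bkf w N)) (bkf_r y (kerN_bkf v N))).1)
  (fun N z => ltac:(by rewrite normrM ler_pM// kerN_bound))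
  (fun z => cvgM (ker_cvg w0 sw (x := x) (y := z)) (ker_cvg v0 sv (x := y) (y := z))).
apply: cvg_trans h; apply: near_eq_cvg; apply: nearW => N.
have bf i k : bmf (fun z => (w i * phi i x * phi i z) * (v k * phi k y * phi k z)).
  by apply: bmfM; apply: bmfZ; exact: phi_bmf.
have -> : (fun z => kerN w N x z * kerN v N y z) = (fun z => \sum_(0 <= i < N) \sum_(0 <= k < N)
   (w i * phi i x * phi i z) * (v k * phi k y * phi k z)).
  apply/funext => z; rewrite /kerN mulr_suml; apply: eq_bigr => i _.
  by rewrite mulr_sumr.
rewrite (Ex_sumE P0 _ (F := fun i z => \sum_(0 <= k < N)
   (w i * phi i x * phi i z) * (v k * phi k y * phi k z))) => [|i]; last exact: bmf_sum.
under eq_bigr => i _.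
  rewrite (Ex_sumE P0 _ (F := fun k z =>
   (w i * phi i x * phi i z) * (v k * phi k y * phi k z)))//.
  under eq_bigr => k _.
    rewrite (_ : (fun z => _) = (fun z => (w i * phi i x * (v k * phi k y)) * (phi i z * phi k z)));
      last by apply/funext => z; ring.
    rewrite ExZ; last by apply: bmf_itg; apply: bmfM; exact: phi_bmf.
    rewrite orth.
    over.
  over.
rewrite sum_diag; last by move=> i k /negbTE ->; rewrite mulr0.
by apply: eq_bigr => k _; rewrite eqxx mulr1; ring.
Qed.

(** The squared Hilbert-Schmidt norm, computed as the trace of the squared operator. *)
Lemma Ex_ker_sqr (w : nat -> R) : (forall k, 0 <= w k) -> cvgn (series w) ->
  cvgn (series (fun k => w k ^+ 2)) ->
  Ex P0 (fun x => Ex P0 (fun y => ker w y x ^+ 2)) = rsum (fun k => w k ^+ 2).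
Proof.
move=> w0 sw sw2.
rewrite -(Ex_ker_diag (w := fun k => w k ^+ 2))//; last by move=> k; exact: sqr_ge0.
apply: eq_Rintegral => x _.
under [X in Ex _ X]eq_fun do rewrite expr2 kerC.
by rewrite Ex_ker_conv.
Qed.

End Mercer.

(** * The statistic under the null hypothesis *)

(** Expanding the squares makes [n * eta2] the V-statistic with kernel [Ktilde] divided by n. Its
    diagonal is exactly [An], and by symmetry the rest is twice the sum over i < j, whence the
    factor 2. *)
Lemma Tstat_ker {d} {T : measurableType d} {R : realType} (lam : nat -> R)
    (phi : nat -> T -> R) (B rho : R) (n : nat) (x : nat -> T) :
  (forall k, measurable_fun setT (phi k)) ->
  (forall k x, `|phi k x| <= B) -> (forall k, 0 <= wgt lam rho k) ->
  cvgn (series (wgt lam rho)) -> (0 < n)%N ->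
  Tstat lam phi rho n x = \sum_(j < n) \sum_(i < j)
    (2 / (n%:R * Num.sqrt (2 * vn lam rho)) * ker phi (wgt lam rho) (x i) (x j)).
Proof.
move=> mphi phiB w0 sw n0.
set w := wgt lam rho in w0 sw *.
have etaE : eta2 lam phi rho n x =
    n%:R^-1 ^+ 2 * \sum_(i < n) \sum_(j < n) ker phi w (x i) (x j).
  apply: rsumE; rewrite mulr_sumr.
  have -> : (fun N => \sum_(0 <= k < N)
       wgt lam rho k * (n%:R^-1 * \sum_(i < n) phi k (x i)) ^+ 2) =
     (fun N => \sum_(i < n) n%:R^-1 ^+ 2 * \sum_(j < n) kerN phi w N (x i) (x j)).
    apply/funext => N; rewrite -mulr_sumr.
    under [in RHS]eq_bigr do rewrite exchange_big/=.
    rewrite [in RHS]exchange_big/= mulr_sumr; apply: eq_bigr => k _.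
    rewrite exprMn mulrCA; congr (_ * _); rewrite expr2 mulr_suml mulr_sumr.
    apply: eq_bigr => i _; rewrite mulr_sumr mulr_sumr; apply: eq_bigr => j _.
    by rewrite mulrA.
  apply: (cvg_sum_seq (u := fun (i : 'I_n) N => n%:R^-1 ^+ 2 * \sum_(j < n) kerN phi w N (x i) (x j))) => i.
  apply: cvgMr; apply: (cvg_sum_seq (u := fun (j : 'I_n) N => kerN phi w N (x i) (x j))) => j.
  exact: (ker_cvg phiB w0 sw).
rewrite /Tstat etaE (sum_square_split n (g := fun i j => ker phi w (x i) (x j))); last first.
  by move=> i j; exact: kerC.
under [in RHS]eq_bigr do rewrite -mulr_sumr.
rewrite -mulr_sumr invfM /An -[Ktilde lam phi rho]/(ker phi w).
have nN0 : n%:R != 0 :> R by rewrite pnatr_eq0 -lt0n.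
set s := (Num.sqrt _)^-1.
by field.
Qed.

Section NullScale.
Context {d} {T : measurableType d} {R : realType} {d'} {Om : measurableType d'}.
Variables (Q : probability Om R) (P0 : probability T R) (n : nat) (X : nat -> Om -> T).
Hypothesis iid : iid_sample Q P0 n X.
Variables (phi : nat -> T -> R) (B : R) (w : nat -> R).
Hypotheses (mphi : forall k, measurable_fun setT (phi k))
  (phiB : forall k x, `|phi k x| <= B)
  (orth : forall j k, Ex P0 (fun x => phi j x * phi k x) = (j == k)%:R)
  (mean : forall k, Ex P0 (phi k) = 0)
  (w01 : forall k, 0 <= w k <= 1) (sw : cvgn (series w)) (n0 : (0 < n)%N).

Let N1 := rsum w.
Let v := rsum (fun k => w k ^+ 2).
Hypothesis v0 : 0 < v.

Let c := 2 / (n%:R * Num.sqrt (2 * v)).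
Let h x y := c * ker phi w x y.
Let h2 x y := c ^+ 2 * ker phi (fun k => w k * w k) x y.
Let U om := \sum_(j < n) \sum_(i < j) h (X i om) (X j om).

Let w0 k : 0 <= w k. Proof. by case/andP: (w01 k). Qed.
Let ww k : 0 <= w k * w k <= w k.
Proof. by case/andP: (w01 k) => ? ?; rewrite mulr_ge0//= ler_piMr. Qed.
Let ww0 k : 0 <= w k * w k. Proof. by case/andP: (ww k). Qed.
Let sw2 : cvgn (series (fun k => w k * w k)). Proof. exact: summable_le ww sw. Qed.
Let vE : rsum (fun k => w k * w k) = v. Proof. by []. Qed.
Let nR : 0 < n%:R :> R. Proof. by rewrite ltr0n. Qed.

Let c2 : c ^+ 2 = 2 / (n%:R ^+ 2 * v).
Proof.
rewrite /c exprMn exprVn exprMn sqr_sqrtr; last by rewrite mulr_ge0// ltW.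
by field; rewrite !gt_eqF.
Qed.

Let bh : bkf h. Proof. by apply: bmfZ; exact: (ker_bkf mphi phiB). Qed.
Let sh x y : h x y = h y x. Proof. by rewrite /h kerC. Qed.
Let ker0 (u : nat -> R) x : (forall k, 0 <= u k) -> cvgn (series u) -> Ex P0 (ker phi u x) = 0.
Proof.
move=> u0 su; rewrite (Ex_ker mphi phiB)//; apply: rsumE.
rewrite (_ : (fun N => _) = (fun=> 0)); first exact: cvg_cst.
by apply/funext => N; apply: big1 => k _; rewrite mean mulr0.
Qed.
Let h0 x : Ex P0 (h x) = 0.
Proof.
rewrite /h ExZ ?ker0 ?mulr0//; apply: bmf_itg.
by apply: bkf_r; exact: (ker_bkf mphi phiB).
Qed.

Let vn2 : Ex P0 (fun x => Ex P0 (fun y => ker phi w y x ^+ 2)) = v.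
Proof. by rewrite (Ex_ker_sqr mphi phiB). Qed.

Let Zker (e : R) k (u : nat -> R) : (forall k, 0 <= u k) -> cvgn (series u) ->
  Ex P0 (fun x => Ex P0 (fun y => (e * ker phi u y x) ^+ k)) =
  e ^+ k * Ex P0 (fun x => Ex P0 (fun y => ker phi u y x ^+ k)).
Proof.
move=> u0 su; have bk := bmfX k (ker_bkf mphi phiB u0 su).
rewrite -ExZ; last by apply: bmf_itg; exact: (bkf_Ex_l P0 P0 (h := fun y x => ker phi u y x ^+ k)).
apply: eq_Rintegral => x _; under [X in Ex P0 X = _]eq_fun do rewrite exprMn.
by rewrite ExZ//; apply: bmf_itg; exact: (bkf_l (h := fun y x => ker phi u y x ^+ k)).
Qed.

(** The normalisation makes the variance at most 1: [c^2 = 2 / (n^2 * v)], and there are at most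
    [n^2 / 2] pairs, each of second moment [c^2 * v]. *)
Lemma null_chebyshev (t : R) : 0 < t ->
  exists Y : Om -> R, [/\ bmf Y, forall om, 0 <= Y om,
    forall om, t <= U om -> 1 <= Y om & Ex Q Y <= (t ^+ 2)^-1].
Proof.
move=> t0; have bU : bmf U by apply: (Past_bmf iid (j := n)); exact: (Past_U).
have t20 : 0 < t ^+ 2 by exact: exprn_gt0.
exists (fun om => (t ^+ 2)^-1 * U om ^+ 2); split.
- exact/bmfZ/bmfX.
- by move=> om; rewrite mulr_ge0 ?sqr_ge0// invr_ge0 ltW.
- move=> om tU; rewrite mulrC ler_pdivlMr// mul1r ler_sqr ?nnegrE ?(ltW t0)//.
  exact: le_trans (ltW t0) tU.
rewrite (ExZ _ (bmf_itg Q (bmfX 2 bU))) -[leRHS]mulr1 ler_wpM2l ?invr_ge0 ?(ltW t20)//.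
rewrite (Ex_U_sqr iid bh sh h0)// Zker// vn2 c2.
have := @sum_ltn_nat R n; set s := \sum_(j < n) _ => sn.
rewrite (_ : _ * (_ * v) = s * (2 / n%:R ^+ 2)); last by field; rewrite !gt_eqF.
by rewrite mulrA ler_pdivrMr ?exprn_gt0//; lra.
Qed.

(** The term [16 / v] comes from the fluctuation of the conditional variances and is small because
    the effective dimension is large. The term in [N1^2 / (n^2 * v)] is the fourth-moment price of
    truncation, and it grows with the effective dimension. *)
Lemma null_tail (t : R) : 0 < t ->
  exists Y : Om -> R, [/\ bmf Y, forall om, 0 <= Y om,
    forall om, t <= U om -> 1 <= Y om &
    Ex Q Y <= expR (- (5 / 12 * t ^+ 2)) + 100 * (8 * B ^+ 4 / n%:R + 16 / v) +
      (4 * B ^+ 4 * N1 ^+ 2 / (n%:R ^+ 2 * v) + 12 * B ^+ 4 / n%:R) * (10 * t) ^+ 4].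
Proof.
move=> t0.
have sw4 : cvgn (series (fun k => (w k * w k) ^+ 2)).
  apply: (summable_le (b := w)) => // k; rewrite sqr_ge0/= expr2.
  by have /andP[? ?] := w01 k; rewrite (le_trans _ (_ : w k * w k <= _)) ?ler_piMr//; case/andP: (ww k) => //; nra.
have c20 : 0 <= c ^+ 2 by exact: sqr_ge0.
have kd2 := ker_diag_bound phiB ww0 sw2.
have bh2 : bkf h2 by apply: bmfZ; exact: (ker_bkf mphi phiB).
(* [l = 5/6 * t] minimises [3/5 * l^2 - l * t], with value [- 5/12 * t^2]; the truncation level
   [1 / (10 t)] then makes [l * a] equal to 1/12. The bound on the diagonal of [h2] is
   [c^2 * B^2 * v = 2 * B^2 / n^2]. In the fourth moment of h, two factors of the kernel are bounded
   by [B^2 * N1] and the other two integrate to v. *)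
have [] := @U_tail _ _ R _ _ Q P0 n X iid h h2 bh sh h0 bh2 _ _ _ (5 / 6 * t) (10 * t)^-1 t
  (c ^+ 2 * (B ^+ 2 * v)) (c ^+ 4 * v) (c ^+ 4 * ((B ^+ 2 * N1) ^+ 2 * v)).
- by move=> x y; rewrite /h2 kerC.
- move=> x; rewrite /h2 ExZ ?ker0 ?mulr0//; apply: bmf_itg.
  exact: bkf_r (ker_bkf mphi phiB ww0 sw2).
- move=> x y; rewrite /h /h2 -(Ex_ker_conv mphi phiB orth x y w0 w0 sw sw).
  rewrite -ExZ; first by apply: eq_Rintegral => z _; ring.
  by apply: bmf_itg; apply: bmfM; exact: bkf_r (ker_bkf mphi phiB w0 sw).
- by lra.
- by rewrite invr_gt0; lra.
- by rewrite invfM mulrACA divff ?gt_eqF//; lra.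
- by move=> x; have /andP[k1 k2] := kd2 x; rewrite /h2 mulr_ge0//= ler_wpM2l// -vE.
- rewrite Zker// -exprM ler_wpM2l ?exprn_even_ge0// (Ex_ker_sqr mphi phiB orth)//.
  apply: rsum_le; last by [].
  move=> k; rewrite sqr_ge0/= -[leRHS]mulr1 expr2 ler_wpM2l//.
  by have /andP[? ?] := w01 k; case/andP: (ww k) => _; move/le_trans; apply.
- rewrite Zker// ler_wpM2l ?exprn_even_ge0// -vn2.
  have bk := ker_bkf mphi phiB w0 sw.
  have bk2 := bkf_Ex_l P0 P0 (h := fun y x => ker phi w y x ^+ 2) (bmfX 2 bk).
  rewrite -(ExZ _ (bmf_itg P0 bk2)); apply: Ex_le.
  + by apply: bmf_itg; exact: (bkf_Ex_l P0 P0 (h := fun y x => ker phi w y x ^+ 4) (bmfX 4 bk)).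
  + exact/bmf_itg/bmfZ.
  move=> x; have bkx := bkf_l x bk.
  rewrite -(ExZ _ (bmf_itg P0 (bmfX 2 bkx))); apply: Ex_le.
  + exact/bmf_itg/bmfX.
  + exact/bmf_itg/bmfZ/bmfX.
  move=> y; rewrite (exprD _ 2 2) ler_wpM2r ?sqr_ge0// -[leLHS]real_normK ?num_real//.
  have hk := ker_bound phiB w0 sw y x.
  by rewrite ler_sqr ?nnegrE// (le_trans _ hk).
- rewrite /h2 ExZ; last first.
    have mxx : measurable_fun setT (fun x : T => (x, x)).
      by apply/measurable_fun_pair; exact: measurable_id.
    by apply: bmf_itg; exact: (bmf_comp (ker_bkf mphi phiB ww0 sw2) mxx).
  rewrite (Ex_ker_diag mphi phiB orth ww0 sw2) vE c2.
  have := @sum_ltn_nat R n; set s := \sum_(j < n) _ => sn.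
  rewrite (_ : _ * (_ * v) = s * (2 / n%:R ^+ 2)); last by field; rewrite !gt_eqF.
  by rewrite mulrA ler_pdivrMr ?exprn_gt0//; lra.
move=> Y [bY Y0 tY EY]; exists Y; split => //.
have c4 : c ^+ 4 = (2 / (n%:R ^+ 2 * v)) ^+ 2 by rewrite -c2 -exprM.
apply: le_trans EY _; apply: lerD; first apply: lerD.
- by rewrite ler_expR; lra.
- rewrite c4 c2.
  rewrite ler_wpM2l// le_eqVlt; apply/orP; left; apply/eqP.
  by field; rewrite !gt_eqF.
- rewrite exprVn invrK ler_wpM2r ?exprn_even_ge0//.
  rewrite c4 c2.
  rewrite le_eqVlt; apply/orP; left; apply/eqP.
  by field; rewrite !gt_eqF.
Qed.

End NullScale.

(** * Effective dimension *)

Section Spectral.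
Context {R : realType}.

Lemma pos_prefix_lb (f : nat -> R) m : (forall k, 0 < f k) ->
  exists2 a : R, 0 < a & forall k, (k < m)%N -> a <= f k.
Proof.
move=> f0; elim: m => [|m [a a0 ih]]; first by exists 1.
exists (Num.min a (f m)); first by rewrite lt_min a0 f0.
move=> k; rewrite ltnS leq_eqVlt => /predU1P[->|/ih]; rewrite ge_min ?lexx ?orbT//.
by move=> ->.
Qed.

Lemma prefix_ub (f : nat -> R) m :
  exists2 a : R, 0 < a & forall k, (k < m)%N -> f k <= a.
Proof.
elim: m => [|m [a a0 ih]]; first by exists 1.
exists (Num.max a (f m)); first by rewrite lt_max a0.
move=> k; rewrite ltnS leq_eqVlt => /predU1P[->|/ih]; rewrite le_max ?lexx ?orbT//.
by move=> ->.
Qed.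

(** A tail of the sequence stays above a positive number, and the finitely many terms before it are
    positive; this turns the asymptotic eigenvalue condition into a bound valid for every k. *)
Lemma limn_einf_gt0 (f : nat -> R) : (forall k, 0 < f k) ->
  (0 < limn_einf (fun k => (f k)%:E))%E -> exists2 a : R, 0 < a & forall k, a <= f k.
Proof.
move=> f0; rewrite limn_einf_lim.
have -> : limn (einfs (fun k => (f k)%:E)) = ereal_sup (range (einfs (fun k => (f k)%:E))).
  by apply/cvg_lim => //; exact: cvg_einfs_sup.
move=> /ereal_sup_gt.
move=> [_ [m _ <-]] im.
have [a a0 ha] := pos_prefix_lb m f0.
have [b b0 hb] : exists2 b : R, 0 < b & forall k, (m <= k)%N -> b <= f k.
  have ifm k : (m <= k)%N -> (einfs (fun k => (f k)%:E) m <= (f k)%:E)%E.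
    by move=> mk; apply: ereal_inf_lbound; exists k.
  have := ifm m (leqnn m); move: im ifm; case: (einfs _ m) => [r| |] //.
  by rewrite lte_fin => r0 ifm _; exists r => // k mk; rewrite -lee_fin ifm.
exists (Num.min a b); first by rewrite lt_min a0 b0.
move=> k; rewrite ge_min; have [km|mk] := ltnP k m; first by rewrite ha.
by rewrite hb// orbT.
Qed.

Lemma limn_esup_lty (f : nat -> R) :
  (limn_esup (fun k => (f k)%:E) < +oo)%E -> exists2 a : R, 0 < a & forall k, f k <= a.
Proof.
rewrite limn_esup_lim.
have -> : limn (esups (fun k => (f k)%:E)) = ereal_inf (range (esups (fun k => (f k)%:E))).
  by apply/cvg_lim => //; exact: cvg_esups_inf.
move=> /ereal_inf_lt.
move=> [_ [m _ <-]] im.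
have [a a0 ha] := prefix_ub f m.
have [b hb] : exists b : R, forall k, (m <= k)%N -> f k <= b.
  have ifm k : (m <= k)%N -> ((f k)%:E <= esups (fun k => (f k)%:E) m)%E.
    by move=> mk; apply: ereal_sup_ubound; exists k.
  have := ifm m (leqnn m); move: im ifm; case: (esups _ m) => [r| |] //.
  by move=> _ ifm _; exists r => // k mk; rewrite -lee_fin ifm.
exists (Num.max a b); first by rewrite lt_max a0.
move=> k; rewrite le_max; have [km|mk] := ltnP k m; first by rewrite ha.
by rewrite hb// orbT.
Qed.

(** Discrete form of the integral comparison for a power: [ln (x / (x + 1)) <= - 1 / (x + 1)] and
    [exp z >= 1 + z] give [(x / (x + 1))^(1 - q) >= 1 + (q - 1) / (x + 1)]. The right side
    telescopes when summed. *)
Lemma powR_telescope (q x : R) : 1 < q -> 0 < x ->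
  (q - 1) * (x + 1) `^ (- q) <= x `^ (1 - q) - (x + 1) `^ (1 - q).
Proof.
move=> q1 x0; have y0 : 0 < x + 1 by lra.
have xE : x `^ (1 - q) = (x + 1) `^ (1 - q) * (x / (x + 1)) `^ (1 - q).
  by rewrite -powRM ?divr_ge0 ?ltW// mulrCA divff ?gt_eqF// mulr1.
have yE : (x + 1) `^ (- q) = (x + 1) `^ (1 - q) / (x + 1).
  rewrite -[X in _ / X](powRr1 (ltW y0)) -powRB; last by rewrite (gt_eqF y0) implybT.
  by congr powR; ring.
have lnx : ln (x / (x + 1)) <= - (x + 1)^-1.
  have xy0 : 0 < x / (x + 1) by rewrite divr_gt0.
  rewrite -ler_expR lnK//; have := expR_ge1Dx (- (x + 1)^-1); apply: le_trans.
  rewrite le_eqVlt; apply/orP; left; apply/eqP; field; lra.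
have : 1 + (q - 1) / (x + 1) <= (x / (x + 1)) `^ (1 - q).
  rewrite /powR gt_eqF ?divr_gt0//; apply: le_trans (expR_ge1Dx _).
  rewrite lerD2l; have : 0 <= (q - 1) * (- (x + 1)^-1 - ln (x / (x + 1))).
    by rewrite mulr_ge0//; lra.
  lra.
have := powR_gt0 (1 - q) y0; rewrite xE yE.
set a := (x + 1) `^ _; set b := (x / _) `^ _ => a0 hb.
rewrite -subr_ge0 (_ : _ - _ = a * (b - (1 + (q - 1) / (x + 1)))); last by field; lra.
by apply: mulr_ge0; [exact: ltW | rewrite subr_ge0].
Qed.

Lemma powR_tail_sum (q : R) K N : 1 < q -> (0 < K)%N -> (K <= N)%N ->
  (q - 1) * (\sum_(K <= k < N) k.+1%:R `^ (- q)) <= K%:R `^ (1 - q).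
Proof.
move=> q1 K0 KN; rewrite mulr_sumr.
apply: (@le_trans _ _ (\sum_(K <= k < N) (k%:R `^ (1 - q) - k.+1%:R `^ (1 - q)))).
  apply: ler_sum_nat => k /andP[Kk _]; rewrite -natr1; apply: powR_telescope => //.
  by rewrite ltr0n (leq_trans K0 Kk).
have -> : \sum_(K <= k < N) (k%:R `^ (1 - q) - k.+1%:R `^ (1 - q)) =
    - \sum_(K <= k < N) (k.+1%:R `^ (1 - q) - k%:R `^ (1 - q)).
  by rewrite -sumrN; apply: eq_bigr => k _; rewrite opprB.
by rewrite (telescope_sumr (fun k => k%:R `^ (1 - q)) KN) opprB gerBl powR_ge0.
Qed.

Variables (lam : nat -> R) (s : R).
Hypotheses (lam0 : forall k, 0 < lam k) (s12 : 1 / 2 < s).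

Lemma wgt_bounds rho k : 0 < rho -> 0 < wgt lam rho k <= 1.
Proof.
move=> r0; rewrite /wgt; have := lam0 k => l0; have r2 : 0 < rho ^+ 2 by exact: exprn_gt0.
by rewrite divr_gt0 ?addr_gt0//= ler_pdivrMr ?addr_gt0// mul1r lerDl ltW.
Qed.

(** [D = rho^(-1/s)] is the index where eigenvalues cross [rho^2], as [D^(2 s) = rho^(-2)]. Below D
    the weights are bounded away from 0; beyond D they are at most a multiple of
    [rho^(-2) * k^(-2 s)], whose tail sum is again of order D. *)
Lemma spectral_bounds :
  (0 < limn_einf (fun k => (((k.+1)%:R `^ (2 * s)) * lam k)%:E))%E ->
  (limn_esup (fun k => (((k.+1)%:R `^ (2 * s)) * lam k)%:E) < +oo)%E ->
  exists C c : R, [/\ 0 < C, 0 < c & forall rho : R, 0 < rho <= 1 ->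
    [/\ cvgn (series (wgt lam rho)),
        rsum (wgt lam rho) <= C * rho `^ (- s^-1) &
        c * rho `^ (- s^-1) <= rsum (fun k => wgt lam rho k ^+ 2)]].
Proof.
have s12' := s12; have q1 : 1 < 2 * s by lra.
have s0 : 0 < s by lra.
have p0 k : 0 < k.+1%:R `^ (2 * s) :> R by rewrite powR_gt0.
move=> /limn_einf_gt0[|al al0 hal]; first by move=> k; exact: mulr_gt0.
move=> /limn_esup_lty[be be0 hbe].
(* The 2 is from [K + 1 <= 2 * D] for the indices up to [K = floor D], and [be / (2 s - 1)] from the
   tail. Below D each weight is at least [al / (al + 1)], and the final 1/2 is from [K >= D / 2]. *)
exists (2 + be / (2 * s - 1)), ((al / (al + 1)) ^+ 2 / 2).
have cc : 0 < al / (al + 1) by rewrite divr_gt0//; lra.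
split; first by rewrite addr_gt0// divr_gt0//; lra.
  by rewrite divr_gt0// exprn_gt0.
move=> rho /andP[r0 r1].
have r2 : 0 < rho ^+ 2 by exact: exprn_gt0.
set D := rho `^ (- s^-1).
have D1 : 1 <= D.
  have : rho `^ s^-1 <= 1 `^ s^-1.
    by rewrite ge0_ler_powR ?nnegrE ?invr_ge0 ?(ltW r0) ?(ltW s0).
  by rewrite powR1 /D powRN invf_ge1 ?powR_gt0.
have D0 : 0 < D by lra.
have Dq : D `^ (2 * s) = (rho ^+ 2)^-1.
  rewrite /D -powRrM (_ : _ * _ = - 2%:R); last by field; lra.
  by rewrite powR_invn ?ltW.
pose K := Num.truncn D.
have /andP[KD DK] : K%:R <= D < K.+1%:R by apply: Num.Theory.truncn_itv; exact: ltW.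
have K1 : (0 < K)%N by rewrite lt0n; apply/eqP => K0; move: DK; rewrite K0; lra.
have wb k := wgt_bounds k r0.
have w0 k : 0 <= wgt lam rho k by case/andP: (wb k) => /ltW.
have wtail k : wgt lam rho k <= be / rho ^+ 2 * k.+1%:R `^ (- (2 * s)).
  rewrite powRN mulrAC -mulrA /wgt.
  apply: (@le_trans _ _ (lam k / rho ^+ 2)).
    rewrite ler_wpM2l ?(ltW (lam0 k))// lef_pV2 ?posrE// ?addr_gt0//.
    by rewrite lerDr ltW.
  by rewrite mulrA ler_wpM2r ?invr_ge0 ?(ltW r2)// ler_pdivlMr// mulrC.
have pb N : \sum_(0 <= k < N) wgt lam rho k <= (2 + be / (2 * s - 1)) * D.
  apply: (@le_trans _ _ (\sum_(0 <= k < maxn N K.+1) wgt lam rho k)).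
    rewrite [leRHS](big_cat_nat (n := N)) ?leq_maxl//= lerDl.
    by apply: sumr_ge0.
  rewrite (big_cat_nat (n := K.+1)) ?leq_maxr//= mulrDl; apply: lerD.
    apply: (@le_trans _ _ (\sum_(0 <= k < K.+1) 1)).
      by apply: ler_sum => k _; case/andP: (wb k).
    rewrite sumr_const_nat subn0 -natr1; lra.
  apply: (@le_trans _ _ (\sum_(K.+1 <= k < maxn N K.+1) be / rho ^+ 2 * k.+1%:R `^ (- (2 * s)))).
    by apply: ler_sum.
  rewrite -mulr_sumr.
  have := powR_tail_sum q1 (isT : (0 < K.+1)%N) (leq_maxr N K.+1).
  set S := \sum_(_ <= k < _) _ => hS.
  have : K.+1%:R `^ (1 - 2 * s) <= D * rho ^+ 2.
    have -> : D * rho ^+ 2 = D `^ (1 - 2 * s).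
      by rewrite powRB ?(gt_eqF D0) ?implybT// powRr1 ?(ltW D0)// Dq invrK.
    rewrite (_ : 1 - 2 * s = - (2 * s - 1)); last by ring.
    rewrite !powRN lef_pV2 ?posrE ?powR_gt0//.
    by rewrite ge0_ler_powR ?nnegrE ?(ltW DK)//; lra.
  move=> hK; have {hS hK} hS : S <= D * rho ^+ 2 / (2 * s - 1).
    by rewrite ler_pdivlMr ?(le_trans _ hK) 1?mulrC//; lra.
  have -> : be / (2 * s - 1) * D = be / rho ^+ 2 * (D * rho ^+ 2 / (2 * s - 1)).
    by field; rewrite gt_eqF//=; lra.
  by rewrite ler_wpM2l// divr_ge0 ?ltW.
have cw : cvgn (series (wgt lam rho)) by exact: summable_bound pb.
have cw2 : cvgn (series (fun k => wgt lam rho k ^+ 2)).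
  apply: (summable_le _ cw) => k; rewrite sqr_ge0/= expr2 ler_piMr//.
  by case/andP: (wb k).
split=> //; first exact: rsum_le_bound pb.
apply: le_trans (le_rsum_partial K _ cw2); last by move=> k; exact: sqr_ge0.
apply: (@le_trans _ _ (\sum_(0 <= k < K) (al / (al + 1)) ^+ 2)).
  rewrite sumr_const_nat subn0 -[_ *+ K]mulr_natr.
  have K1' : 1 <= K%:R :> R by rewrite ler1n.
  have : 0 <= (al / (al + 1)) ^+ 2 * (K%:R - D / 2).
    rewrite mulr_ge0 ?sqr_ge0//; move: DK; rewrite -natr1; lra.
  lra.
apply: ler_sum_nat => k /andP[_ kK].
rewrite ler_sqr ?nnegrE ?(ltW cc)//.
have lk : al * rho ^+ 2 <= lam k.
  have pD : k.+1%:R `^ (2 * s) <= (rho ^+ 2)^-1.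
    rewrite -Dq ge0_ler_powR ?nnegrE ?(ltW D0)//; first lra.
    by apply: le_trans KD; rewrite ler_nat.
  rewrite -ler_pdivlMr//; apply: le_trans (hal k) _.
  by rewrite mulrC ler_wpM2l// ltW.
have := lam0 k => l0.
rewrite /wgt ler_pdivrMr; last lra.
by rewrite mulrAC ler_pdivlMr ?addr_gt0//; nra.
Qed.

End Spectral.

(** * The grid of scales *)

Section Scales.
Context {R : realType}.

Lemma expR_ge_pow (x : R) k : 0 <= x -> (0 < k)%N -> (x / k%:R) ^+ k <= expR x.
Proof.
move=> x0 k0; have kR : 0 < k%:R :> R by rewrite ltr0n.
have -> : expR x = expR (x / k%:R) ^+ k.
  by rewrite -expRM_natl; congr expR; field; rewrite gt_eqF.
rewrite lerXn2r ?nnegrE ?expR_ge0 ?divr_ge0 ?(ltW kR)//.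
by apply: le_trans (expR_ge1Dx _); lra.
Qed.

Lemma loglog_large (A : R) : exists N, forall n, (N <= n)%N -> A <= loglog n.
Proof.
exists (Num.truncn (expR (expR A))).+1 => n Nn.
have h : expR (expR A) <= n%:R.
  have /andP[_ h] := Num.Theory.truncn_itv (expR_ge0 (expR A)).
  by apply: le_trans (ltW h) _; rewrite ler_nat.
have n0 : 0 < n%:R :> R by exact: lt_le_trans (expR_gt0 _) h.
have h1 : expR A <= ln n%:R by rewrite -ler_expR lnK.
rewrite /loglog -ler_expR lnK// posrE; exact: lt_le_trans (expR_gt0 _) h1.
Qed.

Section Fixed.
Variables (n : nat) (s : R).
Hypotheses (s0 : 0 < s) (L1 : 1 <= loglog n :> R).
Let L : R := loglog n.
Let x : R := ln n%:R.
Let r : R := Num.sqrt (loglog n) / n%:R.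

(** [ln] takes the default value 0 on nonpositive arguments, so [loglog n >= 1] already forces
    [n > 0] and [ln n > 0]. Largeness of n is therefore always expressed through [loglog n]. *)
Lemma loglog_ge1 : [/\ (0 < n)%N, n%:R = expR x, x = expR L & 0 < r].
Proof.
have x0 : 0 < x.
  rewrite ltNge; apply/negP => xle; move: L1; rewrite /loglog ln0//.
  by rewrite ler10.
have n0 : (0 < n)%N.
  by rewrite lt0n; apply/eqP => nE; move: x0; rewrite /x nE ln0 ?ltxx.
have nR : 0 < n%:R :> R by rewrite ltr0n.
split => //; first by rewrite lnK.
  by rewrite /L /loglog lnK.
by rewrite divr_gt0// sqrtr_gt0; exact: lt_le_trans ltr01 L1.
Qed.

(** From [sqrt L <= L <= x <= 2 * exp (x / 2)], where [exp x = n]. The decay estimates only need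
    some negative power of n. *)
Lemma r_le : r <= 2 * expR (- (x / 2)).
Proof.
have [n0 nE xE r0] := loglog_ge1.
have L1' : 1 <= L := L1.
have Lx : L <= x by rewrite xE; apply: le_trans (expR_ge1Dx _); lra.
have sL : Num.sqrt L <= L.
  have sq : Num.sqrt L ^+ 2 = L by rewrite sqr_sqrtr// (le_trans ler01).
  have : 1 <= Num.sqrt L by rewrite -[leLHS]sqrtr1 ler_wsqrtr.
  by move=> h; rewrite -[leRHS]sq expr2 ler_peMr// (le_trans ler01).
have xe : x <= 2 * expR (x / 2) by have := expR_ge1Dx (x / 2); lra.
rewrite /r ler_pdivrMr ?ltr0n// nE -mulrA -expRD.
rewrite (_ : - (x / 2) + x = x / 2); last by field.
exact: le_trans (le_trans sL Lx) xe.
Qed.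

Lemma inv_r_le : r^-1 <= expR x.
Proof.
have [n0 nE xE r0] := loglog_ge1.
rewrite /r invfM invrK nE ler_piMl ?expR_ge0// invf_le1 ?sqrtr_gt0.
  by rewrite -sqrtr1 ler_wsqrtr.
exact: lt_le_trans ltr01 L1.
Qed.

Lemma rho_star_gt0 : 0 < rho_star s n.
Proof. by have [_ _ _ r0] := loglog_ge1; rewrite powR_gt0. Qed.

(** The effective dimension along the grid: it starts at [r^(-2) = n^2 / loglog n] and shrinks by
    the factor [2^(-1/s)] at each step. *)
Lemma rho_powR k : (2 ^+ k * rho_star s n) `^ (- s^-1) =
  (2 `^ (- s^-1)) ^+ k / r ^+ 2.
Proof.
have [_ _ _ r0] := loglog_ge1.
rewrite powRM ?exprn_ge0 ?powR_ge0//; congr (_ * _).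
  by rewrite -powR_mulrn// powRAC powR_mulrn ?powR_ge0.
rewrite /rho_star -powRrM (_ : 2 * s * - s^-1 = - 2%:R); last by field; rewrite gt_eqF.
by rewrite powR_invn// ltW.
Qed.

Hypothesis r1 : r <= 1.
Let b := 2 * s / (4 * s + 1).
Let m := m_star s n.

(** Rounding the base-2 logarithm of [r^b / rho_star] up places the last grid point within a factor
    2 above [r^b]. The number of points is logarithmic since this ratio is at most
    [r^(-2 s) <= n^(2 s)]. *)
Lemma grid_bounds : [/\ r `^ b <= 2 ^+ m * rho_star s n,
  2 ^+ m * rho_star s n <= 2 * r `^ b & m%:R <= 1 + 2 * s * x / ln 2].
Proof.
have s0' := s0.
have [n0 nE xE r0] := loglog_ge1.
have ln2 : 0 < ln 2 :> R by rewrite ln_gt0// ltr1n.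
have b0 : 0 < b by rewrite divr_gt0//; lra.
have b2s : b <= 2 * s by rewrite ler_pdivrMr; [nra|lra].
have rs0 := rho_star_gt0.
have rb0 : 0 < r `^ b by rewrite powR_gt0.
pose A := (rho_star s n)^-1 * r `^ b.
have A0 : 0 < A by rewrite mulr_gt0// invr_gt0.
have A1 : 1 <= A.
  rewrite /A mulrC ler_pdivlMr// mul1r /rho_star ger_powR ?r0//.
pose z := ln A / ln 2.
have z0 : 0 <= z by apply: divr_ge0; [exact: ln_ge0 | exact: ltW].
have zE : expR (z * ln 2) = A by rewrite /z mulfVK ?gt_eqF// lnK.
(* Because [A >= 1] the ceiling is nonnegative, so [int_to_nat] does not fall back to its default
   0. *)
have mE : m%:R = (Num.ceil z)%:~R :> R.
  rewrite /m /m_star -/r -/A -/b -/z.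
  have : 0 <= Num.ceil z by rewrite ceil_ge0; lra.
  by case: (Num.ceil z) => k.
have zm : z <= m%:R by rewrite mE; exact: Num.Theory.ceil_ge.
have mz : m%:R < z + 1 by rewrite mE; have := Num.Theory.ceilB1_lt z; rewrite intrD; lra.
have p2 : 2 ^+ m = expR (m%:R * ln 2) :> R by rewrite -{1}(@lnK _ 2) ?posrE// -expRM_natl.
have Ar : A * rho_star s n = r `^ b by rewrite /A mulrAC mulVf ?mul1r// gt_eqF.
split.
- by rewrite -Ar ler_wpM2r ?(ltW rs0)// -zE p2 ler_expR ler_wpM2r// ltW.
- rewrite -Ar mulrA ler_wpM2r ?(ltW rs0)// -zE p2 -{2}(@lnK _ 2) ?posrE// -expRD ler_expR.
  by rewrite -[X in X + _]mul1r -mulrDl ler_wpM2r ?(ltW ln2)// addrC ltW.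
- apply: le_trans (ltW mz) _; rewrite addrC lerD2l /z ler_wpM2r ?invr_ge0 ?(ltW ln2)//.
  rewrite -ler_expR lnK ?posrE// /A.
  apply: (@le_trans _ _ (rho_star s n)^-1).
    rewrite ler_piMr ?invr_ge0 ?(ltW rs0)//.
    by rewrite -(powRr0 r) ger_powR ?r0// ltW.
  rewrite /rho_star -/r.
  have -> : (r `^ (2 * s))^-1 = (r^-1) `^ (2 * s).
    by rewrite -powRN -(powR_inv1 (ltW r0)) -powRrM mulN1r.
  have -> : expR (2 * s * x) = expR x `^ (2 * s) by rewrite -expRM mulrC.
  apply: ge0_ler_powR; last exact: inv_r_le.
  - by rewrite mulr_ge0// ltW.
  - by rewrite nnegrE invr_ge0 ltW.
  - by rewrite nnegrE expR_ge0.
Qed.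

End Fixed.
End Scales.

(** * Decay of the error terms against the size of the grid *)

Section NullAsymptotics.
Context {R : realType}.
Local Notation LL n := (loglog n : R).
Local Notation lnn n := (ln n%:R : R).
Local Notation rr n := (Num.sqrt (loglog n) / n%:R : R).

Lemma ln_ge_loglog n : 1 <= LL n -> LL n <= lnn n.
Proof.
move=> L1; have [_ _ xE _] := loglog_ge1 L1.
rewrite xE; apply: le_trans (expR_ge1Dx _); rewrite /loglog; lra.
Qed.

Lemma sqrt_loglog n : 1 <= LL n ->
  [/\ 1 <= Num.sqrt (LL n), Num.sqrt (LL n) ^+ 2 = LL n & Num.sqrt (LL n) <= LL n].
Proof.
move=> L1; have sq : Num.sqrt (LL n) ^+ 2 = LL n by rewrite sqr_sqrtr// (le_trans ler01).
have u1 : 1 <= Num.sqrt (LL n) by rewrite -[leLHS]sqrtr1 ler_wsqrtr.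
by split => //; rewrite -[leRHS]sq expr2 ler_peMr// (le_trans ler01).
Qed.

Lemma r_le_inv n : 1 <= LL n -> rr n <= 4 / LL n.
Proof.
move=> L1; have Lx := ln_ge_loglog L1; have L0 : 0 < LL n by exact: lt_le_trans L1.
have x0 : 0 < lnn n by exact: lt_le_trans Lx.
apply: le_trans (r_le L1) _.
apply: (@le_trans _ _ (4 / lnn n)); last by rewrite ler_wpM2l// lef_pV2.
rewrite expRN (_ : 4 / lnn n = 2 * (lnn n / 2)^-1); last by field; rewrite gt_eqF.
rewrite ler_wpM2l// lef_pV2 ?posrE ?expR_gt0 ?divr_gt0//.
by apply: le_trans (expR_ge1Dx _); rewrite lerDr.
Qed.

(** Here and below the factor [ln n] stands for the number of scales. The exponential is the power
    -5/4 of [ln n], so a surplus [exp (- loglog n / 4)] is left. *)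
Lemma decay_exp n : 1 <= LL n ->
  lnn n * expR (- (5 / 4 * LL n)) <= 4 / Num.sqrt (LL n).
Proof.
move=> L1; have [_ _ xE _] := loglog_ge1 L1; have L0 : 0 < LL n by exact: lt_le_trans L1.
have [u1 _ uL] := sqrt_loglog L1.
rewrite [lnn n]xE -expRD (_ : _ + _ = - (LL n / 4)); last by field.
apply: (@le_trans _ _ (4 / LL n)); last first.
  by rewrite ler_wpM2l// lef_pV2 ?posrE// (lt_le_trans ltr01).
rewrite expRN -[4 / _]invf_div lef_pV2 ?posrE ?expR_gt0 ?divr_gt0//.
by apply: le_trans (expR_ge1Dx _); rewrite lerDr.
Qed.

(** With [x = ln n >= loglog n], the claim reduces to [x^4 <= 256 * n], which is
    [exp x >= (x / 4)^4]. *)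
Lemma decay_inv_n n : 1 <= LL n ->
  lnn n * (LL n ^+ 2 / n%:R) <= 256 / Num.sqrt (LL n).
Proof.
move=> L1; have [n0 nE xE _] := loglog_ge1 L1; have L0 : 0 < LL n by exact: lt_le_trans L1.
have [u1 _ uL] := sqrt_loglog L1; have Lx := ln_ge_loglog L1.
have x0 : 0 < lnn n by exact: lt_le_trans Lx.
apply: (@le_trans _ _ (256 / lnn n)); last first.
  apply: ler_wpM2l; first by rewrite ler0n.
  by rewrite lef_pV2 ?posrE ?(le_trans uL Lx) ?(lt_le_trans ltr01 u1).
rewrite mulrA ler_pdivrMr ?ltr0n// mulrAC ler_pdivlMr//.
have := expR_ge_pow (k := 4) (ltW x0) isT; rewrite -nE => h.
apply: (@le_trans _ _ (lnn n ^+ 4)).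
  rewrite [leRHS](_ : _ = lnn n * lnn n ^+ 2 * lnn n); last by ring.
  rewrite ler_wpM2r ?(ltW x0)// ler_wpM2l ?(ltW x0)//.
  by rewrite ler_sqr ?nnegrE ?(ltW x0) ?(ltW L0).
by move: h; rewrite expr_div_n ler_pdivrMr ?exprn_gt0// mulrC -natrX.
Qed.

(** By [r_le] the power is at most [2^a * exp (- a * x / 2)] with [x = ln n], and
    [exp (a * x / 2) >= (a * x / 4)^2]; hence the 16. *)
Lemma decay_r_pow (a : R) n : 0 < a -> 1 <= LL n ->
  lnn n * rr n `^ a <= 2 `^ a * 16 / a ^+ 2 / Num.sqrt (LL n).
Proof.
move=> a0 L1; have [n0 nE xE r0] := loglog_ge1 L1; have L0 : 0 < LL n by exact: lt_le_trans L1.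
have [u1 _ uL] := sqrt_loglog L1; have Lx := ln_ge_loglog L1.
have x0 : 0 < lnn n by exact: lt_le_trans Lx.
have ra : rr n `^ a <= 2 `^ a * expR (- (a * lnn n / 2)).
  rewrite (_ : - (a * lnn n / 2) = - (lnn n / 2) * a); last by ring.
  rewrite expRM -powRM ?expR_ge0//; apply: ge0_ler_powR; last exact: r_le.
  - exact: ltW.
  - by rewrite nnegrE ltW.
  - by rewrite nnegrE mulr_ge0 ?expR_ge0.
apply: (@le_trans _ _ (lnn n * (2 `^ a * expR (- (a * lnn n / 2))))).
  by rewrite ler_wpM2l ?(ltW x0).
apply: (@le_trans _ _ (2 `^ a * 16 / a ^+ 2 / lnn n)); last first.
  apply: ler_wpM2l.
    by apply: divr_ge0; [apply: mulr_ge0; [exact: powR_ge0|exact: ler0n] | exact: sqr_ge0].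
  by rewrite lef_pV2 ?posrE ?(le_trans uL Lx) ?(lt_le_trans ltr01 u1).
rewrite mulrCA -!mulrA ler_wpM2l ?powR_ge0// expRN.
have ax0 : 0 <= a * (lnn n / 2).
  by apply: mulr_ge0; [exact: ltW | apply: divr_ge0; [exact: ltW | exact: ler0n]].
have h := expR_ge_pow (k := 2) ax0 isT.
rewrite ler_pdivrMr ?expR_gt0// mulrC.
apply: le_trans (ler_wpM2r _ h); last by rewrite !mulr_ge0 ?invr_ge0 ?sqr_ge0 ?(ltW x0).
rewrite le_eqVlt; apply/orP; left; apply/eqP; field.
by rewrite !gt_eqF.
Qed.

(** With [u = sqrt (loglog n)] and [l = - ln y], rounding u down costs a factor [1 / y] in
    [exp (- l * u)]. The bound [exp (l * u) >= (l * u / 3)^3] beats [loglog n = u^2] and leaves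
    [1 / u]; hence 27. *)
Lemma decay_geom (y : R) n : 0 < y < 1 -> 1 <= LL n ->
  LL n * y ^+ Num.truncn (Num.sqrt (LL n)) <=
  y^-1 * (27 / (- ln y) ^+ 3) / Num.sqrt (LL n).
Proof.
move=> /andP[y0 y1] L1; have [u1 u2 uL] := sqrt_loglog L1.
set u := Num.sqrt (LL n) in u1 u2 uL *; have u0 : 0 < u by exact: lt_le_trans u1.
have /andP[_ uK] := Num.Theory.truncn_itv (ltW u0).
set K := Num.truncn u in uK *.
pose l := - ln y; have l0 : 0 < l by rewrite oppr_gt0 ln_lt0// y0.
have yE : y = expR (- l) by rewrite opprK lnK.
have yK : y ^+ K <= y^-1 * expR (- (l * u)).
  rewrite yE -expRN -expRM_natl -expRD ler_expR opprK.
  have : 0 <= l * (K.+1%:R - u) by rewrite mulr_ge0 ?(ltW l0)// subr_ge0 ltW.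
  by rewrite -natr1 /l; lra.
apply: (@le_trans _ _ (LL n * (y^-1 * expR (- (l * u))))).
  by rewrite ler_wpM2l// (le_trans _ L1).
rewrite mulrCA -!mulrA ler_wpM2l ?invr_ge0 ?(ltW y0)// expRN -u2.
have h := @expR_ge_pow R (l * u) 3 (mulr_ge0 (ltW l0) (ltW u0)) isT.
rewrite ler_pdivrMr ?expR_gt0// mulrC.
apply: le_trans (ler_wpM2r _ h); last first.
  by rewrite !mulr_ge0 ?invr_ge0 ?exprn_ge0 ?(ltW l0) ?(ltW u0).
rewrite le_eqVlt; apply/orP; left; apply/eqP; rewrite -/l; field.
by rewrite !gt_eqF.
Qed.

Lemma geom_tail_sum (y : R) K N : 0 < y < 1 ->
  \sum_(0 <= k < N) (if (K <= k)%N then y ^+ k else 0) <= y ^+ K / (1 - y).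
Proof.
move=> /andP[y0 y1]; have y1' : 0 < 1 - y by rewrite subr_gt0.
(* The exact value of the partial sum carries the induction; [maxn K N] covers the case N < K, where
   every summand is 0. *)
suff : \sum_(0 <= k < N) (if (K <= k)%N then y ^+ k else 0) <=
    (y ^+ K - y ^+ maxn K N) / (1 - y).
  move=> /le_trans; apply; rewrite ler_wpM2r ?invr_ge0 ?(ltW y1')// gerBl.
  by rewrite exprn_ge0// ltW.
elim: N => [|N ih]; first by rewrite big_geq// maxn0 subrr mul0r.
rewrite big_nat_recr//=; case: ifP => KN; last first.
  rewrite addr0; apply: le_trans ih _; rewrite ler_wpM2r ?invr_ge0 ?(ltW y1')//.
  move/negbT: KN; rewrite -ltnNge => NK.
  by rewrite (maxn_idPl (ltnW NK)) (maxn_idPl NK).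
move: ih; rewrite (maxn_idPr KN) (maxn_idPr (leqW KN)) => ih.
apply: le_trans (lerD ih (lexx _)) _.
rewrite -[X in _ + X](@mulfK _ (1 - y)) ?gt_eqF// -mulrDl ler_wpM2r ?invr_ge0 ?(ltW y1')//.
by rewrite exprS; lra.
Qed.

End NullAsymptotics.

Section NullTheorem.
Context {R : realType}.
Local Notation LL n := (loglog n : R).
Local Notation rr n := (Num.sqrt (loglog n) / n%:R : R).

Lemma two_powRN_lt1 (s : R) : 0 < s -> (0 : R) < 2 `^ (- s^-1) < 1.
Proof.
move=> s0; rewrite powR_gt0//= powRN invf_lt1 ?powR_gt0//.
have : 1 `^ s^-1 < 2 `^ s^-1 :> R.
  by apply: gt0_ltr_powR; rewrite ?invr_gt0 ?nnegrE ?ltr1n.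
by rewrite powR1.
Qed.

(** Fewer than [sqrt (loglog n)] scales cost [1 / (3 loglog n)] each, and the geometric terms sum to
    a multiple of the first one. The terms common to all scales are multiplied by at most
    [M * ln n], where [M = 2 + 2 s / ln 2] uses [ln n >= 1]. *)
Lemma null_sum_bound (s a g1 g3 H : R) : 0 < s -> 0 < a -> 0 <= g1 -> 0 <= g3 -> 0 <= H ->
  exists K : R, forall n, 1 <= LL n -> rr n <= 1 ->
  \sum_(0 <= k < (m_star s n : nat).+1)
    (if (k < Num.truncn (Num.sqrt (LL n)))%N then (3 * LL n)^-1
     else expR (- (5 / 4 * LL n)) + g1 * (LL n ^+ 2 / n%:R) + g3 * rr n `^ a +
       H * (LL n * (2 `^ (- s^-1)) ^+ k)) <= K / Num.sqrt (LL n).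
Proof.
move=> s0 a0 g10 g30 H0.
have y01 := two_powRN_lt1 s0; set y := 2 `^ (- s^-1) in y01 *.
have ln2 : 0 < ln 2 :> R by rewrite ln_gt0// ltr1n.
pose M := 2 + 2 * s / ln 2.
have M0 : 0 <= M by rewrite addr_ge0// divr_ge0 ?mulr_ge0 ?(ltW s0) ?(ltW ln2).
pose Ca := 2 `^ a * 16 / a ^+ 2.
pose Cy := y^-1 * (27 / (- ln y) ^+ 3).
exists (3^-1 + M * (4 + g1 * 256 + g3 * Ca) + H * (Cy / (1 - y))) => n L1 r1.
have [u1 u2 uL] := sqrt_loglog L1.
have L0 : 0 < LL n by exact: lt_le_trans L1.
have Lx := ln_ge_loglog L1.
have [n0 nE xE r0] := loglog_ge1 L1.
have [_ _ mM] := grid_bounds s0 L1 r1.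
set m := m_star s n in mM *; set x : R := ln n%:R in Lx nE xE mM *.
set k0 := Num.truncn _.
set u := Num.sqrt (LL n) in u1 u2 uL k0 *.
have u0 : 0 < u by exact: lt_le_trans u1.
have /andP[k0u _] := Num.Theory.truncn_itv (ltW u0).
set G := expR (- (5 / 4 * LL n)) + g1 * (LL n ^+ 2 / n%:R) + g3 * rr n `^ a.
have G0 : 0 <= G.
  rewrite /G; apply: addr_ge0; first apply: addr_ge0; rewrite ?expR_ge0//.
    by apply: mulr_ge0 => //; apply: divr_ge0; [exact: sqr_ge0 | exact: ler0n].
  by apply: mulr_ge0 => //; exact: powR_ge0.
have /andP[y0 y1] := y01.
apply: (@le_trans _ _ (k0%:R / (3 * LL n) + m.+1%:R * G +
   H * (LL n * (y ^+ k0 / (1 - y))))).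
  apply: (@le_trans _ _ (\sum_(0 <= k < m.+1) ((if (k < k0)%N then (3 * LL n)^-1 else 0) + G +
     H * (LL n * (if (k0 <= k)%N then y ^+ k else 0))))).
    apply: ler_sum => k _; case: ltnP => kk; first by rewrite !mulr0 addr0 lerDl.
    by rewrite add0r.
  rewrite big_split big_split/= -!mulr_sumr; apply: lerD; first apply: lerD.
  (* The cut-off [k0] may exceed the number of grid points, so the sum is first extended to cover
     both. *)
  - apply: (@le_trans _ _ (\sum_(0 <= k < maxn m.+1 k0) (if (k < k0)%N then (3 * LL n)^-1 else 0))).
      rewrite [leRHS](big_cat_nat (n := m.+1)) ?leq_maxl//= lerDl; apply: sumr_ge0 => k _.
      by case: ifP => // _; rewrite invr_ge0 mulr_ge0// ltW.
    rewrite (big_cat_nat (n := k0)) ?leq_maxr//=.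
    have -> : \sum_(k0 <= k < maxn m.+1 k0) (if (k < k0)%N then (3 * LL n)^-1 else 0) = 0.
      rewrite big_nat_cond big1// => k /andP[/andP[+ _] _].
      by rewrite leqNgt => /negbTE ->.
    have -> : \sum_(0 <= k < k0) (if (k < k0)%N then (3 * LL n)^-1 else 0) =
      \sum_(0 <= k < k0) (3 * LL n)^-1 by apply: eq_big_nat => k /andP[_ ->].
    by rewrite addr0 sumr_const_nat subn0 -[_ *+ k0]mulr_natl.
  - by rewrite sumr_const_nat subn0 -[_ *+ m.+1]mulr_natl.
  - apply: ler_wpM2l => //; apply: ler_wpM2l; first exact: ltW.
    exact: geom_tail_sum.
have dD (p q t v : R) : (p + q + t) * v = p * v + q * v + t * v by ring.
have hG : x * G <= (4 + g1 * 256 + g3 * Ca) / u.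
  have -> : x * G = x * expR (- (5 / 4 * LL n)) + g1 * (x * (LL n ^+ 2 / n%:R)) +
      g3 * (x * rr n `^ a) by rewrite /G; ring.
  have -> : (4 + g1 * 256 + g3 * Ca) / u = 4 / u + g1 * (256 / u) + g3 * (Ca / u).
    by rewrite dD -(mulrA g1) -(mulrA g3).
  apply: lerD; first apply: lerD.
  - exact: decay_exp.
  - by apply: ler_wpM2l => //; exact: decay_inv_n.
  - by apply: ler_wpM2l => //; exact: decay_r_pow.
have hm : m.+1%:R <= M * x.
  have : 1 <= x by exact: le_trans L1 Lx.
  rewrite -natr1 /M mulrDl (_ : 2 * s / ln 2 * x = 2 * s * x / ln 2); last by ring.
  by lra.
rewrite dD; apply: lerD; first apply: lerD.
- rewrite invfM mulrCA; apply: ler_wpM2l; first by rewrite invr_ge0.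
  rewrite ler_pdivrMr ?L0// (_ : u^-1 * LL n = u); first exact: k0u.
  by rewrite -u2 expr2 mulrA mulVf ?mul1r// gt_eqF.
- apply: (@le_trans _ _ (M * x * G)); first exact: ler_wpM2r.
  by rewrite -!(mulrA M); apply: ler_wpM2l.
- rewrite -!(mulrA H); apply: ler_wpM2l => //.
  rewrite mulrA [X in _ <= X](_ : _ = Cy / u / (1 - y)); last by ring.
  apply: ler_wpM2r; first by rewrite invr_ge0 subr_ge0 ltW.
  exact: decay_geom.
Qed.

End NullTheorem.

Lemma bigmax_seq_geP {R : realType} (t x0 : R) (f : nat -> R) (r : seq nat) :
  t <= \big[Order.max/x0]_(k <- r) f k -> t <= x0 \/ exists2 k, k \in r & t <= f k.
Proof.
elim: r => [|k r ih]; first by rewrite big_nil; left.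
rewrite big_cons le_max => /orP[tk|/ih[|[i ir ti]]].
- by right; exists k; rewrite ?mem_head.
- by left.
- by right; exists i => //; rewrite in_cons ir orbT.
Qed.

Lemma bigmax_seq_ge {R : realType} (x0 : R) (f : nat -> R) (r : seq nat) k :
  k \in r -> f k <= \big[Order.max/x0]_(k <- r) f k.
Proof.
elim: r => // j r ih; rewrite in_cons big_cons le_max => /orP[/eqP <-|/ih ->].
  by rewrite lexx.
by rewrite orbT.
Qed.

Lemma measurable_bigmax_seq {d} {T : measurableType d} {R : realType}
  (x0 : T -> R) (U : nat -> T -> R) (r : seq nat) :
  measurable_fun setT x0 -> (forall k, measurable_fun setT (U k)) ->
  measurable_fun setT (fun w => \big[Order.max/x0 w]_(k <- r) U k w).
Proof.
move=> mx mU; elim: r => [|k r ih].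
  by under [X in measurable_fun _ X]eq_fun do rewrite big_nil.
under [X in measurable_fun _ X]eq_fun do rewrite big_cons.
exact: measurable_maxr.
Qed.

(** Markov's inequality for the sum of the [Y k], which is at least 1 as soon as one [U k] reaches
    t. The default of the maximum is [U 0], itself a member of the family, and adds no event. *)
Lemma max_union_bound {d} {T : measurableType d} {R : realType} (Q : probability T R)
  (U : nat -> T -> R) (t : R) (p : nat -> R) m :
  (forall k, measurable_fun setT (U k)) ->
  (forall k, (k <= m)%N -> exists Y : T -> R, [/\ bmf Y, forall w, 0 <= Y w,
    forall w, t <= U k w -> 1 <= Y w & Ex Q Y <= p k]) ->
  (Q [set w | (t <= \big[Order.max/U 0%N w]_(0 <= k < m.+1) U k w)%R] <=
   (\sum_(0 <= k < m.+1) p k)%:E)%E.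
Proof.
move=> mU hY.
have /choice[Y {}hY] : forall k, exists Y : T -> R, (k <= m)%N -> [/\ bmf Y, forall w, 0 <= Y w,
    forall w, t <= U k w -> 1 <= Y w & Ex Q Y <= p k].
  move=> k; have [km|mk] := leqP k m; last by exists (fun=> 0).
  by have [Y ?] := hY k km; exists Y.
pose F w := \sum_(k < m.+1) Y k w.
have bY (k : 'I_m.+1) : bmf (Y k) by have [] := hY k (ltn_ord k).
have bF : bmf F by exact: bmf_sum.
have F0 w : 0 <= F w.
  by apply: sumr_ge0 => k _; have [_ h _ _] := hY k (ltn_ord k); exact: h.
apply: (@le_trans _ _ (Q [set w | (1 <= F w)%R])).
  apply: le_measure; rewrite ?inE.
  - rewrite -[X in measurable X]setTI; apply: (measurable_fun_le measurableT (measurable_cst _)).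
    exact: (measurable_bigmax_seq _ (mU 0%N) mU).
  - rewrite -[X in measurable X]setTI; apply: (measurable_fun_le measurableT (measurable_cst _)).
    by case: bF.
  - move=> w /= tw.
    have [k km tk] : exists2 k, (k <= m)%N & t <= U k w.
      have [t0|[k]] := bigmax_seq_geP tw; first by exists 0%N.
      by rewrite mem_index_iota => km tk; exists k.
    have [_ _ /(_ _ tk) h _] := hY k km; apply: le_trans h _.
    rewrite /F (bigD1 (Ordinal (km : (k < m.+1)%N)))//= lerDl; apply: sumr_ge0 => i _.
    by have [_ h _ _] := hY i (ltn_ord i); exact: h.
apply: le_trans (markov_Ex Q ltr01 bF F0) _.
rewrite divr1 lee_fin (Ex_sumE Q _ bY) big_mkord; apply: ler_sum => k _.
by have [] := hY k (ltn_ord k).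
Qed.

(** * Type I error *)

Lemma grid_le1 {R : realType} (s : R) n k : 0 < s -> 1 <= loglog n :> R ->
  Num.sqrt (loglog n) / n%:R <= 1 :> R ->
  2 * (Num.sqrt (loglog n) / n%:R : R) `^ (2 * s / (4 * s + 1)) <= 1 ->
  (k <= m_star s n)%N -> 0 < 2 ^+ k * rho_star s n <= 1.
Proof.
move=> s0 L1 r1 rb km; have [_ g2m _] := grid_bounds s0 L1 r1.
have rs0 := rho_star_gt0 s L1.
rewrite mulr_gt0 ?exprn_gt0//=; apply: le_trans rb; apply: le_trans g2m.
by rewrite ler_wpM2r ?(ltW rs0)// ler_weXn2l// ler1n.
Qed.

Lemma measurable_Tstat {d} {T : measurableType d} {R : realType} {d'} {Om : measurableType d'}
  (Q : probability Om R) (P : probability T R) n (X : nat -> Om -> T)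
  (lam : nat -> R) (phi : nat -> T -> R) (B rho : R) : iid_sample Q P n X ->
  (forall k, measurable_fun setT (phi k)) -> (forall k x, `|phi k x| <= B) -> (0 < n)%N ->
  (forall k, 0 <= wgt lam rho k) -> cvgn (series (wgt lam rho)) ->
  measurable_fun setT (fun w => Tstat lam phi rho n (fun i => X i w)).
Proof.
move=> iid mphi phiB n0 w0 sw.
have bh : bkf (fun x z => 2 / (n%:R * Num.sqrt (2 * vn lam rho)) * ker phi (wgt lam rho) x z).
  by apply: bmfZ; exact: (ker_bkf mphi phiB).
under eq_fun do rewrite (Tstat_ker _ mphi phiB w0 sw n0).
suff [] : bmf (fun w => \sum_(j < n) \sum_(i < j)
    (2 / (n%:R * Num.sqrt (2 * vn lam rho)) * ker phi (wgt lam rho) (X i w) (X j w))) by [].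
by have := Past_bmf iid (@Past_U _ _ _ _ _ X n _ bh).
Qed.

Lemma measurable_superlevel {d} {T : measurableType d} {R : realType} (f : T -> R) (t : R) :
  measurable_fun setT f -> measurable [set x | t <= f x].
Proof.
move=> mf; rewrite -[X in measurable X]setTI.
exact: measurable_fun_le (measurable_cst _) mf.
Qed.

Lemma powRN_le {R : realType} (x y e : R) : 0 < x -> x <= y -> 0 <= e ->
  y `^ (- e) <= x `^ (- e).
Proof.
move=> x0 xy e0; have y0 : 0 < y by exact: lt_le_trans xy.
rewrite !powRN lef_pV2 ?posrE ?powR_gt0//.
by apply: ge0_ler_powR => //; rewrite nnegrE ltW.
Qed.

(** The last grid point is at most [2 * r^b], so this keeps all scales in the range (0, 1] of
    [spectral_bounds]. The threshold [q = 2^(-1/b)] satisfies [q^b = 1/2], and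
    [r <= 4 / loglog n]. *)
Lemma r_pow_le_half {R : realType} (b : R) : 0 < b ->
  exists A0 : R, 1 <= A0 /\ forall n, A0 <= loglog n ->
    Num.sqrt (loglog n) / n%:R <= 1 :> R /\
    2 * (Num.sqrt (loglog n) / n%:R : R) `^ b <= 1.
Proof.
move=> b0; pose q : R := 2 `^ (- b^-1).
have /andP[q0 q1] := two_powRN_lt1 b0.
have A4 : 1 <= 4 / q by rewrite ler_pdivlMr// mul1r; apply: le_trans (ltW q1) _; rewrite ler1n.
exists (4 / q); split => // n An; have L1 := le_trans A4 An.
have L0 : 0 < loglog n :> R by exact: lt_le_trans L1.
have [_ _ _ r0] := loglog_ge1 L1.
have rq : Num.sqrt (loglog n) / n%:R <= q :> R.
  apply: le_trans (r_le_inv L1) _.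
  by rewrite ler_pdivrMr// mulrC -ler_pdivrMr.
split; first exact: le_trans rq (ltW q1).
have : (Num.sqrt (loglog n) / n%:R : R) `^ b <= q `^ b.
  by apply: ge0_ler_powR; [exact: ltW | rewrite nnegrE ltW | rewrite nnegrE (ltW q0) |].
rewrite /q -powRrM mulNr mulVf ?gt_eqF// powR_inv1// => h.
by rewrite -ler_pdivlMl// mulr1.
Qed.

Lemma ler_sum3 {R : realType} (e z a1 b1 a2 b2 a3 b3 : R) :
  a1 <= b1 -> a2 <= b2 -> a3 <= b3 ->
  e + (a1 + a2) + (a3 + z) <= e + (b1 + z) + b2 + b3.
Proof. lra. Qed.

Lemma null_rejection_rate {d} {T : measurableType d} {R : realType}
  (P0 : probability T R) (lam : nat -> R) (phi : nat -> T -> R) (s : R) :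
  standing_setup P0 lam phi s ->
  exists K A0 : R, forall n, A0 <= loglog n ->
  forall (d' : measure_display) (Om : measurableType d') (Q : probability Om R)
         (X : nat -> Om -> T), iid_sample Q P0 n X ->
  (Q [set w | (Num.sqrt (3 * loglog n) <= Ttilde lam phi s n (fun i => X i w))%R]
     <= (K / Num.sqrt (loglog n))%:E)%E.
Proof.
move=> [[lam0 _] [mphi [orth mean]] _ [s12 [einf esup]] [B0 phiB0]].
pose B := Num.max B0 0.
have phiB k x : `|phi k x| <= B by rewrite le_max phiB0.
have mean' k : Ex P0 (phi k) = 0 by rewrite /Rintegral mean.
have [C [c [C0 c0 spec]]] := spectral_bounds lam0 s12 einf esup.
have s0 : 0 < s by apply: lt_trans s12; rewrite divr_gt0.
(* [a = b / s]: [1 / v] is of order [rho^(1/s)], and the largest scale is of order [r^b], so [1 / v]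
   is at most of order [r^a]. *)
pose b : R := 2 * s / (4 * s + 1); pose a : R := 2 / (4 * s + 1).
have s41 : 0 < 4 * s + 1 by rewrite addr_gt0// mulr_gt0.
have b0 : 0 < b by rewrite divr_gt0// mulr_gt0.
have a0 : 0 < a by rewrite divr_gt0.
have [A0 [A1 hA]] := r_pow_le_half b0.
pose y : R := 2 `^ (- s^-1).
have /andP[y0 y1] : 0 < y < 1 by exact: two_powRN_lt1.
have B40 : 0 <= B ^+ 4 by rewrite (exprM _ 2 2) sqr_ge0.
(* [(10 t)^4 = q * (loglog n)^2] since [t^2 = 3 loglog n]. The constants [g1], [g3] and [H] collect
   the terms in [1 / n], [1 / v] and [N1^2 / (n^2 * v)]. *)
pose q := (10 : R) ^+ 4 * 9.
have q0 : 0 <= q by rewrite mulr_ge0// exprn_ge0.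
pose g1 : R := 100 * (8 * B ^+ 4) + 12 * B ^+ 4 * q.
pose g3 : R := 100 * 16 / (c * y).
pose H : R := 4 * B ^+ 4 * (C ^+ 2 / c) * q.
have g10 : 0 <= g1.
  by apply: addr_ge0; apply: mulr_ge0 => //; apply: mulr_ge0.
have g30 : 0 <= g3.
  by apply: divr_ge0; apply: mulr_ge0 => //; exact: ltW.
have H0 : 0 <= H.
  apply: mulr_ge0 => //; apply: mulr_ge0; first exact: mulr_ge0.
  by apply: divr_ge0; [exact: sqr_ge0 | exact: ltW].
have [K hK] := null_sum_bound s0 a0 g10 g30 H0.
exists K, A0 => n An d' Om Q X iid.
have L1 : 1 <= loglog n :> R by exact: le_trans A1 An.
have [r1 rb] := hA n An.
have [n0 nE xE r0] := loglog_ge1 L1.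
have L0 : 0 < loglog n :> R by exact: lt_le_trans L1.
have [g1m g2m _] := grid_bounds s0 L1 r1.
have rho0 := rho_star_gt0 s L1.
set r := Num.sqrt (loglog n) / n%:R in r1 rb r0 g1m g2m.
set m := m_star s n in g1m g2m.
set t := Num.sqrt (3 * loglog n).
have t2 : t ^+ 2 = 3 * loglog n by rewrite sqr_sqrtr// mulr_ge0// ltW.
have t0 : 0 < t by rewrite sqrtr_gt0 mulr_gt0.
have rn : r ^+ 2 * n%:R ^+ 2 = loglog n.
  by rewrite -exprMn /r divfK ?gt_eqF ?ltr0n// sqr_sqrtr// ltW.
pose rho k := 2 ^+ k * rho_star s n.
have rhok0 k : 0 < rho k by rewrite mulr_gt0// exprn_gt0.
have rho1 k : (k <= m)%N -> 0 < rho k <= 1 by exact: grid_le1.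
pose U k w := Tstat lam phi (rho k) n (fun i => X i w).
have w01 k j : 0 <= wgt lam (rho k) j <= 1.
  by have /andP[/ltW -> ->] := wgt_bounds lam0 j (rhok0 k).
have sw k : (k <= m)%N -> cvgn (series (wgt lam (rho k))).
  by move=> km; have [] := spec _ (rho1 k km).
have UE k w : (k <= m)%N -> U k w = \sum_(j < n) \sum_(i < j)
    (2 / (n%:R * Num.sqrt (2 * vn lam (rho k))) * ker phi (wgt lam (rho k)) (X i w) (X j w)).
  move=> km; apply: (Tstat_ker _ mphi phiB _ (sw k km) n0) => j.
  by case/andP: (w01 k j).
(* Beyond the grid the scale may exceed 1, where [spectral_bounds] gives no summability; the family
   is cut to 0 there so that it is measurable for every k. *)
pose V k w := if (k <= m)%N then U k w else 0.
have mV k : measurable_fun setT (V k).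
  have [km|mk] := leqP k m; last first.
    have -> : V k = cst 0 by apply/funext => w; rewrite /V leqNgt mk.
    exact: measurable_cst.
  have -> : V k = U k by apply/funext => w; rewrite /V km.
  apply: (measurable_Tstat iid mphi phiB n0) => [j|]; last exact: sw.
  by case/andP: (w01 k j).
have TE w : Ttilde lam phi s n (fun i => X i w) =
    \big[Order.max/V 0%N w]_(0 <= k < m.+1) V k w.
  rewrite /Ttilde /V leq0n /U /rho expr0 mul1r; apply: eq_big_nat => k /andP[_].
  by rewrite ltnS => ->.
under eq_set do rewrite TE.
pose p k : R := if (k < Num.truncn (Num.sqrt (loglog n : R)))%N then (3 * loglog n)^-1
     else expR (- (5 / 4 * loglog n)) + g1 * (loglog n ^+ 2 / n%:R) + g3 * r `^ a +
       H * (loglog n * y ^+ k).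
apply: (@le_trans _ _ (\sum_(0 <= k < m.+1) p k)%:E); last by rewrite lee_fin; exact: hK.
apply: max_union_bound => // k km; rewrite /p.
have [swk N1k vk] := spec _ (rho1 k km).
set w := wgt lam (rho k) in swk N1k vk *.
have DE : rho k `^ (- s^-1) = y ^+ k / r ^+ 2 by exact: rho_powR.
set D := rho k `^ (- s^-1) in N1k vk DE *.
have D0 : 0 < D by rewrite powR_gt0.
have v0 : 0 < rsum (fun j => w j ^+ 2) by apply: lt_le_trans vk; rewrite mulr_gt0.
have Vle om : t <= V k om -> t <= \sum_(j < n) \sum_(i < j)
   (2 / (n%:R * Num.sqrt (2 * rsum (fun j => w j ^+ 2))) * ker phi w (X i om) (X j om)).
  by rewrite /V km UE.
(* The fourth-moment term H * loglog n * y^k of the tail bound does not vanish at the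
   lowest scales; there Chebyshev's inequality costs 1 / (3 loglog n) per scale. *)
case: ifP => kk.
  have [Y [bY Y0 tY EY]] := null_chebyshev iid mphi phiB orth mean' (w01 k) swk n0 v0 t0.
  by exists Y; split => //; [move=> om /Vle /tY | rewrite -t2].
have [Y [bY Y0 tY EY]] := null_tail iid mphi phiB orth mean' (w01 k) swk n0 v0 t0.
exists Y; split => //; first by move=> om /Vle /tY.
apply: le_trans EY _.
set v := rsum (fun j => w j ^+ 2) in vk v0 *; set N1 := rsum w in N1k *.
have nR : 0 < n%:R :> R by rewrite ltr0n.
have N10 : 0 <= N1 by apply: rsum_ge0 => // j; case/andP: (w01 k j).
have E1 : expR (- (5 / 12 * t ^+ 2)) = expR (- (5 / 4 * loglog n)).
  by congr expR; rewrite t2; field.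
have T4 : (10 * t) ^+ 4 = q * loglog n ^+ 2.
  rewrite exprMn (exprM t 2 2) t2 exprMn /q -[in RHS]mulrA; congr (_ * (_ * _)).
  by ring.
(* [y * r^(-a)] is [(2 * r^b)^(-1/s)]: the factor y absorbs the 2 in the upper bound for the largest
   scale. *)
have iv : v^-1 <= r `^ a / (c * y).
  rewrite -[r `^ a]invrK -invfM lef_pV2 ?posrE//; last first.
    by rewrite mulr_gt0 ?mulr_gt0 ?invr_gt0 ?powR_gt0.
  apply: le_trans vk; rewrite mulrC -mulrA ler_wpM2l ?(ltW c0)//.
  rewrite -powRN (_ : - a = b * - s^-1); last by rewrite /a /b; field; rewrite !gt_eqF.
  have -> : y * r `^ (b * - s^-1) = (2 * r `^ b) `^ (- s^-1).
    by rewrite powRM ?powR_ge0// -powRrM.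
  apply: powRN_le => //; last by rewrite invr_ge0 ltW.
  by apply: le_trans g2m; rewrite ler_wpM2r ?(ltW rho0)// ler_weXn2l// ler1n.
(* The ratio is at most a constant times [D / n^2], and [D = y^k / r^2] with
   [r^2 * n^2 = loglog n]. *)
have NV : N1 ^+ 2 / (n%:R ^+ 2 * v) <= C ^+ 2 / c * (y ^+ k / loglog n).
  have -> : C ^+ 2 / c * (y ^+ k / loglog n) = (C * D) ^+ 2 / (n%:R ^+ 2 * (c * D)).
    by rewrite DE -rn; field; rewrite !gt_eqF// exprn_gt0.
  apply: ler_pM; rewrite ?sqr_ge0 ?invr_ge0 ?mulr_ge0 ?(ltW v0) ?sqr_ge0//.
    by rewrite ler_sqr ?nnegrE// mulr_ge0 ?ltW.
  rewrite lef_pV2 ?posrE ?mulr_gt0 ?exprn_gt0//.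
  by rewrite ler_wpM2l ?sqr_ge0.
rewrite E1 T4.
have h1 : B ^+ 4 / n%:R <= B ^+ 4 * (loglog n ^+ 2 / n%:R).
  rewrite ler_wpM2l// ler_peMl ?invr_ge0 ?(ltW nR)//.
  by rewrite expr_ge1// (le_trans ler01).
set u := loglog n ^+ 2 / n%:R in h1 *.
have -> : 100 * (8 * B ^+ 4 / n%:R + 16 / v) = 100 * 8 * (B ^+ 4 / n%:R) + 100 * 16 * v^-1.
  by ring.
have -> : (4 * B ^+ 4 * N1 ^+ 2 / (n%:R ^+ 2 * v) + 12 * B ^+ 4 / n%:R) * (q * loglog n ^+ 2) =
  4 * B ^+ 4 * (N1 ^+ 2 / (n%:R ^+ 2 * v)) * q * loglog n ^+ 2 + 12 * B ^+ 4 * q * u.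
  by rewrite /u; ring.
have h2 : 4 * B ^+ 4 * (N1 ^+ 2 / (n%:R ^+ 2 * v)) * q * loglog n ^+ 2 <= H * (loglog n * y ^+ k).
  have -> : H * (loglog n * y ^+ k) =
    4 * B ^+ 4 * (C ^+ 2 / c * (y ^+ k / loglog n)) * q * loglog n ^+ 2.
    by rewrite /H; field; rewrite !gt_eqF.
  rewrite ler_wpM2r ?sqr_ge0// ler_wpM2r// ler_wpM2l// mulr_ge0//.
have h3 : 100 * 16 * v^-1 <= g3 * r `^ a.
  have -> : g3 * r `^ a = 100 * 16 * (r `^ a / (c * y)) by rewrite /g3; ring.
  by apply: ler_wpM2l => //; exact: mulr_ge0.
have h4 : 100 * 8 * (B ^+ 4 / n%:R) <= 100 * (8 * B ^+ 4) * u.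
  have -> : 100 * (8 * B ^+ 4) * u = 100 * 8 * (B ^+ 4 * u) by ring.
  by apply: ler_wpM2l => //; exact: mulr_ge0.
have -> : g1 * u = 100 * (8 * B ^+ 4) * u + 12 * B ^+ 4 * q * u by rewrite /g1 mulrDl.
exact: ler_sum3.
Qed.

(** * Square-integrable functions and the spectrum *)

Section SquareIntegrable.
Context {d} {T : measurableType d} {R : realType} (P0 : probability T R).
Implicit Types f g : T -> R.
Local Notation itg f := (P0.-integrable [set: T] (EFin \o f)).

Lemma itg_dom f g : measurable_fun setT f -> (forall x, `|f x| <= g x) -> itg g -> itg f.
Proof.
move=> mf fg ig; apply: (le_integrable measurableT _ _ ig).
  exact/measurable_EFinP.
by move=> x _; rewrite lee_fin; apply: le_trans (fg x) (ler_norm _).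
Qed.

Lemma L2_sqr f : L2 P0 f -> itg (fun x => f x ^+ 2).
Proof.
move=> [mf fi]; apply/integrableP; split.
  by apply/measurable_EFinP; exact: measurable_funX.
rewrite (le_lt_trans _ fi)// le_eqVlt; apply/orP; left; apply/eqP.
by apply: eq_integral => x _; rewrite /= ger0_norm ?sqr_ge0.
Qed.

Lemma sqr_L2 f : measurable_fun setT f -> itg (fun x => f x ^+ 2) -> L2 P0 f.
Proof.
move=> mf /integrableP[_ fi]; split => //.
rewrite (le_lt_trans _ fi)// le_eqVlt; apply/orP; left; apply/eqP.
by apply: eq_integral => x _; rewrite /= ger0_norm ?sqr_ge0.
Qed.

Lemma L2M f g : L2 P0 f -> L2 P0 g -> itg (fun x => f x * g x).
Proof.
move=> Lf Lg; apply: (@itg_dom _ (fun x => f x ^+ 2 + g x ^+ 2)).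
- by case: Lf Lg => mf _ [mg _]; exact: measurable_funM.
- move=> x; have h1 := sqr_ge0 (f x - g x); have h2 := sqr_ge0 (f x + g x).
  by rewrite ler_norml; apply/andP; split; nra.
- by apply: itgD; exact: L2_sqr.
Qed.

Lemma bmf_L2 f : bmf f -> L2 P0 f.
Proof. by move=> bf; apply: sqr_L2; [case: bf | exact/bmf_itg/bmfX]. Qed.

Lemma L2_itg f : L2 P0 f -> itg f.
Proof.
move=> Lf; have := L2M Lf (bmf_L2 (bmf_cst 1)).
by under [X in itg X]eq_fun do rewrite mulr1.
Qed.

Lemma L2D f g : L2 P0 f -> L2 P0 g -> L2 P0 (fun x => f x + g x).
Proof.
move=> Lf Lg; apply: sqr_L2; first by case: Lf Lg => mf _ [mg _]; exact: measurable_funD.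
under [X in itg X]eq_fun do rewrite sqrrD.
apply: itgD; last exact: L2_sqr.
apply: itgD; first exact: L2_sqr.
under [X in itg X]eq_fun do rewrite mulr2n.
by apply: itgD; exact: L2M.
Qed.

Lemma bmfM_L2 f g : bmf f -> L2 P0 g -> L2 P0 (fun x => f x * g x).
Proof.
move=> [mf [C fC]] Lg; have mg := Lg.1.
apply: sqr_L2; first exact: measurable_funM.
apply: (@itg_dom _ (fun x => C ^+ 2 * g x ^+ 2)).
- by apply: measurable_funX; exact: measurable_funM.
- move=> x; rewrite ger0_norm ?sqr_ge0// exprMn ler_wpM2r ?sqr_ge0//.
  have C0 := le_trans (normr_ge0 _) (fC x).
  by rewrite -[leLHS]real_normK ?num_real// ler_sqr ?nnegrE.
- exact/itgZ/L2_sqr.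
Qed.

Lemma L2Z (a : R) f : L2 P0 f -> L2 P0 (fun x => a * f x).
Proof. by apply: bmfM_L2; exact: bmf_cst. Qed.

Lemma L2B f g : L2 P0 f -> L2 P0 g -> L2 P0 (fun x => f x - g x).
Proof.
move=> Lf Lg; under [X in L2 _ X]eq_fun do rewrite -mulN1r.
by apply: L2D => //; exact: L2Z.
Qed.

(** p agrees almost everywhere with the Radon-Nikodym derivative, as both have the same integral
    over every measurable set; the change-of-variables formula for the latter then transfers to
    p. *)
Lemma Ex_change_of_measure (P : probability T R) (p : T -> R) f :
  itg p -> (forall A, measurable A -> (P A = \int[P0]_(x in A) (p x)%:E)%E) ->
  bmf f -> itg (fun x => f x * p x) /\ Ex P f = Ex P0 (fun x => f x * p x).
Proof.
move=> ip PE bf; have mp := measurable_int _ ip.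
have PP0 : P `<< P0.
  apply/null_content_dominatesP => A mA A0; rewrite PE//.
  by apply: null_set_integral => //; exact: measurable_funTS.
have pae : ae_eq P0 setT (EFin \o p) (Radon_Nikodym (charge_of_finite_measure P) P0).
  apply: integral_ae_eq => // A _ mA.
  by rewrite -Radon_Nikodym_integral//= -PE.
have ifp : itg (fun x => f x * p x).
  have [mf [C fC]] := bf.
  apply: (@itg_dom _ (fun x => C * `|p x|)).
  - by apply: measurable_funM => //; exact/measurable_EFinP.
  - by move=> x; rewrite normrM ler_wpM2r.
  - by apply: itgZ; exact: (integrable_norm ip).
split => //; congr fine.
rewrite -(Radon_Nikodym_change_of_variables PP0 measurableT (bmf_itg P bf)).
apply: ae_eq_integral => //.
- apply: emeasurable_funM; last exact: measurable_int (Radon_Nikodym_integrable _).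
  exact: measurable_int (bmf_itg P0 bf).
- exact: measurable_int ifp.
- apply: filterS pae => x /= h _; by rewrite EFinM h.
Qed.

End SquareIntegrable.

(** Split [b^2] with the weights [w = l / (l + q)] and [1 - w <= q / l]. The second part is an
    RKHS-norm term; in the first, [b^2 <= 2 a^2 + 2 (a - b)^2]. Here a and b are coefficients of u
    and of its approximant, l is the eigenvalue, and q is the squared scale. *)
Lemma shrink_coef {R : realType} (l q a b : R) : 0 < l -> 0 < q ->
  b ^+ 2 <= 2 * (l / (l + q) * a ^+ 2) + q * (l^-1 * b ^+ 2) + 2 * (a - b) ^+ 2.
Proof.
move=> l0 q0; have lq : 0 < l + q by rewrite addr_gt0.
set w := l / (l + q).
have wE : w + q / (l + q) = 1 by rewrite /w -mulrDl divff// gt_eqF.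
have w0 : 0 <= w by rewrite divr_ge0 ?ltW.
have q1 : 0 <= q / (l + q) by rewrite divr_ge0 ?ltW.
have ql : q / (l + q) <= q * l^-1.
  by rewrite ler_wpM2l ?(ltW q0)// lef_pV2 ?posrE// lerDl ltW.
have hb : q / (l + q) * b ^+ 2 <= q * (l^-1 * b ^+ 2).
  by rewrite [leRHS]mulrA ler_wpM2r ?sqr_ge0.
have ha : w * b ^+ 2 <= w * (2 * a ^+ 2 + 2 * (a - b) ^+ 2).
  by rewrite ler_wpM2l//; have := sqr_ge0 (2 * a - b); nra.
have hc : w * (2 * (a - b) ^+ 2) <= 2 * (a - b) ^+ 2.
  have w1 : w <= 1 by rewrite -wE lerDl.
  by apply: ler_piMl => //; apply: mulr_ge0 => //; exact: sqr_ge0.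
have bE : b ^+ 2 = w * b ^+ 2 + q / (l + q) * b ^+ 2 by rewrite -mulrDl wE mul1r.
lra.
Qed.

Lemma cvg_sqr {R : realType} (u : nat -> R) (l : R) : u N @[N --> \oo] --> l ->
  u N ^+ 2 @[N --> \oo] --> l ^+ 2.
Proof.
by move=> ul; rewrite expr2; under eq_cvg do rewrite expr2; exact: (cvgM ul ul).
Qed.

(** * Eigenfunction expansions and the spectral energy of an alternative *)

Section Spectrum.
Context {d} {T : measurableType d} {R : realType} (P0 : probability T R).
Variables (phi : nat -> T -> R) (B : R).
Hypotheses (mphi : forall k, measurable_fun setT (phi k))
  (phiB : forall k x, `|phi k x| <= B)
  (orth : forall j k, Ex P0 (fun x => phi j x * phi k x) = (j == k)%:R)
  (mean : forall k, Ex P0 (phi k) = 0).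

Let bphi k : bmf (phi k) := phi_bmf mphi phiB k.
Let S (b : nat -> R) N x := \sum_(0 <= k < N) b k * phi k x.

Let bS b N : bmf (S b N).
Proof. by apply: (@bmf_sum _ _ _ _ _ (fun k x => b k * phi k x)) => k; exact: bmfZ. Qed.

Lemma Ex_mul_phi_sum (f : T -> R) b N : L2 P0 f ->
  Ex P0 (fun x => f x * \sum_(0 <= k < N) b k * phi k x) =
  \sum_(0 <= k < N) b k * Ex P0 (fun x => f x * phi k x).
Proof.
move=> Lf; have Lp k : P0.-integrable setT (EFin \o (fun x => f x * phi k x)).
  by apply: L2M => //; exact: bmf_L2.
under [X in Ex P0 X]eq_fun do rewrite mulr_sumr.
have [|_ ->] := @Ex_sum _ _ _ P0 _ (index_iota 0 N) (fun k x => f x * (b k * phi k x)).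
  move=> k.
  rewrite [X in EFin \o X](_ : _ = (fun x => b k * (f x * phi k x))); first exact: itgZ.
  by apply/funext => x; rewrite mulrCA.
apply: eq_bigr => k _; rewrite -ExZ//.
  by apply: eq_Rintegral => x _; rewrite mulrCA.
Qed.

Lemma Ex_phi_sum_sqr b N :
  Ex P0 (fun x => (\sum_(0 <= k < N) b k * phi k x) ^+ 2) = \sum_(0 <= k < N) b k ^+ 2.
Proof.
under [X in Ex P0 X]eq_fun do rewrite expr2.
rewrite Ex_mul_phi_sum; last exact/bmf_L2/bS.
apply: eq_big_nat => k /andP[_ kN].
have -> : Ex P0 (fun x => (\sum_(0 <= k < N) b k * phi k x) * phi k x) =
  Ex P0 (fun x => phi k x * \sum_(0 <= k < N) b k * phi k x).
  by apply: eq_Rintegral => x _; rewrite mulrC.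
rewrite Ex_mul_phi_sum; last exact: bmf_L2.
rewrite (bigD1_seq k) ?mem_index_iota ?iota_uniq//= orth eqxx mulr1 big1 ?addr0 ?expr2//.
by move=> j jk; rewrite orth eq_sym (negbTE jk) mulr0.
Qed.

Lemma bessel (f : T -> R) N : L2 P0 f ->
  \sum_(0 <= k < N) Ex P0 (fun x => f x * phi k x) ^+ 2 <= Ex P0 (fun x => f x ^+ 2).
Proof.
move=> Lf; pose c k := Ex P0 (fun x => f x * phi k x).
have LS := bmf_L2 P0 (bS c N).
have h : 0 <= Ex P0 (fun x => (f x ^+ 2 - 2 * (f x * S c N x)) + S c N x ^+ 2).
  by apply: Ex_ge0 => x; rewrite (_ : _ + _ = (f x - S c N x) ^+ 2) ?sqr_ge0//; ring.
move: h; have i1 := L2_sqr Lf; have i2 := L2M Lf LS; have i3 := L2_sqr LS.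
rewrite ExD//; last by apply: itgB => //; exact: itgZ.
rewrite ExB//; last exact: itgZ.
rewrite ExZ// Ex_mul_phi_sum// Ex_phi_sum_sqr.
under [X in - (2 * X)]eq_bigr => k _ do rewrite -/(c k) -expr2.
rewrite -/c; set s := \sum_(_ <= _ < _) _; lra.
Qed.

Section PhiSeries.
Variable b : nat -> R.
Hypothesis sb : cvgn (series (fun k => `|b k|)).
Let g x := rsum (fun k => b k * phi k x).
Let C := B * rsum (fun k => `|b k|).

Let bp k x : `|b k * phi k x| <= B * `|b k|.
Proof. by rewrite normrM mulrC ler_wpM2r. Qed.

Let Sg x : S b ^~ x @ \oo --> g x.
Proof.
apply: rsum_cvg; apply: normed_cvg.
apply: (@summable_le _ _ (fun k => B * `|b k|)) => [k|].
  by rewrite normr_ge0 bp.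
exact: (@is_cvg_seriesZ _ (fun k => `|b k|) B).
Qed.

Let SC N x : `|S b N x| <= C.
Proof.
apply: le_trans (ler_norm_sum _ _ _) _.
apply: (@le_trans _ _ (\sum_(0 <= k < N) B * `|b k|)).
  by apply: ler_sum => k _; exact: bp.
rewrite -mulr_sumr ler_wpM2l ?le_rsum_partial//.
exact: le_trans (normr_ge0 _) (phiB 0%N x).
Qed.

Lemma phi_series_bmf : bmf (fun x => rsum (fun k => b k * phi k x)).
Proof. by have [] := @bounded_cvg_Ex _ _ _ P0 (S b) g C (fun N => (bS b N).1) SC Sg. Qed.

Lemma Ex_phi_series (P : probability T R) :
  (\sum_(0 <= k < N) b k * Ex P (phi k)) @[N --> \oo] -->
    Ex P (fun x => rsum (fun k => b k * phi k x)).
Proof.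
have [_ h] := @bounded_cvg_Ex _ _ _ P (S b) g C (fun N => (bS b N).1) SC Sg.
apply: cvg_trans h; apply: near_eq_cvg; apply: nearW => N.
rewrite (@Ex_sumE _ _ _ P _ _ (fun k x => b k * phi k x)) => [|k]; last exact: bmfZ.
by apply: eq_bigr => k _; rewrite ExZ//; exact: bmf_itg.
Qed.

Lemma Ex_phi_series_phi k :
  Ex P0 (fun x => rsum (fun j => b j * phi j x) * phi k x) = b k.
Proof.
have cv : Ex P0 (fun x => S b N x * phi k x) @[N --> \oo] --> Ex P0 (fun x => g x * phi k x).
  have [] := @bounded_cvg_Ex _ _ _ P0 (fun N x => S b N x * phi k x) (fun x => g x * phi k x) (C * B).
  - by move=> N; apply: measurable_funM => //; case: (bS b N).
  - by move=> N x; rewrite normrM ler_pM.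
  - by move=> x; apply: cvgM; [exact: Sg | exact: cvg_cst].
  - by [].
apply: (cvg_unique _ cv) => //; apply: (@cvg_near_cst _ _ _ _ _ _).
exists k.+1 => // N /= kN.
have -> : Ex P0 (fun x => S b N x * phi k x) = Ex P0 (fun x => phi k x * S b N x).
  by apply: eq_Rintegral => x _; rewrite mulrC.
rewrite Ex_mul_phi_sum; last exact: bmf_L2.
rewrite (bigD1_seq k) ?mem_index_iota ?iota_uniq//= orth eqxx mulr1 big1 ?addr0//.
by move=> j jk; rewrite orth eq_sym (negbTE jk) mulr0.
Qed.

Lemma Ex_phi_series_sqr :
  (\sum_(0 <= k < N) b k ^+ 2) @[N --> \oo] -->
    Ex P0 (fun x => rsum (fun k => b k * phi k x) ^+ 2).
Proof.
have [N|N x|x|_] := @bounded_cvg_Ex _ _ _ P0 (fun N x => S b N x ^+ 2) (fun x => g x ^+ 2) (C ^+ 2).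
- by apply: measurable_funX; case: (bS b N).
- by rewrite normrX lerXn2r ?nnegrE// (le_trans _ (SC N x)).
- exact: cvg_sqr.
- by under eq_cvg do rewrite Ex_phi_sum_sqr.
Qed.

End PhiSeries.

Variables (lam : nat -> R).
Hypotheses (lam0 : forall k, 0 < lam k) (lamd : forall k, lam k.+1 < lam k)
  (slam : cvgn (series lam))
  (basis : forall f, L2 P0 f -> mean0 P0 f -> (forall k, inner P0 f (phi k) = 0) ->
     L2sq P0 f = 0).

Let b (h : T -> R) k := Ex P0 (fun x => h x * phi k x).

Lemma Knorm2_partial (h : T -> R) (A : R) N : (Knorm2 P0 lam phi h <= A%:E)%E ->
  \sum_(0 <= k < N) (lam k)^-1 * Ex P0 (fun x => h x * phi k x) ^+ 2 <= A.
Proof.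
move=> hA; rewrite -lee_fin; apply: le_trans hA.
rewrite -sumEFin; apply: nneseries_lim_ge => k _ _.
by rewrite lee_fin mulr_ge0 ?sqr_ge0// invr_ge0 ltW.
Qed.

(** A finite RKHS norm makes the coefficients absolutely summable, since
    [|b_k| <= b_k^2 / lam_k + lam_k] and the eigenvalues are summable. The series g therefore
    converges uniformly, and Parseval's identity for it follows by bounded convergence. The
    difference h - g has mean zero and no coefficients, so the basis property makes it null. *)
Lemma inH_parseval (h : T -> R) (A : R) : inH P0 lam phi h ->
  (Knorm2 P0 lam phi h <= A%:E)%E ->
  exists g : T -> R, [/\ bmf g, Ex P0 (fun x => (h x - g x) ^+ 2) = 0 &
    (\sum_(0 <= k < N) Ex P0 (fun x => h x * phi k x) ^+ 2) @[N --> \oo] -->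
      Ex P0 (fun x => g x ^+ 2)].
Proof.
move=> [Lh h0 _] hA.
have sb : cvgn (series (fun k => `|b h k|)).
  apply: (@summable_le _ _ (fun k => (lam k)^-1 * b h k ^+ 2 + lam k)) => [k|].
    rewrite normr_ge0/=; have l0 := lam0 k.
    have -> : (lam k)^-1 * b h k ^+ 2 + lam k = (b h k ^+ 2 + lam k ^+ 2) / lam k.
      by field; rewrite gt_eqF.
    rewrite ler_pdivlMr// -[b h k ^+ 2]real_normK ?num_real//.
    have := normr_ge0 (b h k); set z := `|_|; move: (lam k) l0 => l l0 z0.
    have := sqr_ge0 (z - l); nra.
  have sl' := slam.
  apply: (@is_cvg_seriesD _ (fun k => (lam k)^-1 * b h k ^+ 2) lam) => //.
  apply: (@summable_bound _ _ A) => [k|N]; last exact: Knorm2_partial.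
  by rewrite mulr_ge0 ?sqr_ge0// invr_ge0 ltW.
pose g x := rsum (fun k => b h k * phi k x).
have bg : bmf g by exact: phi_series_bmf.
exists g; split => //; last exact: Ex_phi_series_sqr.
have g0 : Ex P0 g = 0.
  rewrite -(rsumE (Ex_phi_series sb (P := P0))); apply: rsumE.
  rewrite (_ : (fun N => _) = (fun=> 0)); first exact: cvg_cst.
  by apply/funext => N; apply: big1 => k _; rewrite mean mulr0.
have Lg := bmf_L2 P0 bg.
apply: basis; first exact: L2B.
  rewrite /mean0; have i := L2_itg (L2B Lh Lg).
  rewrite -[LHS]fineK; last exact: integrable_fin_num i.
  congr EFin; rewrite -/(Ex P0 (fun x => h x - g x)) (ExB (L2_itg Lh) (L2_itg Lg)) g0.
  by rewrite /Rintegral h0 subr0.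
move=> k; have Lk := bmf_L2 P0 (bphi k).
rewrite /inner -/(Ex P0 (fun x => (h x - g x) * phi k x)).
under [X in Ex P0 X]eq_fun do rewrite mulrBl.
by rewrite ExB ?(Ex_phi_series_phi sb) ?subrr//; exact: L2M.
Qed.

(* With g the uniformly convergent eigenfunction series of h, u = (u - h) + (h - g) + g,
   where h - g is null by the basis property; the coefficients of u and h differ by
   at most |u - h| by Bessel's inequality. *)
Lemma alt_size_bound (u h : T -> R) (A : R) : L2 P0 u -> inH P0 lam phi h ->
  (Knorm2 P0 lam phi h <= A%:E)%E ->
  [/\ Ex P0 (fun x => u x ^+ 2) <= 3 * Ex P0 (fun x => (u x - h x) ^+ 2) + 3 * (lam 0%N * A) &
   forall w rho2, (forall k, w k = lam k / (lam k + rho2)) -> 0 < rho2 ->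
     cvgn (series (fun k => w k * Ex P0 (fun x => u x * phi k x) ^+ 2)) ->
     Ex P0 (fun x => u x ^+ 2) / 6 - 3 / 2 * Ex P0 (fun x => (u x - h x) ^+ 2) - rho2 * A / 2 <=
       rsum (fun k => w k * Ex P0 (fun x => u x * phi k x) ^+ 2)].
Proof.
move=> Lu Hh hA; have [g [bg g0 gcv]] := inH_parseval Hh hA.
have [Lh _ _] := Hh; have Lg := bmf_L2 P0 bg.
have Luh := L2B Lu Lh; have Lhg := L2B Lh Lg.
set e2 := Ex P0 (fun x => (u x - h x) ^+ 2).
have ue : Ex P0 (fun x => u x ^+ 2) <= 3 * e2 + 3 * Ex P0 (fun x => g x ^+ 2).
  have -> : 3 * e2 + 3 * Ex P0 (fun x => g x ^+ 2) =
    Ex P0 (fun x => 3 * (u x - h x) ^+ 2 + 3 * (h x - g x) ^+ 2 + 3 * g x ^+ 2).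
    rewrite !ExD ?ExZ ?g0 ?mulr0 ?addr0//; do ?[apply: itgD]; try apply: itgZ; exact: L2_sqr.
  apply: Ex_le; first exact: L2_sqr.
    by do 2?[apply: itgD]; apply: itgZ; exact: L2_sqr.
  move=> x; have h1 := sqr_ge0 ((u x - h x) - (h x - g x)).
  have h2 := sqr_ge0 ((u x - h x) - g x); have h3 := sqr_ge0 ((h x - g x) - g x).
  nra.
have A0 : 0 <= A by have := Knorm2_partial 0 hA; rewrite big_geq.
split.
  apply: le_trans ue _; rewrite lerD2l ler_wpM2l//.
  rewrite -(cvg_lim _ gcv)//; apply: limr_le; first by apply/cvg_ex; exists (Ex P0 (fun x => g x ^+ 2)).
  apply: nearW => N; apply: le_trans (_ : lam 0%N * \sum_(0 <= k < N) (lam k)^-1 * b h k ^+ 2 <= _).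
    rewrite mulr_sumr; apply: ler_sum => k _.
    rewrite mulrA ler_peMl ?sqr_ge0// ler_pdivlMr// mul1r.
    elim: k => // k ih; exact: le_trans (ltW (lamd k)) ih.
  by rewrite ler_wpM2l ?(ltW (lam0 0%N))//; exact: Knorm2_partial.
move=> w rho2 wE rho0 sw.
(* By [ue], half the squared norm of g is at least that of u divided by 6, minus [e2 / 2]; together
   with the [e2] in this bound this makes the coefficient 3/2. *)
suff key : Ex P0 (fun x => g x ^+ 2) / 2 - rho2 * A / 2 - e2 <=
    rsum (fun k => w k * Ex P0 (fun x => u x * phi k x) ^+ 2).
  by apply: le_trans key; lra.
have w0 k : 0 <= w k * Ex P0 (fun x => u x * phi k x) ^+ 2.
  by rewrite mulr_ge0 ?sqr_ge0// wE divr_ge0 ?ltW// addr_gt0.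
suff : Ex P0 (fun x => g x ^+ 2) <=
    2 * (rsum (fun k => w k * Ex P0 (fun x => u x * phi k x) ^+ 2)) + rho2 * A + 2 * e2 by lra.
rewrite -(cvg_lim _ gcv)//; apply: limr_le; first by apply/cvg_ex; exists (Ex P0 (fun x => g x ^+ 2)).
apply: nearW => N.
have h1 := le_rsum_partial N w0 sw.
have h2 := Knorm2_partial N hA.
have h3 := bessel N Luh.
apply: le_trans (_ : 2 * \sum_(0 <= k < N) w k * Ex P0 (fun x => u x * phi k x) ^+ 2 +
  rho2 * \sum_(0 <= k < N) (lam k)^-1 * Ex P0 (fun x => h x * phi k x) ^+ 2 +
  2 * \sum_(0 <= k < N) Ex P0 (fun x => (u x - h x) * phi k x) ^+ 2 <= _); last first.
  by apply: lerD; [apply: lerD|]; apply: ler_wpM2l => //; exact: ltW.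
rewrite !mulr_sumr -!big_split/=; apply: ler_sum => k _.
have Lk := bmf_L2 P0 (bphi k).
have -> : Ex P0 (fun x => (u x - h x) * phi k x) =
  Ex P0 (fun x => u x * phi k x) - Ex P0 (fun x => h x * phi k x).
  under [X in Ex P0 X = _]eq_fun do rewrite mulrBl.
  by rewrite ExB//; exact: L2M.
have l0 := lam0 k; rewrite wE.
exact: shrink_coef.
Qed.

End Spectrum.

(** * The statistic under an alternative *)

Lemma sum_pairs {R : realType} (f : nat -> R) n :
  \sum_(j < n) \sum_(i < j) (f i + f j) = (n%:R - 1) * \sum_(i < n) f i.
Proof.
elim: n => [|n ih]; first by rewrite !big_ord0 mulr0.
rewrite !big_ord_recr/= ih big_split/= sumr_const card_ord -mulr_natl -natr1.
by ring.
Qed.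

Lemma sum_ltn_nat_eq {R : realType} m : \sum_(j < m) j%:R = m%:R * (m%:R - 1) / 2 :> R.
Proof.
elim: m => [|m ih]; first by rewrite big_ord0 mul0r mul0r.
by rewrite big_ord_recr/= ih -natr1; field.
Qed.

Section Variance.
Context {d} {T : measurableType d} {R : realType} (P : probability T R).

Lemma sqr_Ex_le (f : T -> R) : bmf f -> Ex P f ^+ 2 <= Ex P (fun x => f x ^+ 2).
Proof.
move=> bf; set m := Ex P f.
have h : 0 <= Ex P (fun x => (f x ^+ 2 - (2 * m) * f x) + m ^+ 2).
  by apply: Ex_ge0 => x; rewrite (_ : _ + _ = (f x - m) ^+ 2) ?sqr_ge0//; ring.
have b2 := bmfX 2 bf; have bz := bmfZ (2 * m) bf.
move: h; rewrite (ExD (bmf_itg P (bmfB b2 bz)) (bmf_itg P (bmf_cst (m ^+ 2)))).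
rewrite (ExB (bmf_itg P b2) (bmf_itg P bz)) (ExZ _ (bmf_itg P bf)) Ex_cst -/m.
by nra.
Qed.

Lemma Ex_center_le (f : T -> R) : bmf f ->
  Ex P (fun x => (f x - Ex P f) ^+ 2) <= Ex P (fun x => f x ^+ 2).
Proof.
move=> bf; set m := Ex P f.
have b2 := bmfX 2 bf; have bz := bmfZ (2 * m) bf.
have -> : (fun x => (f x - m) ^+ 2) = (fun x => (f x ^+ 2 - (2 * m) * f x) + m ^+ 2).
  by apply/funext => x; ring.
rewrite (ExD (bmf_itg P (bmfB b2 bz)) (bmf_itg P (bmf_cst (m ^+ 2)))).
rewrite (ExB (bmf_itg P b2) (bmf_itg P bz)) (ExZ _ (bmf_itg P bf)) Ex_cst -/m.
by have := sqr_ge0 m; nra.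
Qed.

Lemma Ex_sqrB_le (f g : T -> R) : bmf f -> bmf g ->
  Ex P (fun x => (f x - g x) ^+ 2) <=
  2 * Ex P (fun x => f x ^+ 2) + 2 * Ex P (fun x => g x ^+ 2).
Proof.
move=> bf bg; have b2 := bmfX 2 bf; have g2 := bmfX 2 bg.
rewrite -(ExZ 2 (bmf_itg P b2)) -(ExZ 2 (bmf_itg P g2)).
rewrite -(ExD (bmf_itg P (bmfZ 2 b2)) (bmf_itg P (bmfZ 2 g2))).
apply: Ex_le; [exact/bmf_itg/bmfX/bmfB | exact/bmf_itg/bmfD/bmfZ/g2/bmfZ/b2 |].
by move=> x; have := sqr_ge0 (f x + g x); nra.
Qed.

End Variance.

Section AltScale.
Context {d} {T : measurableType d} {R : realType} {d'} {Om : measurableType d'}.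
Variables (Q : probability Om R) (P0 P : probability T R) (n : nat) (X : nat -> Om -> T).
Hypothesis iid : iid_sample Q P n X.
Variables (phi : nat -> T -> R) (B : R) (w : nat -> R) (p : T -> R).
Hypotheses (mphi : forall k, measurable_fun setT (phi k))
  (phiB : forall k x, `|phi k x| <= B)
  (orth : forall j k, Ex P0 (fun x => phi j x * phi k x) = (j == k)%:R)
  (w01 : forall k, 0 <= w k <= 1) (sw : cvgn (series w))
  (Lp : L2 P0 p) (PE : forall f, bmf f -> Ex P f = Ex P0 (fun x => f x * p x)).

Let a k := Ex P (phi k).
Let G := rsum (fun k => w k * a k ^+ 2).
Let K := ker phi w.
(** First Hoeffding projection of the kernel, which need not be degenerate under P; its mean under P
    is the energy [G]. *)
Let g x := Ex P (K x).
Let S2 := Ex P0 (fun x => p x ^+ 2).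
Let w0 k : 0 <= w k. Proof. by case/andP: (w01 k). Qed.
Let bphi k : bmf (phi k) := phi_bmf mphi phiB k.
Let bK : bkf K. Proof. exact: (ker_bkf mphi phiB). Qed.
Let bg : bmf g. Proof. exact: bkf_Ex_r. Qed.

Let aB k : `|a k| <= B.
Proof. by apply: Ex_norm_le => //; exact: bmf_itg. Qed.

Let a2B k : a k ^+ 2 <= B ^+ 2.
Proof.
have B0 := le_trans (normr_ge0 _) (aB k).
by rewrite -[leLHS]real_normK ?num_real// ler_sqr ?nnegrE.
Qed.

Lemma energy_summable : cvgn (series (fun k => w k * Ex P (phi k) ^+ 2)).
Proof.
apply: (@summable_le _ _ (fun k => B ^+ 2 * w k)) => [k|].
  by rewrite mulr_ge0 ?sqr_ge0//= mulrC; apply: ler_wpM2r => //; exact: a2B.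
exact: (@is_cvg_seriesZ _ w (B ^+ 2)).
Qed.

Let swa : cvgn (series (fun k => `|w k * a k|)).
Proof.
apply: (@summable_le _ _ (fun k => B * w k)) => [k|].
  by rewrite normr_ge0/= normrM (ger0_norm (w0 k)) mulrC ler_wpM2r.
exact: (@is_cvg_seriesZ _ w B).
Qed.

Let gE : g = (fun x => rsum (fun k => w k * a k * phi k x)).
Proof.
apply/funext => x; rewrite /g (Ex_ker mphi phiB w0 sw).
by congr rsum; apply/funext => k; rewrite mulrAC.
Qed.

Let Eg : Ex P g = G.
Proof.
rewrite gE -(rsumE (Ex_phi_series mphi phiB swa (P := P))).
by congr rsum; apply/funext => k; rewrite -mulrA expr2.
Qed.

Let Eg0 : Ex P0 (fun x => g x ^+ 2) <= G.
Proof.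
have -> : Ex P0 (fun x => g x ^+ 2) = rsum (fun k => (w k * a k) ^+ 2).
  by rewrite gE; apply/esym/rsumE; exact: (Ex_phi_series_sqr mphi phiB).
apply: rsum_le; last exact: energy_summable.
move=> k; rewrite sqr_ge0/= exprMn expr2 -mulrA.
have /andP[_ w1] := w01 k.
by apply: ler_wpM2l => //; rewrite ler_piMl ?sqr_ge0.
Qed.

(** Cauchy-Schwarz for the sums of [w k] and of [w k * a k ^ 2], carried out term by term as an
    arithmetic-geometric mean inequality; [ka = ga / (B * Z)] balances the two halves. *)
Let g_sup (ga Z : R) x : 0 < ga -> 0 < Z -> 0 < B -> ga ^+ 2 = G -> rsum w <= Z ^+ 2 ->
  `|g x| <= ga * B * Z.
Proof.
move=> ga0 Z0 B0 gaG wZ.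
have [ka ka0 kaE] : exists2 ka, 0 < ka & ka * (B * Z) = ga.
  by exists (ga / (B * Z)); [rewrite divr_gt0// mulr_gt0 | rewrite mulfVK// gt_eqF// mulr_gt0].
have sN N : `|\sum_(0 <= k < N) w k * a k * phi k x| <= ga * B * Z.
  apply: le_trans (ler_norm_sum _ _ _) _.
  apply: (@le_trans _ _ (\sum_(0 <= k < N) (ka * B ^+ 2 / 2 * w k + ka^-1 / 2 * (w k * a k ^+ 2)))).
    apply: ler_sum => k _; rewrite !normrM (ger0_norm (w0 k)) -mulrA.
    have -> : ka * B ^+ 2 / 2 * w k + ka^-1 / 2 * (w k * a k ^+ 2) =
      w k * ((ka ^+ 2 * B ^+ 2 + a k ^+ 2) / (2 * ka)) by field; rewrite gt_eqF.
    rewrite ler_wpM2l// ler_pdivlMr ?mulr_gt0//.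
    have h1 : `|a k| * `|phi k x| <= `|a k| * B by rewrite ler_wpM2l.
    have h2 : `|a k| * `|phi k x| * (2 * ka) <= `|a k| * B * (2 * ka).
      by rewrite ler_wpM2r// mulr_ge0// ltW.
    apply: le_trans h2 _; rewrite -[a k ^+ 2]real_normK ?num_real//.
    by have := sqr_ge0 (ka * B - `|a k|); nra.
  rewrite big_split/= -!mulr_sumr.
  have h1 : \sum_(0 <= k < N) w k <= Z ^+ 2 by apply: le_trans wZ; exact: le_rsum_partial.
  have h2 : \sum_(0 <= k < N) w k * a k ^+ 2 <= ga ^+ 2.
    rewrite gaG; apply: le_rsum_partial => [k|]; last exact: energy_summable.
    by rewrite mulr_ge0 ?sqr_ge0.
  have -> : ga * B * Z = ka * B ^+ 2 / 2 * Z ^+ 2 + ka^-1 / 2 * ga ^+ 2.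
    by rewrite -kaE; field; rewrite !gt_eqF.
  apply: lerD; apply: ler_wpM2l => //; apply: divr_ge0 => //.
    by apply: mulr_ge0; [exact: ltW | exact: sqr_ge0].
  by rewrite invr_ge0 ltW.
rewrite gE; have cv : `|\sum_(0 <= k < N) w k * a k * phi k x| @[N --> \oo] -->
    `|rsum (fun k => w k * a k * phi k x)|.
  apply: cvg_norm; apply: rsum_cvg; apply: normed_cvg.
  apply: (@summable_le _ _ (fun k => B * `|w k * a k|)) => [k|].
    by rewrite normr_ge0/= normrM mulrC ler_wpM2r.
  exact: (@is_cvg_seriesZ _ (fun k => `|w k * a k|) B).
rewrite -(cvg_lim _ cv)//; apply: limr_le; last exact: nearW.
by apply/cvg_ex; eexists; exact: cv.
Qed.

(** Under P0 this is the expectation of [g^2 * p]. One factor g is bounded by [g_sup]; the other is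
    paired with p in L2(P0), where its squared norm is at most [G]. Only square integrability of p
    is used, and [tau = sg / ga] balances the inequality. *)
Let Eg2 (ga Z sg : R) : 0 < ga -> 0 < Z -> 0 < B -> 0 < sg -> ga ^+ 2 = G ->
  rsum w <= Z ^+ 2 -> S2 <= sg ^+ 2 ->
  Ex P (fun x => g x ^+ 2) <= ga ^+ 2 * (B * Z * sg).
Proof.
move=> ga0 Z0 B0 sg0 gaG wZ Ssg; rewrite (PE (bmfX 2 bg)).
have [tau tau0 tauE] : exists2 tau, 0 < tau & tau * ga = sg.
  by exists (sg / ga); [rewrite divr_gt0 | rewrite mulfVK// gt_eqF].
have Lg := bmf_L2 P0 bg.
apply: (@le_trans _ _ (Ex P0 (fun x => ga * B * Z * (tau / 2 * g x ^+ 2 + tau^-1 / 2 * p x ^+ 2)))).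
  apply: Ex_le.
  - by apply: L2M => //; exact/bmf_L2/bmfX.
  - by apply: itgZ; apply: itgD; apply: itgZ; exact: L2_sqr.
  move=> x; have hx := g_sup x ga0 Z0 B0 gaG wZ.
  apply: le_trans (ler_norm _) _.
  have -> : `|g x ^+ 2 * p x| = `|g x| * (`|g x| * `|p x|) by rewrite normrM normrX expr2 mulrA.
  apply: le_trans (_ : ga * B * Z * (`|g x| * `|p x|) <= _).
    by rewrite ler_wpM2r// mulr_ge0.
  apply: ler_wpM2l; first by rewrite !mulr_ge0 ?ltW.
  have -> : tau / 2 * g x ^+ 2 + tau^-1 / 2 * p x ^+ 2 =
    (tau ^+ 2 * g x ^+ 2 + p x ^+ 2) / (2 * tau) by field; rewrite gt_eqF.
  rewrite ler_pdivlMr ?mulr_gt0// -[g x ^+ 2]real_normK ?num_real//.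
  rewrite -[p x ^+ 2]real_normK ?num_real//.
  by have := sqr_ge0 (tau * `|g x| - `|p x|); nra.
have ig := itgZ (tau / 2) (L2_sqr Lg); have ip := itgZ (tau^-1 / 2) (L2_sqr Lp).
rewrite (ExZ _ (itgD ig ip)) (ExD ig ip) (ExZ _ (L2_sqr Lg)) (ExZ _ (L2_sqr Lp)).
have -> : ga ^+ 2 * (B * Z * sg) = ga * B * Z * (tau / 2 * ga ^+ 2 + tau^-1 / 2 * sg ^+ 2).
  by rewrite -tauE; field; rewrite !gt_eqF.
apply: ler_wpM2l; first by rewrite !mulr_ge0 ?ltW.
apply: lerD; apply: ler_wpM2l.
- by rewrite divr_ge0// ltW.
- by rewrite gaG.
- by rewrite divr_ge0// invr_ge0 ltW.
- by [].
Qed.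

(* E_P of the squared truncated kernel is the sum of w_j w_k (E_P phi_j phi_k)^2, and
   Bessel's inequality for phi_j p bounds the sum over k. *)
Let kernel_second_moment :
  Ex P (fun x => Ex P (fun y => K x y ^+ 2)) <= rsum w * (B ^+ 2 * S2).
Proof.
pose F N x := Ex P (fun y => kerN phi w N x y ^+ 2).
pose C := (B ^+ 2 * rsum w) ^+ 2.
have C0 (x : T) : 0 <= B ^+ 2 * rsum w by exact: le_trans (normr_ge0 _) (ker_bound phiB w0 sw x x).
have bN N := kerN_bkf mphi phiB w N.
have bN2 N : bkf (fun x y => kerN phi w N x y ^+ 2) by exact: (bmfX 2 (bN N)).
have NC N x y : `|kerN phi w N x y ^+ 2| <= C.
  by rewrite normrX lerXn2r ?nnegrE ?(C0 x)// kerN_bound.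
have cvF x : F ^~ x @ \oo --> Ex P (fun y => K x y ^+ 2).
  have [N|N y|y|_] := @bounded_cvg_Ex _ _ _ P (fun N y => kerN phi w N x y ^+ 2) (fun y => K x y ^+ 2) C.
  - by case: (bkf_r x (bN2 N)).
  - exact: NC.
  - by apply: cvg_sqr; exact: ker_cvg.
  - by [].
have bF N : bmf (F N) by exact: bkf_Ex_r.
have [N|N x|x|_ cv] := @bounded_cvg_Ex _ _ _ P F (fun x => Ex P (fun y => K x y ^+ 2)) C.
- by case: (bF N).
- by apply: Ex_norm_le => [|y]; [exact/bmf_itg/(bkf_r x (bN2 N)) | exact: NC].
- exact: cvF.
rewrite -(cvg_lim _ cv)//; apply: limr_le; first by apply/cvg_ex; eexists; exact: cv.
apply: nearW => N.
have bf j k x : bmf (fun y => (w j * phi j x * phi j y) * (w k * phi k x * phi k y)).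
  by apply: bmfM; exact: bmfZ.
have bjk j k : bmf (fun x => phi j x * phi k x) by exact: bmfM.
have FE x : F N x = \sum_(0 <= j < N) \sum_(0 <= k < N)
    (w j * w k * Ex P (fun y => phi j y * phi k y)) * (phi j x * phi k x).
  rewrite /F.
  have -> : (fun y => kerN phi w N x y ^+ 2) = (fun y => \sum_(0 <= j < N) \sum_(0 <= k < N)
      (w j * phi j x * phi j y) * (w k * phi k x * phi k y)).
    apply/funext => y; rewrite expr2 /kerN mulr_suml; apply: eq_bigr => j _.
    by rewrite mulr_sumr.
  rewrite (@Ex_sumE _ _ _ P _ _ (fun j y => \sum_(0 <= k < N)
      (w j * phi j x * phi j y) * (w k * phi k x * phi k y))) => [|j]; last first.
    by apply: (@bmf_sum _ _ _ _ _ (fun k y => (w j * phi j x * phi j y) * (w k * phi k x * phi k y))) => k; exact: bf.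
  apply: eq_bigr => j _.
  rewrite (@Ex_sumE _ _ _ P _ _ (fun k y => (w j * phi j x * phi j y) * (w k * phi k x * phi k y))) => [|k]; last exact: bf.
  apply: eq_bigr => k _.
  rewrite [RHS](_ : _ = (w j * phi j x * (w k * phi k x)) * Ex P (fun y => phi j y * phi k y)); last by ring.
  rewrite -(ExZ _ (bmf_itg P (bjk j k))).
  by apply: eq_Rintegral => y _; ring.
rewrite (_ : F N = fun x => \sum_(0 <= j < N) \sum_(0 <= k < N)
    (w j * w k * Ex P (fun y => phi j y * phi k y)) * (phi j x * phi k x)); last exact/funext.
rewrite (@Ex_sumE _ _ _ P _ _ (fun j x => \sum_(0 <= k < N)
    (w j * w k * Ex P (fun y => phi j y * phi k y)) * (phi j x * phi k x))) => [|j]; last first.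
  by apply: (@bmf_sum _ _ _ _ _ (fun k x => (w j * w k * Ex P (fun y => phi j y * phi k y)) * (phi j x * phi k x))) => k; exact: bmfZ.
apply: (@le_trans _ _ (\sum_(0 <= j < N) w j * (B ^+ 2 * S2))); last first.
  rewrite -mulr_suml ler_wpM2r ?le_rsum_partial//.
  by rewrite mulr_ge0 ?sqr_ge0//; apply: Ex_ge0 => x; exact: sqr_ge0.
apply: ler_sum => j _.
rewrite (@Ex_sumE _ _ _ P _ _ (fun k x => (w j * w k * Ex P (fun y => phi j y * phi k y)) * (phi j x * phi k x))) => [|k]; last exact: bmfZ.
have Ljp := bmfM_L2 (bphi j) Lp.
apply: (@le_trans _ _ (\sum_(0 <= k < N) w j * Ex P0 (fun x => phi j x * p x * phi k x) ^+ 2)).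
  apply: ler_sum => k _; rewrite (ExZ _ (bmf_itg P (bjk j k))).
  have -> : Ex P0 (fun x => phi j x * p x * phi k x) = Ex P (fun y => phi j y * phi k y).
    by rewrite PE//; apply: eq_Rintegral => x _; rewrite mulrAC.
  rewrite -!mulrA -expr2 ler_wpM2l// ler_piMl ?sqr_ge0//.
  by case/andP: (w01 k).
rewrite -mulr_sumr ler_wpM2l//.
apply: le_trans (bessel mphi phiB orth N Ljp) _.
have iS := L2_sqr Lp.
rewrite -(ExZ _ iS); apply: Ex_le; [exact: L2_sqr | exact: itgZ |].
move=> x; rewrite exprMn ler_wpM2r ?sqr_ge0//.
rewrite -[leLHS]real_normK ?num_real// ler_sqr ?nnegrE//.
exact: le_trans (normr_ge0 _) (phiB j x).
Qed.

Let s := \sum_(j < n) j%:R : R.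

Lemma alt_variance (ga Z sg : R) : (0 < n)%N -> 0 < ga -> 0 < Z -> 0 < B -> 0 < sg -> ga ^+ 2 = G ->
  rsum w <= Z ^+ 2 -> S2 <= sg ^+ 2 ->
  Ex Q (fun om => (\sum_(j < n) \sum_(i < j) K (X i om) (X j om) - s * G) ^+ 2) <=
  4 * (n%:R * (B * Z * sg)) ^+ 2 + 2 * n%:R ^+ 3 * ga ^+ 2 * (B * Z * sg).
Proof.
move=> n0 ga0 Z0 B0 sg0 gaG wZ Ssg.
have hg2 := Eg2 ga0 Z0 B0 sg0 gaG wZ Ssg.
have hK2 : Ex P (fun x => Ex P (fun y => K x y ^+ 2)) <= (B * Z * sg) ^+ 2.
  apply: le_trans kernel_second_moment _.
  rewrite !exprMn mulrCA -mulrA ler_wpM2l ?sqr_ge0//.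
  apply: ler_pM => //; first by apply: rsum_ge0.
  by apply: Ex_ge0 => x; exact: sqr_ge0.
pose Kc x y := (K x y - g x) - (g y - G).
have bgl : bkf (fun x _ : T => g x) by exact: (bmf_comp bg measurable_fst).
have bgr : bkf (fun _ y : T => g y) by exact: (bmf_comp bg measurable_snd).
have bKc : bkf Kc.
  apply: (@bmfB _ _ _ (fun z : T * T => K z.1 z.2 - g z.1) (fun z => g z.2 - G)).
    exact: bmfB bK bgl.
  exact: bmfB bgr (bmf_cst G).
have sKc x y : Kc x y = Kc y x.
  by rewrite /Kc (kerC phi w x y : K x y = K y x); ring.
have bgG : bmf (fun y => g y - G) by exact: bmfB bg (bmf_cst G).
have EgG : Ex P (fun y => g y - G) = 0.
  by rewrite (ExB (bmf_itg P bg) (bmf_itg P (bmf_cst G))) Ex_cst Eg subrr.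
have bKx x : bmf (K x) by exact: bkf_r bK.
have bKgx x : bmf (fun y => K x y - g x) by exact: bmfB (bKx x) (bmf_cst (g x)).
have Kc0 x : Ex P (Kc x) = 0.
  rewrite (ExB (bmf_itg P (bKgx x)) (bmf_itg P bgG)) EgG subr0.
  by rewrite (ExB (bmf_itg P (bKx x)) (bmf_itg P (bmf_cst (g x)))) Ex_cst subrr.
have bK2 : bkf (fun x y => K x y ^+ 2) by exact: (bmfX 2 bK).
have bEK2 : bmf (fun x => Ex P (fun y => K x y ^+ 2)) by exact: bkf_Ex_r.
have g2K : Ex P (fun x => g x ^+ 2) <= (B * Z * sg) ^+ 2.
  apply: le_trans hK2; apply: Ex_le; [exact/bmf_itg/bmfX | exact: bmf_itg |].
  by move=> x; exact: sqr_Ex_le.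
have EKc : Ex P (fun x => Ex P (fun y => Kc y x ^+ 2)) <= 4 * (B * Z * sg) ^+ 2.
  apply: (@le_trans _ _ (Ex P (fun x => 2 * Ex P (fun y => K x y ^+ 2) + 2 * Ex P (fun y => g y ^+ 2)))).
    apply: Ex_le.
    - by apply: bmf_itg; exact: (bkf_Ex_l P P (h := fun y x => Kc y x ^+ 2) (bmfX 2 bKc)).
    - by apply: bmf_itg; apply: bmfD; [exact: bmfZ | exact: bmf_cst].
    move=> x; under [X in Ex P X <= _]eq_fun do rewrite sKc.
    apply: le_trans (Ex_sqrB_le P (bKgx x) bgG) _.
    apply: lerD; apply: ler_wpM2l => //; first exact: Ex_center_le.
    by rewrite -Eg; exact: Ex_center_le.
  rewrite (ExD (bmf_itg P (bmfZ 2 bEK2)) (bmf_itg P (bmf_cst _))) Ex_cst (ExZ _ (bmf_itg P bEK2)).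
  by lra.
(* Hoeffding decomposition of the U-statistic under P. *)
pose S om := \sum_(i < n) (g (X i om) - G).
pose U om := \sum_(j < n) \sum_(i < j) Kc (X i om) (X j om).
(* Each index lies in n - 1 pairs, which gives the coefficient of the linear part; the sign [1 - n]
   turns the sum into the difference that [Ex_sqrB_le] expects. *)
have UE om : \sum_(j < n) \sum_(i < j) K (X i om) (X j om) - s * G = U om - (1 - n%:R) * S om.
  rewrite (_ : (1 - n%:R) * S om = - ((n%:R - 1) * S om)); last by ring.
  rewrite -(sum_pairs (fun i => g (X i om) - G)) opprK /U -big_split/=.
  rewrite /s mulr_suml -sumrB; apply: eq_bigr => j _.
  rewrite -big_split/= mulr_natl -[X in _ *+ X]card_ord -sumr_const -sumrB; apply: eq_bigr => i _.
  by rewrite /Kc; ring.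
have bU : bmf U by apply: (Past_bmf iid (j := n)); exact: (Past_U).
have bS : bmf S by apply: (Past_bmf iid (j := n)); exact: (Past_sum_bmf X bgG (leqnn n)).
under [X in Ex Q X <= _]eq_fun do rewrite UE.
apply: le_trans (Ex_sqrB_le Q bU (bmfZ (1 - n%:R) bS)) _.
apply: lerD.
  rewrite (Ex_U_sqr iid bKc sKc Kc0)//.
  have sn := @sum_ltn_nat R n.
  apply: (@le_trans _ _ (2 * (n%:R ^+ 2 / 2 * (4 * (B * Z * sg) ^+ 2)))); last first.
    by rewrite exprMn le_eqVlt; apply/orP; left; apply/eqP; field.
  apply: ler_wpM2l => //; apply: ler_pM => //; first by apply: sumr_ge0.
  by apply: Ex_ge0 => x; apply: Ex_ge0 => y; exact: sqr_ge0.
have -> : (fun om => ((1 - n%:R) * S om) ^+ 2) = (fun om => (1 - n%:R) ^+ 2 * S om ^+ 2).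
  by apply/funext => om; rewrite exprMn.
rewrite (ExZ _ (bmf_itg Q (bmfX 2 bS))) (Ex_sum_sqr iid bgG)//.
have hc : Ex P (fun x => (g x - G) ^+ 2) <= ga ^+ 2 * (B * Z * sg).
  by apply: le_trans hg2; rewrite -Eg; exact: Ex_center_le.
have -> : 2 * n%:R ^+ 3 * ga ^+ 2 * (B * Z * sg) =
  2 * (n%:R ^+ 2 * (n%:R * (ga ^+ 2 * (B * Z * sg)))) by ring.
apply: ler_wpM2l => //; apply: ler_pM; first exact: sqr_ge0.
- by apply: mulr_ge0 => //; apply: Ex_ge0 => x; exact: sqr_ge0.
- rewrite -subr_ge0 (_ : _ - _ = (n%:R - 1) + n%:R); last by ring.
  by apply: addr_ge0 => //; rewrite subr_ge0 ler1n.
- exact: ler_wpM2l.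
Qed.

(** For n >= 2 the mean [s * G] is at least [n^2 * G / 4], twice [m = n^2 * G / 8]. A value of the
    U-statistic below m is then a deviation of more than m, which makes [Y] at least 1; dividing the
    variance by [m^2] produces the 64. *)
Lemma alt_chebyshev (c t Z sg : R) : (1 < n)%N -> 0 < G -> 0 < Z -> 0 < B -> 0 < sg ->
  rsum w <= Z ^+ 2 -> S2 <= sg ^+ 2 -> 0 < c -> t <= c * (n%:R ^+ 2 * G / 8) ->
  exists Y : Om -> R, [/\ bmf Y, forall om, 0 <= Y om,
    forall om, Y om < 1 ->
      t <= \sum_(j < n) \sum_(i < j) (c * ker phi w (X i om) (X j om)) &
    Ex Q Y <= 64 * (4 * (B * Z * sg / (n%:R * G)) ^+ 2 + 2 * (B * Z * sg / (n%:R * G)))].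
Proof.
move=> n1 G0 Z0 B0 sg0 wZ Ssg c0 tc.
pose ga := Num.sqrt G; have ga0 : 0 < ga by rewrite sqrtr_gt0.
have gaG : ga ^+ 2 = G by rewrite sqr_sqrtr// ltW.
have V := alt_variance (ltnW n1) ga0 Z0 B0 sg0 gaG wZ Ssg.
have n2 : 2 <= n%:R :> R by rewrite ler_nat.
have sE : n%:R ^+ 2 / 4 <= s by rewrite /s sum_ltn_nat_eq; nra.
have nR : 0 < n%:R :> R by exact: lt_le_trans n2.
pose m := n%:R ^+ 2 * G / 8.
have m0 : 0 < m by rewrite divr_gt0// mulr_gt0 ?exprn_gt0.
have sm : 2 * m <= s * G.
  have -> : 2 * m = n%:R ^+ 2 / 4 * G by rewrite /m; field.
  by rewrite ler_wpM2r// ltW.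
pose U om := \sum_(j < n) \sum_(i < j) K (X i om) (X j om).
have bU : bmf (fun om => U om - s * G).
  by apply: bmfB; [apply: (Past_bmf iid (j := n)); exact: (Past_U) | exact: bmf_cst].
exists (fun om => (m ^+ 2)^-1 * (U om - s * G) ^+ 2); split.
- exact/bmfZ/bmfX.
- by move=> om; rewrite mulr_ge0 ?sqr_ge0// invr_ge0 sqr_ge0.
- move=> om; rewrite mulrC ltr_pdivrMr ?exprn_gt0// mul1r => h.
  have hm : m <= U om.
    rewrite leNgt; apply/negP => Um; move: h; rewrite ltNge => /negP; apply.
    by nra.
  under eq_bigr do rewrite -mulr_sumr.
  by rewrite -mulr_sumr; apply: le_trans tc _; rewrite ler_wpM2l// ltW.
rewrite (ExZ _ (bmf_itg Q (bmfX 2 bU))).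
apply: (@le_trans _ _ ((m ^+ 2)^-1 * (4 * (n%:R * (B * Z * sg)) ^+ 2 + 2 * n%:R ^+ 3 * ga ^+ 2 * (B * Z * sg)))).
  by rewrite ler_wpM2l ?invr_ge0 ?sqr_ge0.
rewrite gaG /m le_eqVlt; apply/orP; left; apply/eqP.
by field; rewrite !gt_eqF.
Qed.

End AltScale.

(** * Detectable alternatives *)

Lemma measurable_Ttilde {d} {T : measurableType d} {R : realType} {d'} {Om : measurableType d'}
  (lam : nat -> R) (phi : nat -> T -> R) (s : R) n (X : nat -> Om -> T) :
  (forall k, (k <= m_star s n)%N -> measurable_fun setT
     (fun w => Tstat lam phi (2 ^+ k * rho_star s n) n (fun i => X i w))) ->
  measurable_fun setT (fun w => Ttilde lam phi s n (fun i => X i w)).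
Proof.
move=> mT; set m := m_star s n in mT.
pose V k w := if (k <= m)%N then Tstat lam phi (2 ^+ k * rho_star s n) n (fun i => X i w) else 0.
have mV k : measurable_fun setT (V k).
  have [km|mk] := leqP k m; last first.
    have -> : V k = cst 0 by apply/funext => w; rewrite /V leqNgt mk.
    exact: measurable_cst.
  by have := mT k km; congr measurable_fun; apply/funext => w; rewrite /V km.
have -> : (fun w => Ttilde lam phi s n (fun i => X i w)) =
    (fun w => \big[Order.max/V 0%N w]_(0 <= k < m.+1) V k w).
  apply/funext => w; rewrite /Ttilde /V leq0n expr0 mul1r; apply: eq_big_nat => k /andP[_].
  by rewrite ltnS => ->.
exact: measurable_bigmax_seq.
Qed.

Section AlternativeEnergy.
Context {d} {T : measurableType d} {R : realType} (P0 : probability T R).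
Variables (phi : nat -> T -> R) (B : R) (lam : nat -> R) (M theta : R) (u : T -> R).
Hypotheses (mphi : forall k, measurable_fun setT (phi k))
  (phiB : forall k x, `|phi k x| <= B)
  (orth : forall j k, Ex P0 (fun x => phi j x * phi k x) = (j == k)%:R)
  (mean : forall k, Ex P0 (phi k) = 0)
  (lam0 : forall k, 0 < lam k) (lamd : forall k, lam k.+1 < lam k)
  (slam : cvgn (series lam))
  (basis : forall f, L2 P0 f -> mean0 P0 f -> (forall k, inner P0 f (phi k) = 0) ->
     L2sq P0 f = 0)
  (M0 : 0 < M) (Lu : L2 P0 u) (Fu : inF P0 lam phi theta M u).

Let D2 := Ex P0 (fun x => u x ^+ 2).

Let inF_approx (Rr : R) : 0 < theta -> 0 < Rr -> exists h, [/\ inH P0 lam phi h,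
  (Knorm2 P0 lam phi h <= (Rr ^+ 2)%:E)%E &
  Ex P0 (fun x => (u x - h x) ^+ 2) <= (M * Rr `^ (- theta^-1)) ^+ 2].
Proof.
move=> th0 R0; case: Fu => [[thE _]|[_ [_ /(_ _ R0)[h [Hh hA hu]]]]].
  by move: th0; rewrite thE ltxx.
exists h; split => //; move: hu; rewrite /L2norm => hu.
rewrite -[leLHS]sqr_sqrtr; last by apply: Ex_ge0 => x; exact: sqr_ge0.
by rewrite ler_sqr ?nnegrE ?sqrtr_ge0// mulr_ge0 ?powR_ge0// ltW.
Qed.

(** Take u itself as approximant if theta = 0, and the approximant of radius 1, with error at most
    M, otherwise; the bound covers both cases. It is uniform in theta, which the choice of constants
    for the power requires. *)
Lemma alt_size_le : D2 <= 3 * M ^+ 2 + 3 * (lam 0%N * (1 + M ^+ 2)).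
Proof.
have l0 := lam0 0%N; have M2 := sqr_ge0 M.
case: (Fu) => [[_ [Hu hA]]|[th0 _]].
  have [h _] := alt_size_bound mphi phiB orth mean lam0 lamd slam basis Lu Hu hA.
  apply: le_trans h _; rewrite (_ : Ex P0 _ = 0).
    by nra.
  rewrite -[RHS](Ex_cst P0); apply: eq_Rintegral => x _.
  by rewrite subrr expr0n.
have [h [Hh hA eh]] := inF_approx th0 ltr01.
have [hh _] := alt_size_bound mphi phiB orth mean lam0 lamd slam basis Lu Hh hA.
apply: le_trans hh _; move: eh; rewrite powR1 mulr1 expr1n => eh.
by set e := Ex P0 _ in eh *; nra.
Qed.

(** The radius [(6 M / D)^theta] makes the approximation error equal to D/6; for theta = 0 the
    approximant is u itself, of norm at most M, and the factor [1 + M] serves both cases. The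
    constant is 1/6 - (3/2)/36 - (1/2)/36 = 1/9. *)
Lemma alt_energy (rho : R) : 0 < rho -> 0 < D2 -> 0 <= theta ->
  cvgn (series (fun k => wgt lam rho k * Ex P0 (fun x => u x * phi k x) ^+ 2)) ->
  rho * ((1 + M) * (6 * M / Num.sqrt D2) `^ theta) <= Num.sqrt D2 / 6 ->
  D2 / 9 <= rsum (fun k => wgt lam rho k * Ex P0 (fun x => u x * phi k x) ^+ 2).
Proof.
move=> r0 D0 th0 sw; set D := Num.sqrt D2 => rD.
have Dp : 0 < D by rewrite sqrtr_gt0.
have DD : D ^+ 2 = D2 by rewrite sqr_sqrtr// ltW.
have key h (A : R) : 0 <= A -> inH P0 lam phi h -> (Knorm2 P0 lam phi h <= (A ^+ 2)%:E)%E ->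
    Ex P0 (fun x => (u x - h x) ^+ 2) <= D2 / 36 -> rho * A <= D / 6 ->
    D2 / 9 <= rsum (fun k => wgt lam rho k * Ex P0 (fun x => u x * phi k x) ^+ 2).
  move=> A0 Hh hA eh rA.
  have [_ hh] := alt_size_bound mphi phiB orth mean lam0 lamd slam basis Lu Hh hA.
  have r2 : 0 < rho ^+ 2 by exact: exprn_gt0.
  have := hh (wgt lam rho) (rho ^+ 2) (fun k => erefl) r2 sw.
  apply: le_trans.
  have rA2 : rho ^+ 2 * A ^+ 2 <= D2 / 36.
    rewrite -exprMn -DD (_ : _ / 36 = (D / 6) ^+ 2); last by field.
    by rewrite ler_sqr ?nnegrE// ?divr_ge0 ?mulr_ge0// ltW.
  rewrite -/D2; set e := Ex P0 _ in eh *.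
  by move: (rho ^+ 2 * A ^+ 2) rA2 => z; lra.
case: (Fu) => [[thE [Hu hA]]|[thp _]].
  apply: (key u M) => //; first exact: ltW.
    rewrite (_ : Ex P0 _ = 0) ?divr_ge0 ?ltW//.
    by rewrite -[RHS](Ex_cst P0); apply: eq_Rintegral => x _; rewrite subrr expr0n.
  apply: le_trans rD; rewrite thE powRr0 mulr1 ler_wpM2l ?(ltW r0)//.
  by rewrite lerDr.
pose A := (6 * M / D) `^ theta.
have b0 : 0 < 6 * M / D by rewrite divr_gt0// mulr_gt0.
have A0 : 0 < A by rewrite powR_gt0.
have [h [Hh hA eh]] := inF_approx thp A0.
apply: (key h A) => //; first exact: ltW.
  apply: le_trans eh _.
  rewrite /A -powRrM mulrN divff ?gt_eqF// powR_inv1 ?(ltW b0)// -DD.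
  by rewrite le_eqVlt; apply/orP; left; apply/eqP; field; rewrite !gt_eqF.
apply: le_trans rD; rewrite ler_wpM2l ?(ltW r0)//.
by rewrite ler_peMl ?(ltW A0)// lerDl ltW.
Qed.

End AlternativeEnergy.

Lemma grid_arith {R : realType} (m c g r a t D : R) : 0 < a -> 0 < t ->
  12 * m * c * g * r <= a * t * D ->
  2 * (c * r / a) * (m * (g / t)) <= D / 6.
Proof.
move=> a0 t0 h; rewrite ler_pdivlMr//.
have -> : 2 * (c * r / a) * (m * (g / t)) * 6 = 12 * m * c * g * r / (a * t).
  by field; rewrite !gt_eqF.
by rewrite ler_pdivrMr ?mulr_gt0// [D * _]mulrC.
Qed.

(* The scale is the first grid point above rho0 = (C0 r / D^2)^(2s), which balances
   the signal D^2 against the null standard deviation. *)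
Lemma grid_exists {R : realType} (s M CM C0 c1 D theta : R) n :
  1 / 2 < s -> 0 < M -> 0 < CM -> CM <= C0 ->
  1 <= c1 -> C0 <= c1 -> (6 * M) ^+ 2 <= c1 -> 12 * (1 + M) * C0 `^ (2 * s) <= c1 ->
  0 <= theta -> 1 <= loglog n :> R ->
  Num.sqrt (loglog n) / n%:R <= 1 :> R ->
  2 * (Num.sqrt (loglog n) / n%:R : R) `^ (2 * s / (4 * s + 1)) <= 1 ->
  0 < D -> D ^+ 2 <= CM ->
  c1 * (Num.sqrt (loglog n) / n%:R) `^ (4 * s / (4 * s + theta + 1)) <= D ^+ 2 ->
  exists k, let rho := 2 ^+ k * rho_star s n in
   [/\ (k <= m_star s n)%N, 0 < rho <= 1,
    rho `^ (- s^-1) <= (D ^+ 2 / (C0 * (Num.sqrt (loglog n) / n%:R))) ^+ 2 &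
    rho * ((1 + M) * (6 * M / D) `^ theta) <= D / 6].
Proof.
move=> s12 M0 CM0 CMC0 c1_1 c1_C0 c1_M c1_p th0 L1 r1 rb D0 DC Dc.
have s0 : 0 < s by apply: lt_trans s12; rewrite divr_gt0.
have [n0 nE xE r0] := loglog_ge1 L1.
have [g1m g2m _] := grid_bounds s0 L1 r1.
have rs0 := rho_star_gt0 s L1.
set rs := rho_star s n in g1m g2m rs0 *.
have rsE : rs = (Num.sqrt (loglog n) / n%:R) `^ (2 * s) by [].
set r : R := Num.sqrt _ / _ in r0 r1 rb Dc g1m g2m rsE *.
set m := m_star s n in g1m g2m *.
have C00 : 0 < C0 by exact: lt_le_trans CM0 CMC0.
have D20 : 0 < D ^+ 2 by exact: exprn_gt0.
have c10 : 0 < c1 by exact: lt_le_trans c1_1.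
pose E := D ^+ 2 / (C0 * r).
have Cr0 : 0 < C0 * r by rewrite mulr_gt0.
have E0 : 0 < E by rewrite divr_gt0.
pose rho0 := E `^ (- (2 * s)).
have s2 : 0 <= 2 * s by rewrite mulr_ge0 ?ltW.
have rho00 : 0 < rho0 by rewrite powR_gt0.
(* Equivalent to [E <= 1 / r], which holds because [D^2 <= CM <= C0]. *)
have h1 : rs <= rho0.
  rewrite rsE /rho0 powRN -[leLHS]invrK lef_pV2 ?posrE ?invr_gt0 ?powR_gt0//.
  have -> : (r `^ (2 * s))^-1 = (r^-1) `^ (2 * s).
    by rewrite -powRN -(powR_inv1 (ltW r0)) -powRrM mulN1r.
  apply: ge0_ler_powR => //; rewrite ?nnegrE ?invr_ge0 ?(ltW r0) ?(ltW E0)//.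
  rewrite /E ler_pdivrMr// mulrC -mulrA divff ?gt_eqF// mulr1.
  exact: le_trans DC CMC0.
have s40 : 0 < 4 * s by rewrite mulr_gt0.
have s41 : 0 < 4 * s + 1 by rewrite addr_gt0.
have kap0 : 0 < 4 * s + theta + 1 by rewrite addr_gt0// ltr_wpDr.
(* As [r <= 1], the separation rate is smallest at theta = 0, and this smallest rate is all that is
   needed to stay below the last grid point. *)
have h2 : rho0 <= 2 ^+ m * rs.
  apply: le_trans g1m.
  have hE : r `^ (- (4 * s + 1)^-1) <= E.
    rewrite /E ler_pdivlMr// mulrCA -(powRr1 (ltW r0)) -powRrM -powRD; last first.
      by apply/implyP => _; rewrite gt_eqF.
    rewrite mul1r.
    apply: le_trans Dc; apply: ler_pM; rewrite ?powR_ge0 ?(ltW C00)//.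
    rewrite ger_powR ?r0// (_ : - _ + 1 = 4 * s / (4 * s + 1)); last by field; rewrite gt_eqF.
    rewrite ler_wpM2l ?(ltW s40)// lef_pV2 ?posrE//.
    by rewrite lerD2r lerDl.
  have -> : r `^ (2 * s / (4 * s + 1)) = (r `^ (- (4 * s + 1)^-1)) `^ (- (2 * s)).
    by rewrite -powRrM; congr (_ `^ _); field; rewrite gt_eqF.
  by apply: powRN_le => //; rewrite powR_gt0.
have exk : exists k, rho0 <= 2 ^+ k * rs by exists m.
have [k hk kmin] := ex_minnP exk.
have km : (k <= m)%N by exact: kmin.
(* By minimality of k the preceding grid point lies below [rho0]; for k = 0 there is none, and [h1]
   takes its place. *)
have rhok : 2 ^+ k * rs <= 2 * rho0.
  case: k hk kmin km => [|k] hk kmin km; first by rewrite expr0 mul1r (le_trans h1)// ler_peMl ?(ltW rho00)// ler1n.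
  have : ~~ (rho0 <= 2 ^+ k * rs) by apply/negP => /kmin; rewrite ltnn.
  by rewrite -ltNge exprS => /ltW h; rewrite -mulrA ler_wpM2l.
have rho_gt0 : 0 < 2 ^+ k * rs by exact: lt_le_trans hk.
exists k => /=; split => //.
- exact: grid_le1.
- apply: le_trans (powRN_le rho00 hk _) _; first by rewrite invr_ge0 ltW.
  rewrite /rho0 -powRrM (_ : _ * _ = 2%:R); last by field; rewrite gt_eqF.
  by rewrite powR_mulrn// ltW.
- apply: le_trans (_ : 2 * rho0 * ((1 + M) * (6 * M / D) `^ theta) <= _).
    by rewrite ler_wpM2r// mulr_ge0 ?powR_ge0// addr_ge0// ltW.
  have M6 : 0 <= 6 * M by rewrite mulr_ge0 ?ltW.
  have D0' := ltW D0.
  have rhoE : rho0 = C0 `^ (2 * s) * r `^ (2 * s) / D `^ (4 * s).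
    rewrite /rho0 powRN /E powRM ?invr_ge0 ?(ltW D20) ?(ltW Cr0)//.
    rewrite -(powR_mulrn _ D0') -powRrM (_ : 2 * (2 * s) = 4 * s); last by ring.
    rewrite -(powR_inv1 (ltW Cr0)) -powRrM mulN1r powRN powRM ?(ltW C00) ?(ltW r0)//.
    by rewrite invfM invrK mulrC.
  have qE : (6 * M / D) `^ theta = (6 * M) `^ theta / D `^ theta.
    rewrite powRM ?invr_ge0//; congr (_ * _).
    by rewrite -(powR_inv1 D0') -powRrM mulN1r powRN.
  (* The separation condition is raised to the power [(4 s + theta + 1) / 2], which turns the rate
     into [r^(2 s)] for every theta. Of the resulting power of c1, the factor with exponent
     [(4 s + 1) / 2 >= 1] absorbs the fixed constants and [c1^(theta / 2)] absorbs [(6 M)^theta];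
     hence one c1 serves all theta. *)
  have key : 12 * (1 + M) * C0 `^ (2 * s) * ((6 * M) `^ theta) * r `^ (2 * s) <=
      D `^ (4 * s) * D `^ theta * D.
    have k2 : 0 <= (4 * s + theta + 1) / 2 by rewrite divr_ge0 ?ltW.
    have -> : D `^ (4 * s) * D `^ theta * D = (D ^+ 2) `^ ((4 * s + theta + 1) / 2).
      rewrite -(powR_mulrn _ D0') -powRrM.
      rewrite (_ : 2 * _ = 4 * s + theta + 1); last by field.
      by rewrite powRD ?(gt_eqF D0) ?implybT// powRD ?(gt_eqF D0) ?implybT// powRr1.
    apply: (@le_trans _ _ ((c1 * r `^ (4 * s / (4 * s + theta + 1))) `^ ((4 * s + theta + 1) / 2))).
      rewrite [leRHS]powRM ?powR_ge0 ?(ltW c10)// -powRrM.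
      rewrite (_ : 4 * s / _ * _ = 2 * s); last by field; rewrite gt_eqF.
      rewrite ler_wpM2r ?powR_ge0//.
      rewrite (_ : (4 * s + theta + 1) / 2 = (4 * s + 1) / 2 + theta / 2); last by field.
      rewrite powRD ?(gt_eqF c10) ?implybT//; apply: ler_pM; rewrite ?powR_ge0//.
      - by rewrite mulr_ge0 ?powR_ge0// mulr_ge0// addr_ge0// ltW.
      - apply: le_trans c1_p _; rewrite -[leLHS](powRr1 (ltW c10)) ler_powR//.
        by rewrite ler_pdivlMr// mul1r -lerBlDr; move: s12; clear; lra.
      - have -> : (6 * M) `^ theta = ((6 * M) ^+ 2) `^ (theta / 2).
          by rewrite -(powR_mulrn _ M6) -powRrM; congr (_ `^ _); field.
        by apply: ge0_ler_powR; rewrite ?nnegrE ?divr_ge0 ?(ltW c10) ?sqr_ge0.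
    apply: ge0_ler_powR => //; rewrite nnegrE; last exact: ltW.
    by rewrite mulr_ge0 ?powR_ge0 ?(ltW c10).
  rewrite rhoE qE.
  have a0 : 0 < D `^ (4 * s) by rewrite powR_gt0.
  have t0 : 0 < D `^ theta by rewrite powR_gt0.
  exact: grid_arith.
Qed.

Lemma four_le_sum {R : realDomainType} (a b c : R) : 0 <= a -> 0 <= b -> 0 <= c ->
  [/\ 1 <= 1 + a + b + c, a <= 1 + a + b + c, b <= 1 + a + b + c & c <= 1 + a + b + c].
Proof. by move=> a0 b0 c0; split; lra. Qed.

(** Both square roots are at most twice the simpler quantities, [sqrt L] and [Z], and the quotient
    leaves a 4, so 16 = 2 * 4 * 2. *)
Lemma power_arith {R : realType} (L Z G v n : R) : 0 < L -> 0 < n -> 0 < Z -> 0 < v ->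
  v <= Z ^+ 2 -> 16 * Num.sqrt L * Z <= n * G ->
  Num.sqrt (3 * L) <= 2 / (n * Num.sqrt (2 * v)) * (n ^+ 2 * G / 8).
Proof.
move=> L0 n0 Z0 v0 vZ h.
have v2 : 0 < Num.sqrt (2 * v) by rewrite sqrtr_gt0 mulr_gt0.
have -> : 2 / (n * Num.sqrt (2 * v)) * (n ^+ 2 * G / 8) = (n * G) / (4 * Num.sqrt (2 * v)).
  by field; rewrite !gt_eqF.
rewrite ler_pdivlMr ?mulr_gt0//; apply: le_trans h.
have h4 : Num.sqrt 4 = 2 :> R by rewrite (_ : 4 = 2 ^+ 2) ?sqrtr_sqr ?ger0_norm//; ring.
have h3 : Num.sqrt (3 * L) <= 2 * Num.sqrt L.
  by rewrite -h4 -sqrtrM// ler_wsqrtr// ler_wpM2r ?(ltW L0)// ler_nat.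
have hv : Num.sqrt (2 * v) <= 2 * Z.
  have -> : 2 * Z = Num.sqrt (4 * Z ^+ 2) by rewrite sqrtrM// h4 sqrtr_sqr ger0_norm// ltW.
  by rewrite ler_wsqrtr//; apply: ler_pM => //; [exact: ltW | rewrite ler_nat].
have -> : 16 * Num.sqrt L * Z = (2 * Num.sqrt L) * (4 * (2 * Z)) by ring.
by apply: ler_pM; rewrite ?sqrtr_ge0 ?mulr_ge0 ?sqrtr_ge0// ler_wpM2l.
Qed.

Lemma chebyshev_arith {R : realType} (z q S : R) : 0 <= z -> 0 <= q -> 1 <= S -> z <= q / S ->
  64 * (4 * z ^+ 2 + 2 * z) <= 64 * (4 * q ^+ 2 + 2 * q) / S.
Proof.
move=> z0 q0 S1 zq; have S0 : 0 < S by exact: lt_le_trans S1.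
have zS : z * S <= q by rewrite -ler_pdivlMr.
have z2 : z ^+ 2 * S <= q ^+ 2.
  apply: (@le_trans _ _ ((z * S) ^+ 2)).
    rewrite exprMn ler_wpM2l ?sqr_ge0// expr2 ler_peMr// ltW//.
  by rewrite ler_sqr ?nnegrE// mulr_ge0// ltW.
rewrite ler_pdivlMr//; nra.
Qed.

(** * Power *)

Lemma power_rate {d} {T : measurableType d} {R : realType}
  (P0 : probability T R) (lam : nat -> R) (phi : nat -> T -> R) (s M : R) :
  standing_setup P0 lam phi s -> 0 < M ->
  exists c1 K A0 : R, 0 < c1 /\ forall n, A0 <= loglog n ->
  forall (theta Delta : R), 0 <= theta ->
  c1 * (Num.sqrt (loglog n) / n%:R) `^ (4 * s / (4 * s + theta + 1)) <= Delta ->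
  forall P : probability T R, inCalP P0 lam phi Delta theta M P ->
  forall (d' : measure_display) (Om : measurableType d') (Q : probability Om R)
         (X : nat -> Om -> T), iid_sample Q P n X ->
  ((1 - K / Num.sqrt (loglog n))%:E <=
     Q [set w | (Num.sqrt (3 * loglog n) <= Ttilde lam phi s n (fun i => X i w))%R])%E.
Proof.
move=> [[lam0 lamd] [mphi [orth mean]] basis [s12 [einf esup]] [B0 phiB0]] M0.
pose B := Num.max B0 1.
have B_gt0 : 0 < B by rewrite lt_max ltr01 orbT.
have phiB k x : `|phi k x| <= B by rewrite le_max phiB0.
have mean' k : Ex P0 (phi k) = 0 by rewrite /Rintegral mean.
have [C [c [C_gt0 c0 spec]]] := spectral_bounds lam0 s12 einf esup.
have s0 : 0 < s by apply: lt_trans s12; rewrite divr_gt0.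
pose b : R := 2 * s / (4 * s + 1).
have s41 : 0 < 4 * s + 1 by rewrite addr_gt0// mulr_gt0.
have b0 : 0 < b by rewrite divr_gt0// mulr_gt0.
have [A0 [A1 hA]] := r_pow_le_half b0.
(* At scale 1 the weights and the eigenvalues are comparable, since [lam k + 1 <= lam 0 + 1]. *)
have slam : cvgn (series lam).
  have [sw1 _ _] := spec 1 (introT andP (conj ltr01 (lexx 1))).
  apply: (@summable_le _ _ (fun k => (lam 0%N + 1) * wgt lam 1 k)) => [k|].
    have lk := lam0 k; have l0 : lam k <= lam 0%N.
      by elim: k {lk} => // k ih; exact: le_trans (ltW (lamd k)) ih.
    rewrite (ltW lk)/= /wgt expr1n mulrA ler_pdivlMr ?addr_gt0// mulrC ler_wpM2r ?(ltW lk)//.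
    by rewrite lerD2r.
  exact: (@is_cvg_seriesZ _ (wgt lam 1) (lam 0%N + 1)).
pose CM : R := 3 * M ^+ 2 + 3 * (lam 0%N * (1 + M ^+ 2)).
have M2 : 0 < M ^+ 2 by exact: exprn_gt0.
have CM0 : 0 < CM by rewrite addr_gt0 ?mulr_gt0// addr_gt0.
(* [mu^2 >= C] makes [Z], defined below, dominate the square root of the trace [rsum w]. *)
pose mu : R := 1 + C; have mu0 : 0 < mu by rewrite addr_gt0.
have mu2 : C <= mu ^+ 2 by rewrite /mu; move: C_gt0; clear; nra.
(* The summand [CM] keeps [rho0] above the first grid point. The factor 144 = 16 * 9 combines the 16
   of [power_arith] with the 1/9 in the lower bound on the energy. *)
pose C0 : R := CM + 144 * mu.
have C0_gt0 : 0 < C0 by rewrite addr_gt0// mulr_gt0.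
have C0_CM : CM <= C0 by rewrite lerDl mulr_ge0// ltW.
have C0_mu : 144 * mu <= C0 by rewrite lerDr ltW.
pose c1 : R := 1 + C0 + (6 * M) ^+ 2 + 12 * (1 + M) * C0 `^ (2 * s).
have q0 : 0 <= 12 * (1 + M) * C0 `^ (2 * s).
  by rewrite mulr_ge0 ?powR_ge0// mulr_ge0// addr_ge0// ltW.
have M6 : 0 <= (6 * M) ^+ 2 by exact: sqr_ge0.
have [c1_1 c1_C0 c1_M c1_q] : [/\ 1 <= c1, C0 <= c1, (6 * M) ^+ 2 <= c1 &
    12 * (1 + M) * C0 `^ (2 * s) <= c1].
  by apply: four_le_sum => //; exact: ltW.
(* From [p^2 <= 2 u^2 + 2] and the uniform bound [CM], the second moment of p is at most [sg], hence
   at most [sg^2] because [sg >= 1]. *)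
pose sg : R := 2 + 2 * CM; have sg0 : 0 < sg by rewrite addr_gt0// mulr_gt0.
pose q : R := 9 * (B * mu * sg) / C0.
have q_ge0 : 0 <= q by rewrite divr_ge0 ?(ltW C0_gt0)// !mulr_ge0 ?ltW.
exists c1, (64 * (4 * q ^+ 2 + 2 * q)), A0; split; first exact: lt_le_trans c1_1.
move=> n An theta Delta th0 hDelta P [p [mp PE Fp DP]] d' Om Q X iid.
have L1 : 1 <= loglog n :> R by exact: le_trans A1 An.
have L0 : 0 < loglog n :> R by exact: lt_le_trans L1.
have [r1 rb] := hA n An.
have [n0 nE xE r0] := loglog_ge1 L1.
have [sL1 sL2 _] := sqrt_loglog L1.
have rho_le1 j : (j <= m_star s n)%N -> 0 < 2 ^+ j * rho_star s n <= 1 by exact: grid_le1.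
have nR : 0 < n%:R :> R by rewrite ltr0n.
pose u x := p x - 1.
have Lu : L2 P0 u by case: Fp => [[_ [[]]]|[_ []]].
have Lp : L2 P0 p.
  have := L2D Lu (bmf_L2 P0 (bmf_cst 1)); congr L2; apply/funext => x.
  by rewrite /u subrK.
have EP f : bmf f -> Ex P f = Ex P0 (fun x => f x * p x).
  by move=> bf; have [] := Ex_change_of_measure (L2_itg Lp) PE bf.
have Eu k : Ex P (phi k) = Ex P0 (fun x => u x * phi k x).
  have bk := phi_bmf mphi phiB k; have Lk := bmf_L2 P0 bk.
  rewrite (EP _ bk) -[LHS]subr0 -(mean' k) -(ExB (L2M Lk Lp) (L2_itg Lk)).
  by apply: eq_Rintegral => x _; rewrite /u; ring.
pose D2 := Ex P0 (fun x => u x ^+ 2).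
have D2CM : D2 <= CM by exact: (alt_size_le mphi phiB orth mean' lam0 lamd slam basis M0 Lu Fp).
have hD2 : c1 * (Num.sqrt (loglog n) / n%:R) `^ (4 * s / (4 * s + theta + 1)) <= D2.
  exact: le_trans hDelta DP.
have D2_gt0 : 0 < D2.
  by apply: lt_le_trans hD2; rewrite mulr_gt0 ?powR_gt0// (lt_le_trans ltr01).
pose D := Num.sqrt D2; have D_gt0 : 0 < D by rewrite sqrtr_gt0.
have DD : D ^+ 2 = D2 by rewrite sqr_sqrtr// ltW.
have [k] : exists k, let rho := 2 ^+ k * rho_star s n in
   [/\ (k <= m_star s n)%N, 0 < rho <= 1,
    rho `^ (- s^-1) <= (D ^+ 2 / (C0 * (Num.sqrt (loglog n) / n%:R))) ^+ 2 &
    rho * ((1 + M) * (6 * M / D) `^ theta) <= D / 6].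
  by apply: (@grid_exists _ s M CM C0 c1) => //; rewrite DD.
set rho := _ * rho_star s n => /= -[km rho01 rhoE rhoD].
have [sw N1 vlb] := spec _ rho01.
set w := wgt lam rho in sw N1 vlb.
have rho0 : 0 < rho by case/andP: rho01.
have w01 j : 0 <= w j <= 1 by have /andP[/ltW -> ->] := wgt_bounds lam0 j rho0.
have v0 : 0 < vn lam rho by apply: lt_le_trans vlb; rewrite mulr_gt0 ?powR_gt0.
have vN1 : vn lam rho <= rsum w.
  apply: rsum_le => // j; have /andP[w0 w1] := w01 j.
  by rewrite sqr_ge0/= expr2 ler_piMr.
(* The bound on [rho^(-1/s)] from [grid_exists] makes [Z^2] an upper bound for the trace, and
   [sqrt (loglog n) / r = n] turns [sqrt (loglog n) * Z] into a multiple of [n * D2]. *)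
pose Z := mu * (D2 / (C0 * (Num.sqrt (loglog n) / n%:R))).
have Z0 : 0 < Z by rewrite mulr_gt0// divr_gt0// mulr_gt0.
have NZ : rsum w <= Z ^+ 2.
  apply: le_trans N1 _; rewrite exprMn; apply: ler_pM => //.
  - exact: ltW.
  - exact: powR_ge0.
  - by rewrite -DD.
pose G := rsum (fun j => w j * Ex P (phi j) ^+ 2).
have GD : D2 / 9 <= G.
  have en := energy_summable (P := P) mphi phiB w01 sw.
  move: en; rewrite /G (_ : (fun j => _) = (fun j => w j * Ex P0 (fun x => u x * phi j x) ^+ 2)).
    move=> en.
    exact: (alt_energy mphi phiB orth mean' lam0 lamd slam basis M0 Lu Fp).
  by apply/funext => j; rewrite Eu.
have G0 : 0 < G by apply: lt_le_trans GD; rewrite divr_gt0.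
have S2 : Ex P0 (fun x => p x ^+ 2) <= sg ^+ 2.
  have i2 := L2_sqr Lu; have ic := bmf_itg P0 (bmf_cst 2).
  apply: (@le_trans _ _ (Ex P0 (fun x => 2 * u x ^+ 2 + 2))).
    apply: Ex_le; [exact: L2_sqr | exact: itgD (itgZ 2 i2) ic |].
    by move=> x; rewrite -subr_ge0 /u (_ : _ - _ = (p x - 2) ^+ 2) ?sqr_ge0//; ring.
  rewrite (ExD (itgZ 2 i2) ic) (ExZ 2 i2) Ex_cst -/D2.
  apply: (@le_trans _ _ sg); first by rewrite /sg addrC lerD2l ler_wpM2l.
  by rewrite expr2 ler_peMr ?(ltW sg0)// /sg -[leLHS]addr0 lerD ?ler1n// mulr_ge0// ltW.
pose cc := 2 / (n%:R * Num.sqrt (2 * vn lam rho)).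
have v2 : 0 < Num.sqrt (2 * vn lam rho) by rewrite sqrtr_gt0 mulr_gt0.
have cc0 : 0 < cc by rewrite divr_gt0// mulr_gt0.
have n1 : (1 < n)%N.
  by rewrite -(ltr1n R) nE xE -expR0 ltr_expR expR_gt0.
have rnE : Num.sqrt (loglog n) / (Num.sqrt (loglog n) / n%:R) = n%:R :> R.
  by field; rewrite !gt_eqF// (lt_le_trans ltr01).
have tG : Num.sqrt (3 * loglog n) <= cc * (n%:R ^+ 2 * G / 8).
  apply: (power_arith L0 nR Z0 v0 (le_trans vN1 NZ)).
  have -> : 16 * Num.sqrt (loglog n) * Z = 144 * mu * (D2 / 9 * n%:R) / C0.
    by rewrite /Z -[X in _ = _ * (_ * X) / _]rnE; field; rewrite !gt_eqF// (lt_le_trans ltr01).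
  rewrite ler_pdivrMr// mulrC; apply: ler_pM => //; rewrite ?mulr_ge0 ?divr_ge0 ?(ltW D2_gt0) ?(ltW mu0)//.
  by rewrite mulrC ler_wpM2l.
have [Y [bY Y0 YT EY]] := alt_chebyshev iid mphi phiB orth w01 sw Lp EP n1 G0 Z0 B_gt0 sg0 NZ S2 cc0 tG.
have EYq : Ex Q Y <= 64 * (4 * q ^+ 2 + 2 * q) / Num.sqrt (loglog n).
  apply: le_trans EY _.
  set z := B * Z * sg / (n%:R * G).
  have zq : z <= q / Num.sqrt (loglog n).
    rewrite /z ler_pdivrMr ?mulr_gt0//.
    have -> : B * Z * sg = q / Num.sqrt (loglog n) * (n%:R * (D2 / 9)).
      by rewrite /Z /q; field; rewrite !gt_eqF// (lt_le_trans ltr01).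
    apply: ler_wpM2l; first by rewrite divr_ge0 ?(le_trans ler01 sL1).
    by rewrite ler_wpM2l// ltW.
  have z0 : 0 <= z.
    by apply/ltW/divr_gt0; apply: mulr_gt0 => //; exact: mulr_gt0.
  exact: chebyshev_arith.
have mY : measurable [set om | 1 <= Y om].
  by case: bY => mY _; exact: measurable_superlevel.
have mS : measurable [set om | Num.sqrt (3 * loglog n) <= Ttilde lam phi s n (fun i => X i om)].
  apply: measurable_superlevel; apply: measurable_Ttilde => j jm; apply: (measurable_Tstat iid mphi phiB n0).
    by move=> i; have /andP[rj _] := rho_le1 j jm; have /andP[/ltW] := wgt_bounds lam0 i rj.
  by have [] := spec _ (rho_le1 j jm).
apply: (@le_trans _ _ (Q (~` [set om | 1 <= Y om]))).
  rewrite probability_setC// EFinB; apply: leeB => //.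
  apply: le_trans (markov_Ex Q ltr01 bY Y0) _.
  by rewrite divr1 lee_fin.
apply: le_measure; rewrite ?inE//; first exact: measurableC.
move=> om /negP; rewrite -ltNge => /YT YT'.
rewrite /=; apply: le_trans (_ : Tstat lam phi rho n (fun i => X i om) <= _).
  by rewrite (Tstat_ker _ mphi phiB) // => j; case/andP: (w01 j).
by apply: bigmax_seq_ge; rewrite mem_index_iota ltnS.
Qed.

Lemma div_sqrt_le {R : realType} (K eps L : R) : 0 < eps -> 0 < L -> (K / eps) ^+ 2 <= L ->
  K / Num.sqrt L <= eps.
Proof.
move=> e0 L0 h; rewrite ler_pdivrMr ?sqrtr_gt0// mulrC -ler_pdivrMr//.
apply: le_trans (ler_norm _) _; rewrite -sqrtr_sqr.
exact: ler_wsqrtr.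
Qed.

(** The limits are spelled out with N chosen before theta, P and the probability space carrying the
    sample; this order of quantifiers expresses the infimum over the union of the classes. *)
Theorem theorem5 (R : realType) (d : measure_display) (T : measurableType d)
  (P0 : probability T R) (lam : nat -> R) (phi : nat -> T -> R) (s M : R) :
  standing_setup P0 lam phi s -> 0 < M ->
  (* (i) *)
  (forall eps : R, 0 < eps -> exists N : nat, forall n : nat, (N <= n)%N ->
     forall (d' : measure_display) (Om : measurableType d') (Q : probability Om R)
            (X : nat -> Om -> T),
     iid_sample Q P0 n X ->
     (Q [set w | (Num.sqrt (3 * loglog n) <= Ttilde lam phi s n (fun i => X i w))%R]
        <= eps%:E)%E)
  /\
  (* (ii) *)
  (exists c1 : R, 0 < c1 /\
   forall Delta : nat -> R -> R,
     (forall (n : nat) (theta : R), 0 <= theta ->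
        c1 * (Num.sqrt (loglog n) / n%:R) `^ (4 * s / (4 * s + theta + 1))
          <= Delta n theta) ->
     forall eps : R, 0 < eps -> exists N : nat, forall n : nat, (N <= n)%N ->
       forall (theta : R), 0 <= theta ->
       forall P : probability T R, inCalP P0 lam phi (Delta n theta) theta M P ->
       forall (d' : measure_display) (Om : measurableType d') (Q : probability Om R)
              (X : nat -> Om -> T),
       iid_sample Q P n X ->
       ((1 - eps)%:E <=
          Q [set w | (Num.sqrt (3 * loglog n) <= Ttilde lam phi s n (fun i => X i w))%R])%E).
Proof.
move=> setup M0; split.
  have [K [A0 hK]] := null_rejection_rate setup.
  move=> eps eps0.
  (* The last bound, [loglog n >= (K / eps)^2], is what makes [K / sqrt (loglog n)] at most eps. *)
  have [N hN] := loglog_large (Num.max (Num.max A0 1) ((K / eps) ^+ 2)).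
  exists N => n /hN; rewrite !ge_max -andbA => /and3P[LA L1 LK] d' Om Q X iid.
  apply: le_trans (hK n LA _ _ _ _ iid) _.
  by rewrite lee_fin; apply: div_sqrt_le => //; exact: lt_le_trans L1.
have [c1 [K [A0 [c10 hK]]]] := power_rate setup M0.
exists c1; split => // Delta hDelta eps eps0.
have [N hN] := loglog_large (Num.max (Num.max A0 1) ((K / eps) ^+ 2)).
exists N => n /hN; rewrite !ge_max -andbA => /and3P[LA L1 LK] theta th0 P hP d' Om Q X iid.
apply: le_trans (hK n LA theta _ th0 (hDelta n theta th0) P hP _ _ _ _ iid).
by rewrite lee_fin lerD2l lerN2; apply: div_sqrt_le => //; exact: lt_le_trans L1.
Qed.
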